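(* Let $R$ be an Artinian homogeneous graded ring over a field $k$ with graded maximal ideal $\mathfrak m$. Assume that $R$ is not a Gorenstein ring, and that $R$ has a nontrivial deformation. Then the following conditions are equivalent: (1) $R$ has a nonfree (finitely generated) module of G-dimension zero, and $\mathfrak m^3=(0)$. (2) The Hilbert series of $R$ is $H_R(t)=(1+t)(1+rt)$ for some integer $r\ge 2$. (3) There is a one-dimensional Cohen-Macaulay homogeneous graded ring $S$ over $k$ with minimal multiplicity and a homogeneous non-zero divisor $f$ of $S$ of degree $2$ such that $R\cong S/fS$. Furthermore, under condition (3), one has $$\mathrm{G}\text{-}\dim_R M=\mathrm{pd}_S M-1\ (\le\infty)$$ for any finitely generated $R$-module $M$. (Therefore $\mathrm{G}\text{-}\dim_R M=\mathrm{CI}\text{-}\dim_R M$.)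
   Context: A homogeneous graded ring over a field $k$ is a residue ring of a polynomial ring over $k$ in finitely many variables, all of degree one, by a homogeneous ideal. Its graded maximal ideal is the ideal generated by the elements of positive degree. The Hilbert series is $H_R(t)=\sum_i(\dim_k R_i)t^i$. All modules are finitely generated. An Artinian homogeneous graded ring is a local ring with maximal ideal $\mathfrak m$. Nontrivial deformation: an Artinian homogeneous graded ring $R$ over a field $k$ has a nontrivial deformation if there are a homogeneous Cohen-Macaulay graded ring $S$ over $k$ of positive dimension $d$ and a homogeneous regular sequence $f_1,\dots,f_d$ of $S$, all of degree $\ge 2$, such that $R\cong S/(f_1,\dots,f_d)S$. Minimal multiplicity: a Cohen-Macaulay ring $S$ with (graded) maximal ideal $\mathfrak n$ has minimal multiplicity if there is a system of parameters $\underline x=x_1,\dots,x_d$ with $\underline x\,\mathfrak n=\mathfrak n^2$. G-dimension: a finitely generated $R$-module $M$ has G-dimension zero if (i) the natural map $M\to \mathrm{Hom}_R(\mathrm{Hom}_R(M,R),R)$ is an isomorphism, (ii) $\mathrm{Ext}^i_R(M,R)=0$ for all $i>0$, and (iii) $\mathrm{Ext}^i_R(\mathrm{Hom}_R(M,R),R)=0$ for all $i>0$. One writes $\mathrm{G}\text{-}\dim_R M\le n$ if the $n$-th syzygy module of $M$ has G-dimension zero, and $\mathrm{G}\text{-}\dim_R M=\infty$ if there is no such $n$. $\mathrm{pd}_S$ denotes projective dimension over $S$. CI-dimension (Avramov-Gasharov-Peeva): for a nonzero finitely generated module $M$ over a Noetherian local ring $R$, $\mathrm{CI}\text{-}\dim_R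 M=\inf\{\mathrm{pd}_Q(M\otimes_R R')-\mathrm{pd}_Q R'\}$, the infimum being over all diagrams of local homomorphisms $R\to R'\leftarrow Q$ of Noetherian local rings with $R\to R'$ flat and $Q\to R'$ surjective with kernel generated by a $Q$-regular sequence. *)

(* Defs.v *)
From HB Require Import structures.
From mathcomp Require Import all_boot all_order all_algebra.
From mathcomp Require Import boolp classical_sets functions constructive_ereal.
From mathcomp Require Import (canonicals,coercions) mpoly.

Set Implicit Arguments.
Unset Strict Implicit.
Unset Printing Implicit Defensive.

Import Order.TTheory GRing.Theory Num.Theory.

Local Open Scope classical_set_scope.
Local Open Scope ring_scope.

Section Ideals.
Variable A : comNzRingType.
Implicit Types (I J P : set A) (s : seq A).

Definition is_ideal I :=
  [/\ I 0, forall x y, I x -> I y -> I (x + y) & forall a x, I x -> I (a * x)].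

Definition ideal_mul I J : set A :=
  [set x | exists s : seq (A * A),
     (forall p, p \in s -> I p.1 /\ J p.2) /\ x = \sum_(p <- s) p.1 * p.2].

Fixpoint ideal_exp I n : set A :=
  if n is n'.+1 then ideal_mul I (ideal_exp I n') else setT.

Definition ideal_gen (G : set A) : set A := ideal_mul setT G.

Definition ideal_span s : set A := ideal_gen [set` s].

Definition maximal_ideal P :=
  [/\ is_ideal P, ~ P 1 &
      forall J, is_ideal J -> ~ J 1 -> P `<=` J -> J = P].

Definition prime_ideal P :=
  [/\ is_ideal P, ~ P 1 & forall x y, P (x * y) -> P x \/ P y].

Definition is_noetherian := forall I, is_ideal I -> exists s, I = ideal_span s.

Definition is_artinian :=
  forall I : nat -> set A,
    (forall n, is_ideal (I n)) -> (forall n, I n.+1 `<=` I n) ->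
    exists N, forall n, (N <= n)%N -> I n = I N.

Definition is_local :=
  exists2 P, maximal_ideal P & forall J, maximal_ideal J -> J = P.

Definition prime_chain n (p : nat -> set A) :=
  (forall i, (i <= n)%N -> prime_ideal (p i)) /\
  (forall i, (i < n)%N -> p i `<` p i.+1).

Definition krull_dim (d : nat) :=
  (exists p, prime_chain d p) /\ (forall n p, prime_chain n p -> (n <= d)%N).

Definition height P (h : nat) :=
  (exists p, prime_chain h p /\ p h = P) /\
  (forall n p, prime_chain n p -> p n = P -> (n <= h)%N).

Definition regular_seq s :=
  ~ ideal_span s 1 /\
  forall i, (i < size s)%N -> forall x,
    ideal_span (take i s) (nth 0 s i * x) -> ideal_span (take i s) x.

Definition depth P (h : nat) :=
  (exists s, [/\ regular_seq s, [set` s] `<=` P & size s = h]) /\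
  (forall s, regular_seq s -> [set` s] `<=` P -> (size s <= h)%N).

(* For a Noetherian ring and a maximal ideal P, the depth of P on A and the
   height of P are the depth and the dimension of the localization at P. *)
Definition cohen_macaulay :=
  is_noetherian /\
  forall P, maximal_ideal P -> exists h, depth P h /\ height P h.

End Ideals.

Section RingMorphisms.
Variables A B : comNzRingType.

Definition kernel (phi : A -> B) : set A := [set x | phi x = 0].

Definition local_morphism (phi : A -> B) :=
  forall P P', maximal_ideal P -> maximal_ideal P' -> P `<=` phi @^-1` P'.

End RingMorphisms.

(* [N], an [lmodType B], viewed as an A-module through [phi : A -> B]. *)
Definition restr (A B : nzRingType) (phi : {rmorphism A -> B})
  (N : lmodType B) : Type := N.

Section Restr.
Variables (A B : nzRingType) (phi : {rmorphism A -> B}) (N : lmodType B).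

HB.instance Definition _ := GRing.Zmodule.on (restr phi N).

Definition restr_scale (a : A) (x : restr phi N) : restr phi N :=
  phi a *: (x : N).

Fact restr_scaleA a b x :
  restr_scale a (restr_scale b x) = restr_scale (a * b) x.
Proof. by rewrite /restr_scale rmorphM scalerA. Qed.

Fact restr_scale1 : left_id 1 restr_scale.
Proof. by move=> x; rewrite /restr_scale rmorph1 scale1r. Qed.

Fact restr_scaleDr : right_distributive restr_scale +%R.
Proof. by move=> a x y; rewrite /restr_scale scalerDr. Qed.

Fact restr_scaleDl x : {morph restr_scale^~ x : a b / a + b}.
Proof. by move=> a b; rewrite /restr_scale rmorphD scalerDl. Qed.

HB.instance Definition _ :=
  GRing.Zmodule_isLmodule.Build A (restr phi N)
    restr_scaleA restr_scale1 restr_scaleDr restr_scaleDl.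

End Restr.

Section Dual.
Variables (A : comNzRingType) (M : lmodType A).

Definition dual_pred : pred (M -> A^o) := fun f => `[< linear f >].

Fact dual_pred_submod : submod_closed dual_pred.
Proof.
split=> [|a f g].
  by apply/asboolP => b x y; rewrite /= scaler0 addr0.
move=> /asboolP lf /asboolP lg; apply/asboolP => b x y /=.
have -> z : (a *: f + g) z = a *: f z + g z by [].
rewrite lf lg !scalerDr !scalerA (mulrC a b) -!addrA; congr (_ + _).
by rewrite addrCA.
Qed.

HB.instance Definition _ :=
  GRing.isSubmodClosed.Build A (M -> A^o) dual_pred dual_pred_submod.

(* Hom_A(M, A). *)
Record dual := Dual { dual_fun :> M -> A^o; _ : dual_fun \in dual_pred }.

HB.instance Definition _ := [isSub for dual_fun].
HB.instance Definition _ := [Choice of dual by <:].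
HB.instance Definition _ := [SubChoice_isSubLmodule of dual by <:].

End Dual.

Section Modules.
Variable A : comNzRingType.
Implicit Types M N : lmodType A.

Definition fin_gen M :=
  exists (b : nat) (p : {linear 'rV[A]_b -> M}), forall x, exists v, p v = x.

Definition fin_free M := exists (b : nat) (p : {linear 'rV[A]_b -> M}), bijective p.

Definition short_exact (K L M : lmodType A)
    (i : {linear K -> L}) (p : {linear L -> M}) :=
  [/\ injective i, forall x, exists y, p y = x &
      forall y, p y = 0 <-> exists z, i z = y].

Definition projective M :=
  forall (B C : lmodType A) (g : {linear B -> C}) (f : {linear M -> C}),
    (forall c, exists b, g b = c) ->
    exists h : {linear M -> B}, forall x, g (h x) = f x.

Definition injective_module M :=
  forall (B C : lmodType A) (g : {linear B -> C}) (f : {linear B -> M}),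
    injective g -> exists h : {linear C -> M}, forall x, h (g x) = f x.

(* M has a projective resolution of length at most n. *)
Fixpoint pd_le (n : nat) M : Prop :=
  if n is n'.+1 then
    exists (K P : lmodType A) (i : {linear K -> P}) (p : {linear P -> M}),
      [/\ projective P, short_exact i p & pd_le n' K]
  else projective M.

(* M has an injective resolution of length at most n. *)
Fixpoint inj_dim_le (n : nat) M : Prop :=
  if n is n'.+1 then
    exists (E C : lmodType A) (i : {linear M -> E}) (p : {linear E -> C}),
      [/\ injective_module E, short_exact i p & inj_dim_le n' C]
  else injective_module M.

Record free_resolution M := FreeResolution {
  fr_rank : nat -> nat;
  fr_d : forall i, {linear 'rV[A]_(fr_rank i.+1) -> 'rV[A]_(fr_rank i)};
  fr_aug : {linear 'rV[A]_(fr_rank 0) -> M};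
  _ : forall x, exists y, fr_aug y = x;
  _ : forall y, fr_aug y = 0 <-> exists z, fr_d 0 z = y;
  _ : forall i y, fr_d i y = 0 <-> exists z, fr_d i.+1 z = y }.

(* Ext^i_A(M, N) = 0, for M with a resolution by finite free modules: the
   complex Hom_A(F, N) has no cohomology in degree i. *)
Definition ext_zero (i : nat) M N : Prop :=
  exists F : free_resolution M,
  match i with
  | 0 => forall g : {linear 'rV[A]_(fr_rank F 0) -> N},
           (forall y, g (fr_d F 0 y) = 0) -> forall x, g x = 0
  | j.+1 => forall g : {linear 'rV[A]_(fr_rank F j.+1) -> N},
           (forall y, g (fr_d F j.+1 y) = 0) ->
           exists h : {linear 'rV[A]_(fr_rank F j) -> N},
             forall x, g x = h (fr_d F j x)
  end.

(* The covers need not be minimal: by Schanuel's lemma Z only changes by free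
   summands, which do not affect whether its G-dimension is zero. *)
Fixpoint is_syzygy (n : nat) M (Z : lmodType A) : Prop :=
  if n is n'.+1 then
    exists (K : lmodType A) (b : nat)
      (i : {linear K -> 'rV[A]_b}) (p : {linear 'rV[A]_b -> M}),
      short_exact i p /\ is_syzygy n' K Z
  else exists p : {linear M -> Z}, bijective p.

Definition biduality M (x : M) : dual M -> A^o := fun f => f x.

Fact biduality_linear M (x : M) : biduality x \in @dual_pred A (dual M).
Proof. by apply/asboolP. Qed.

Definition to_bidual M (x : M) : dual (dual M) := Dual (biduality_linear x).

Definition Gdim_zero M :=
  [/\ fin_gen M, bijective (@to_bidual M),
      forall i, (0 < i)%N -> ext_zero i M A^o &
      forall i, (0 < i)%N -> ext_zero i (dual M) A^o].

Definition Gdim_le (n : nat) M := exists2 Z, is_syzygy n M Z & Gdim_zero Z.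

(* The least n satisfying P, +oo if there is none; the dimension of the zero
   module is -oo. *)
Definition least_dim M (P : nat -> Prop) : \bar int :=
  if `[< forall x : M, x = 0 >] then -oo%E else
  if pselect (exists n, `[< P n >]) is left ex
  then ((ex_minn ex)%:Z)%:E else +oo%E.

Definition pd M : \bar int := least_dim M (pd_le^~ M).
Definition Gdim M : \bar int := least_dim M (Gdim_le^~ M).

(* Finite self-injective dimension: the definition for Noetherian local rings. *)
Definition gorenstein := exists n, inj_dim_le n A^o.

End Modules.

Section BaseChange.
Variables (A B : comNzRingType) (phi : {rmorphism A -> B}).

Definition semilinear_map (M : lmodType A) (N : lmodType B) (j : M -> N) :=
  forall a x y, j (a *: x + y) = phi a *: j x + j y.

(* N, together with j = (x |-> x (x) 1), is the tensor product of M and B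
   over A. *)
Definition is_base_change (M : lmodType A) (N : lmodType B) (j : M -> N) :=
  semilinear_map j /\
  forall (P : lmodType B) (g : M -> P), semilinear_map g ->
    exists h : {linear N -> P},
      (forall x, h (j x) = g x) /\
      (forall h' : {linear N -> P}, (forall x, h' (j x) = g x) -> h' =1 h).

Definition flat_morphism :=
  forall (M M' : lmodType A) (f : {linear M -> M'})
    (N N' : lmodType B) (j : M -> N) (j' : M' -> N') (fB : {linear N -> N'}),
    is_base_change j -> is_base_change j' ->
    (forall x, fB (j x) = j' (f x)) -> injective f -> injective fB.

End BaseChange.

Definition quasi_deformation (A A' Q : comNzRingType)
    (phi : {rmorphism A -> A'}) (psi : {rmorphism Q -> A'}) :=
  [/\ is_noetherian A' /\ is_local A', is_noetherian Q /\ is_local Q,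
      local_morphism phi /\ flat_morphism phi,
      local_morphism psi /\ (forall x, exists y, psi y = x) &
      exists s : seq Q, regular_seq s /\ kernel psi = ideal_span s].

Definition CIdim (A : comNzRingType) (M : lmodType A) : \bar int :=
  infimum +oo%E [set v : \bar int |
    exists (A' Q : comNzRingType) (phi : {rmorphism A -> A'})
      (psi : {rmorphism Q -> A'}) (N : lmodType A') (j : M -> N),
      [/\ quasi_deformation phi psi, is_base_change phi j &
          v = (pd (restr psi N) - pd (restr psi A'^o))%E]].

(* A residue ring of a polynomial ring by a proper homogeneous ideal: a
   k-algebra with a presentation by a surjection from a polynomial ring whose
   kernel contains the homogeneous components of its elements. *)
Record homog_ring (k : fieldType) := HomogRing {
  hr_alg :> comAlgType k;
  hr_nvars : nat;
  hr_pres : {lrmorphism mpoly.mpoly hr_nvars k -> hr_alg};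
  _ : forall x, exists p, hr_pres p = x;
  _ : forall p d, hr_pres p = 0 -> hr_pres (mpoly.pihomog mpoly.mdeg d p) = 0 }.

Section HomogRings.
Variable k : fieldType.

Definition hr_comp (S : homog_ring k) (i : nat) : set S :=
  [set x | exists2 p, p \is mpoly.ishomog1 i mpoly.mdeg & hr_pres S p = x].

Definition hr_max (S : homog_ring k) : set S :=
  ideal_gen [set x | exists2 i, (0 < i)%N & hr_comp i x].

Definition has_dim (V : lmodType k) (W : set V) (n : nat) :=
  exists b : 'I_n -> V, (forall i, W (b i)) /\
    forall x, W x -> exists! c : 'rV[k]_n, x = \sum_i c 0 i *: b i.

(* The power series \sum_i h_i t^i is the Hilbert series of S. *)
Definition hilbert_series (S : homog_ring k) (h : nat -> nat) :=
  forall i, has_dim (@hr_comp S i) (h i).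

Definition graded_morphism (S R : homog_ring k) (phi : S -> R) :=
  forall i x, hr_comp i x -> hr_comp i (phi x).

(* phi induces an isomorphism of graded k-algebras from S/sS to R. *)
Definition residue_iso (S R : homog_ring k) (s : seq S)
    (phi : {lrmorphism S -> R}) :=
  [/\ graded_morphism phi, forall x, exists y, phi y = x &
      kernel phi = ideal_span s].

Definition nontrivial_deformation (R : homog_ring k) :=
  exists (S : homog_ring k) (d : nat) (s : seq S) (phi : {lrmorphism S -> R}),
    [/\ cohen_macaulay S, krull_dim S d /\ (0 < d)%N,
        regular_seq s /\ size s = d,
        forall f, f \in s -> exists2 e, (2 <= e)%N & hr_comp e f &
        residue_iso s phi].

Definition system_of_parameters (S : homog_ring k) (s : seq S) :=
  [/\ krull_dim S (size s), [set` s] `<=` @hr_max S &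
      exists r, ideal_exp (@hr_max S) r `<=` ideal_span s].

Definition minimal_multiplicity (S : homog_ring k) :=
  exists2 s : seq S, system_of_parameters s &
    ideal_mul (ideal_span s) (@hr_max S) = ideal_exp (@hr_max S) 2.

Definition minmult_deformation (R S : homog_ring k) (f : S)
    (phi : {lrmorphism S -> R}) :=
  [/\ cohen_macaulay S /\ krull_dim S 1, minimal_multiplicity S,
      hr_comp 2 f, forall x, f * x = 0 -> x = 0 & residue_iso [:: f] phi].

End HomogRings.

(* Main.v *)
From HB Require Import structures.
From mathcomp Require Import all_boot all_order all_algebra.
From mathcomp Require Import boolp classical_sets functions constructive_ereal.
From mathcomp Require Import (canonicals,coercions) mpoly.
From mathcomp Require Import generic_quotient ring_quotient.
From mathcomp Require Import ring zify.
Require Import Defs.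

Set Implicit Arguments.
Unset Strict Implicit.
Unset Printing Implicit Defensive.

Import Order.TTheory GRing.Theory Num.Theory.

Local Open Scope classical_set_scope.
Local Open Scope ring_scope.

(* All conditions are compared with the existence of a one-dimensional S and
   linear forms l, l' with R = S/(l l'), l l' regular and S_2 = l S_1.

   If R is a quotient by a regular sequence and m^3 = 0, let T be the quotient by
   all but the last element f, of degree e.  For e >= 4 one gets T_3 = 0, hence
   f = 0.  For e = 3 one gets T_3 = k f, so T_1 is spanned by a regular element and
   R = k[x]/(x^3) is Gorenstein.  For e = 2 one has T_3 = f T_1; in T[1/f] the
   elements b/f with b in T_2 form a finite-dimensional algebra, and splitting it by
   idempotents produces linear forms with l l' = f, whence T_2 = l T_1.
   Multiplication by l' maps T_1 onto T_2 by a dimension count, so T_3 = f T_1 and R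
   has Hilbert function (1, r + 1, r); for r <= 1 it carries a nondegenerate
   functional and is Gorenstein.  A further layer g of the regular sequence is
   impossible: lifting l l' = f through g makes g a multiple of l, or makes g span
   the quadrics modulo l, and then r <= 1.  Conversely R/(l) has the 1 x 1 matrix
   factorization (l, l'), so it is a nonfree module of G-dimension zero.

   For the equality of dimensions, let D be a free resolution over R of M and G its
   Shamash resolution over S.  If M has finite G- or CI-dimension, D is eventually
   exact after dualizing, and so is G.  The maximal ideal of S/l has square zero and
   at least two generators, so the homology of the reduction of G modulo the maximal
   ideal at least doubles from one high degree to the next by exactness of G, and
   from that degree back by exactness of its dual.  Hence it vanishes there and
   that syzygy N has N/lN free over S/l, a property that descends to the first
   syzygy of M over S.  It also holds if pd_S M is finite.  By Nakayama the first
   syzygy is then free up to a unit that is 1 modulo l, so M is given by a matrix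
   factorization of f and has G-dimension zero. *)

(** * Dependent choice, submodules and quotients *)

(** [S] is graded, not local: an element with nonzero residue need not be a unit. Nakayama's lemma
    is therefore replaced by computations modulo [l]. The square of the maximal ideal lies in [l S],
    so 1 + nu inverts 1 - nu modulo [l]. The remaining factor 1 - l a becomes invertible in [R]
    because l^3 lies in [f S], and an element divisible by every power of [l] vanishes because [l]
    has degree one.

    Complexes are families of matrices over one fixed ring, exact modulo an ideal. Killing an
    element then changes only the ideal, Shamash's construction is a block matrix with identities to
    check, and dualizing means passing from rows to columns.

    Freeness of N/lN over S/l is the hinge: finiteness of any of the three dimensions implies it,
    and it forces the values 0 (G-dimension), 1 (projective dimension over [S]) and 0
    (CI-dimension). The equality of dimensions is thus a dichotomy between these values and
    infinity. The bound r >= 2 supplies two independent linear forms modulo [l]; with one form the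
    growth factor of the homology would be 1 and nothing would follow. *)

Lemma dep_choice (I : Type) (B : I -> Type) (P : forall i, B i -> Prop) :
  (forall i, exists y, P i y) -> exists f, forall i, P i (f i).
Proof. by move=> h; exists (fun i => projT1 (cid (h i))) => i; case: cid. Qed.

Definition submodule (A : nzRingType) (V : lmodType A) (P : set V) :=
  P 0 /\ forall a x y, P x -> P y -> P (a *: x + y).

Section Submodules.
Variables (A : nzRingType) (V : lmodType A) (P : set V).

(** The closure proof is a parameter so that the instance below can be found from the predicate
    alone; [quom] and [quor_pred] follow the same pattern. *)
Definition subm_pred of submodule P : pred V := fun x => `[< P x >].

Variable HP : submodule P.

Fact subm_pred_closed : submod_closed (subm_pred HP).
Proof.
case: (HP) => P0 PD; split=> [|a x y]; first exact/asboolP.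
by move=> /asboolP Px /asboolP Py; apply/asboolP/PD.
Qed.

HB.instance Definition _ :=
  GRing.isSubmodClosed.Build A V (subm_pred HP) subm_pred_closed.

Record subm := Subm { subm_val :> V; _ : subm_val \in subm_pred HP }.

HB.instance Definition _ := [isSub for subm_val].
HB.instance Definition _ := [Choice of subm by <:].
HB.instance Definition _ := [SubChoice_isSubLmodule of subm by <:].

Lemma submodule_module : exists (Z : lmodType A) (i : {linear Z -> V}),
  injective i /\ forall x, (exists z, i z = x) <-> P x.
Proof.
exists (subm : lmodType A), (\val : {linear subm -> V}).
split; first exact: val_inj.
move=> x; split=> [[[z hz] <-]|Px]; first exact/asboolP.
have Px' : x \in subm_pred HP by apply/asboolP.
by exists (Subm Px').
Qed.

Local Open Scope quotient_scope.

Definition quom_rel (x y : V) := `[< P (x - y) >].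

Fact quom_rel_equiv : equiv_class_of quom_rel.
Proof.
case: (HP) => P0 PD.
have PN x : P x -> P (- x) by move=> Px; rewrite -[- x]addr0 -scaleN1r; apply: PD.
split=> [x|x y|y x z].
- by apply/asboolP; rewrite subrr.
- by apply/asboolP/asboolP => /PN; rewrite opprB.
- move=> /asboolP Pxy /asboolP Pyz; apply/asboolP.
  by rewrite -(subrKA y) -[x - y]scale1r; apply: PD.
Qed.

Canonical quom_equiv := EquivRelPack quom_rel_equiv.

Definition quom of submodule P := {eq_quot quom_rel}.

HB.instance Definition _ := Choice.on (quom HP).
HB.instance Definition _ := Quotient.on (quom HP).

Let pq (x : V) : quom HP := \pi_(quom HP) x.

Let pqP x y : pq x = pq y <-> P (x - y).
Proof.
rewrite /pq; split=> [/eqquotP|h]; first by move/asboolP.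
by apply/eqquotP/asboolP.
Qed.

Let pqK (x : quom HP) : pq (repr x) = x. Proof. exact: reprK. Qed.

Definition quom_add (x y : quom HP) := pq (repr x + repr y).
Definition quom_opp (x : quom HP) := pq (- repr x).
Definition quom_scale a (x : quom HP) := pq (a *: repr x).

Let PD x y : P x -> P y -> P (x + y).
Proof. by case: HP => P0 h Px Py; rewrite -[x]scale1r; apply: h. Qed.
Let PZ a x : P x -> P (a *: x).
Proof. by case: HP => P0 h Px; rewrite -[_ *: _]addr0; apply: h. Qed.

Let addE x y : quom_add (pq x) (pq y) = pq (x + y).
Proof.
apply/pqP; rewrite opprD addrACA; apply: PD; exact/pqP/pqK.
Qed.
Let oppE x : quom_opp (pq x) = pq (- x).
Proof.
apply/pqP; have -> : - repr (pq x) - - x = (-1) *: (repr (pq x) - x) by rewrite scaleN1r opprD.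
by apply/PZ/pqP/pqK.
Qed.
Let scaleE a x : quom_scale a (pq x) = pq (a *: x).
Proof. by apply/pqP; rewrite -scalerBr; apply: PZ; apply/pqP/pqK. Qed.

Let pqW (Q : quom HP -> Prop) : (forall x, Q (pq x)) -> forall x, Q x.
Proof. by move=> h x; rewrite -[x]pqK. Qed.

Fact quom_addA : associative quom_add.
Proof.
by elim/pqW=> x; elim/pqW=> y; elim/pqW=> z; rewrite !addE addrA.
Qed.
Fact quom_addC : commutative quom_add.
Proof. by elim/pqW=> x; elim/pqW=> y; rewrite !addE addrC. Qed.
Fact quom_add0 : left_id (pq 0) quom_add.
Proof. by elim/pqW=> x; rewrite !addE add0r. Qed.
Fact quom_addN : left_inverse (pq 0) quom_opp quom_add.
Proof. by elim/pqW=> x; rewrite oppE !addE addNr. Qed.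

HB.instance Definition _ :=
  GRing.isZmodule.Build (quom HP) quom_addA quom_addC quom_add0 quom_addN.

Fact quom_scaleA a b x : quom_scale a (quom_scale b x) = quom_scale (a * b) x.
Proof. by elim/pqW: x => x; rewrite !scaleE scalerA. Qed.
Fact quom_scale1 : left_id 1 quom_scale.
Proof. by elim/pqW=> x; rewrite !scaleE scale1r. Qed.
Fact quom_scaleDr : right_distributive quom_scale +%R.
Proof.
move=> a; elim/pqW=> x; elim/pqW=> y.
change (quom_scale a (quom_add (pq x) (pq y)) =
  quom_add (quom_scale a (pq x)) (quom_scale a (pq y))).
by rewrite addE !scaleE addE scalerDr.
Qed.
Fact quom_scaleDl x : {morph quom_scale^~ x : a b / a + b}.
Proof.
elim/pqW: x => x a b.
change (quom_scale (a + b) (pq x) =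
  quom_add (quom_scale a (pq x)) (quom_scale b (pq x))).
by rewrite !scaleE addE scalerDl.
Qed.

HB.instance Definition _ :=
  GRing.Zmodule_isLmodule.Build A (quom HP)
    quom_scaleA quom_scale1 quom_scaleDr quom_scaleDl.

Fact quom_pi_linear : linear pq.
Proof.
move=> a x y; change (pq (a *: x + y) = quom_add (quom_scale a (pq x)) (pq y)).
by rewrite scaleE addE.
Qed.

Lemma quotient_module : exists (Q : lmodType A) (p : {linear V -> Q}),
  (forall y, exists x, p x = y) /\ (forall x, p x = 0 <-> P x).
Proof.
exists (quom HP : lmodType A).
exists (HB.pack_for {linear V -> quom HP} pq
  (GRing.isLinear.Build _ _ _ _ pq quom_pi_linear)); split.
  by move=> y; exists (repr y); rewrite /= pqK.
by move=> x /=; rewrite -[X in _ = X]/(pq 0) pqP subr0.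
Qed.

End Submodules.

(** * Algebra structures along a morphism, and quotient algebras *)

Section AlgebraOfMorphism.
Variables (k : comNzRingType) (B : comNzRingType) (g : {rmorphism k -> B}).

(** A copy of [B] tagged by [g], so that instance resolution sees which morphism defines the
    scalars. *)
Definition algm of {rmorphism k -> B} : Type := B.

HB.instance Definition _ := GRing.ComNzRing.on (algm g).

Definition algm_scale (a : k) (x : algm g) : algm g := (g a : B) * x.

Fact algm_scaleA a b x : algm_scale a (algm_scale b x) = algm_scale (a * b) x.
Proof. by rewrite /algm_scale mulrA rmorphM. Qed.
Fact algm_scale1 : left_id 1 algm_scale.
Proof. by move=> x; rewrite /algm_scale rmorph1 mul1r. Qed.
Fact algm_scaleDr : right_distributive algm_scale +%R.
Proof. by move=> a x y; rewrite /algm_scale mulrDr. Qed.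
Fact algm_scaleDl x : {morph algm_scale^~ x : a b / a + b}.
Proof. by move=> a b; rewrite /algm_scale rmorphD mulrDl. Qed.

HB.instance Definition _ :=
  GRing.Zmodule_isLmodule.Build k (algm g)
    algm_scaleA algm_scale1 algm_scaleDr algm_scaleDl.

Fact algm_scaleAl (a : k) (x y : algm g) : a *: (x * y) = (a *: x) * y.
Proof. exact: mulrA. Qed.

HB.instance Definition _ := GRing.Lmodule_isLalgebra.Build k (algm g) algm_scaleAl.

Fact algm_scaleAr (a : k) (x y : algm g) : a *: (x * y) = x * (a *: y).
Proof. exact: mulrCA. Qed.

HB.instance Definition _ := GRing.Lalgebra_isAlgebra.Build k (algm g) algm_scaleAr.

End AlgebraOfMorphism.

Section QuotientAlgebra.
Variables (A : comNzRingType) (I : set A).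
Hypotheses (HI : is_ideal I) (I1 : ~ I 1).

Definition quor_pred of is_ideal I & ~ I 1 : {pred A} := fun x => `[< I x >].

Fact quor_zmod_closed : zmod_closed (quor_pred HI I1).
Proof.
case: (HI) => I0 ID IM; split; first exact/asboolP.
move=> x y /asboolP Ix /asboolP Iy; apply/asboolP; apply: ID => //.
by rewrite -mulN1r; apply: IM.
Qed.
Fact quor_proper : 1 \notin quor_pred HI I1 /\
  forall a, {in quor_pred HI I1, forall u, a * u \in quor_pred HI I1}.
Proof.
split; first by apply/asboolP.
by move=> a x /asboolP Ix; apply/asboolP; case: HI => _ _; apply.
Qed.

HB.instance Definition _ :=
  GRing.isZmodClosed.Build A (quor_pred HI I1) quor_zmod_closed.
HB.instance Definition _ :=
  isProperIdeal.Build A (quor_pred HI I1) quor_proper.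

Lemma quotient_ring : exists (B : comNzRingType) (p : {rmorphism A -> B}),
  (forall y, exists x, p x = y) /\ (forall x, p x = 0 <-> I x).
Proof.
exists (@ring_quotient.Quotient.quot A (quor_pred HI I1) : comNzRingType).
exists (\pi_((@ring_quotient.Quotient.quot A (quor_pred HI I1)))%qT : {rmorphism _ -> _}); split.
  by move=> y; exists (repr y); exact: reprK.
move=> x; have e0 : \pi_((@ring_quotient.Quotient.quot A (quor_pred HI I1)))%qT (0 : A) = 0 by exact: rmorph0.
rewrite -e0; split=> [/eqP|Ix].
  by rewrite -Quotient.idealrBE subr0 => /asboolP.
by apply/eqP; rewrite -Quotient.idealrBE subr0; apply/asboolP.
Qed.
End QuotientAlgebra.

Lemma quotient_algebra (k : comNzRingType) (A : comAlgType k) (I : set A) :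
  is_ideal I -> ~ I 1 -> exists (B : comAlgType k) (p : {lrmorphism A -> B}),
  (forall y, exists x, p x = y) /\ (forall x, p x = 0 <-> I x).
Proof.
move=> HI I1; have [B [p [ps pk]]] := quotient_ring HI I1.
pose g : {rmorphism k -> B} := (p \o in_alg A : {rmorphism k -> B}).
have lp : scalable (p : A -> algm g).
  by move=> a x; rewrite -mulr_algl rmorphM.
pose p' := HB.pack_for {lrmorphism A -> algm g} (p : A -> algm g)
   (GRing.isScalable.Build _ _ _ _ (p : A -> algm g) lp)
   (GRing.RMorphism.on (p : A -> algm g)).
by exists (algm g : comAlgType k), p'.
Qed.

(** * Linear maps and projective modules *)

Section LinearMaps.
Variable A : comNzRingType.
Implicit Types U V W : lmodType A.

Lemma linear_pack U V (f : U -> V) : linear f ->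
  exists g : {linear U -> V}, forall x, g x = f x.
Proof.
by move=> lf; exists (HB.pack_for {linear U -> V} f (GRing.isLinear.Build _ _ _ _ f lf)).
Qed.

Lemma linear_inj U V (f : {linear U -> V}) :
  (forall x, f x = 0 -> x = 0) -> injective f.
Proof.
by move=> h x y /eqP; rewrite -subr_eq0 -linearB => /eqP/h/eqP; rewrite subr_eq0 => /eqP.
Qed.

Lemma linear_lift_inj U V W (i : {linear V -> W}) (f : {linear U -> W}) :
  injective i -> (forall x, exists y, i y = f x) ->
  exists g : {linear U -> V}, forall x, i (g x) = f x.
Proof.
move=> ii /choice[g gE].
have lg : linear g by move=> a x y; apply: ii; rewrite linearP !gE linearP.
by have [h hE] := linear_pack lg; exists h => x; rewrite hE.
Qed.

Lemma rV_linear_map U n (y : 'I_n -> U) :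
  exists h : {linear 'rV[A]_n -> U}, forall v, h v = \sum_i v 0 i *: y i.
Proof.
have lh : linear (fun v : 'rV[A]_n => \sum_i v 0 i *: y i).
  move=> a u v; rewrite scaler_sumr -big_split /=; apply: eq_bigr => i _.
  by rewrite !mxE scalerDl scalerA.
exact: linear_pack lh.
Qed.

Lemma rV_linear_ext U n (f g : {linear 'rV[A]_n -> U}) :
  (forall i, f 'e_i = g 'e_i) -> forall v, f v = g v.
Proof.
move=> fg v; rewrite (row_sum_delta v) !linear_sum; apply: eq_bigr => i _.
by rewrite !linearZ /= fg.
Qed.

Lemma linear_rVE U n (f : {linear 'rV[A]_n -> U}) v :
  f v = \sum_i v 0 i *: f 'e_i.
Proof.
rewrite {1}(row_sum_delta v) linear_sum; apply: eq_bigr => i _.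
by rewrite linearZ.
Qed.

Lemma projective_rV n : projective ('rV[A]_n : lmodType A).
Proof.
move=> B C g f gs; have /choice[y yE] : forall i, exists y, g y = f 'e_i by [].
have [h hE] := rV_linear_map y; exists h.
apply: (@rV_linear_ext _ _ (g \o h : {linear _ -> _})) => i /=.
rewrite hE (bigD1 i) //= big1 => [|j ji]; last first.
  by rewrite mxE eqxx /= (negPf ji) scale0r.
by rewrite mxE !eqxx scale1r addr0 yE.
Qed.

Lemma projective_retract U V (s : {linear V -> U}) (r : {linear U -> V}) :
  (forall x, r (s x) = x) -> projective U -> projective V.
Proof.
move=> rs pU B C g f gs.
have [h hE] := pU _ _ g (f \o r : {linear _ -> _}) gs.
by exists (h \o s : {linear _ -> _}) => x /=; rewrite hE /= rs.
Qed.

Lemma projective_prod U V :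
  projective U -> projective V -> projective (U * V)%type.
Proof.
move=> pU pV B C g f gs.
have l1 : linear (fun x : U => f (x, 0)).
  by move=> a x y; rewrite -linearP; congr (f (_, _)); rewrite /= scaler0 addr0.
have l2 : linear (fun y : V => f (0, y)).
  by move=> a x y; rewrite -linearP; congr (f (_, _)); rewrite /= scaler0 addr0.
have [f1 f1E] := linear_pack l1; have [f2 f2E] := linear_pack l2.
have [h1 h1E] := pU _ _ g f1 gs; have [h2 h2E] := pV _ _ g f2 gs.
exists ((h1 \o fst) \+ (h2 \o snd) : {linear _ -> _}) => -[x y] /=.
rewrite linearD h1E h2E f1E f2E -linearD; congr (f (_, _)).
  by rewrite /= addr0.
by rewrite /= add0r.
Qed.

Lemma projective_section U V (p : {linear U -> V}) :
  (forall y, exists x, p x = y) -> projective V ->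
  exists s : {linear V -> U}, forall y, p (s y) = y.
Proof.
by move=> ps pV; have [s sE] := pV _ _ p (idfun : {linear V -> V}) ps; exists s.
Qed.

(** A section embeds the projective module in a free one, where a nonzerodivisor of the ring acts
    injectively on each coordinate. *)
Lemma projective_torsion_free U n (p : {linear 'rV[A]_n -> U}) x :
  (forall y, exists v, p v = y) -> projective U ->
  (forall y : A, x * y = 0 -> y = 0) ->
  forall y : U, x *: y = 0 -> y = 0.
Proof.
move=> ps pU xreg y xy0; have [s sE] := projective_section ps pU.
rewrite -(sE y); suff -> : s y = 0 by rewrite linear0.
apply/rowP => j; rewrite [RHS]mxE; apply: xreg.
by have /rowP/(_ j) : x *: s y = 0 by [rewrite -linearZ xy0 linear0]; rewrite !mxE.
Qed.

End LinearMaps.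

(** * Projective dimension up to projective summands, and Schanuel's lemma *)

Section StableEquivalence.
Variable A : comNzRingType.
Implicit Types M K P Q : lmodType A.

Lemma linear_bij M K (f : {linear M -> K}) : bijective f ->
  exists g : {linear K -> M}, cancel f g /\ cancel g f.
Proof.
case=> g fg gf; have lg : linear g.
  by move=> a x y; apply: (can_inj fg); rewrite linearP !gf.
have [h hE] := linear_pack lg.
by exists h; split=> x; rewrite hE.
Qed.

(** Induction along a resolution X -> R -> M. The kernel Z of R + P -> M + P = K + Q -> K maps onto
    Q with kernel X; as Q is projective, Z = X + Q, so X and Z are again stably isomorphic. *)
Lemma pd_le_stable n M K P Q (F : {linear (M * P)%type -> (K * Q)%type}) :
  bijective F -> projective P -> projective Q -> pd_le n M -> pd_le n K.
Proof.
elim: n M K P Q F => [|n IHn] M K P Q F bF pP pQ.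
  have [G [FG GF]] := linear_bij bF.
  move=> /= pM; have pMP := projective_prod pM pP.
  have lj : linear (fun x : K => (x, 0) : K * Q).
    by move=> a x y; congr (_, _); rewrite /= scaler0 addr0.
  have [j jE] := linear_pack lj.
  apply: (@projective_retract _ _ _ (G \o j : {linear _ -> _})
     (fst \o F : {linear _ -> _}) _ pMP) => x /=.
  by rewrite GF jE.
have [G [FG GF]] := linear_bij bF.
move=> [X [R [i [q [pR [ii qs iq] pX]]]]] /=.
have lc : linear (fun z : R * P => F (q z.1, z.2)).
  by move=> a [x y] [x' y']; rewrite -linearP; congr (F (_, _)); rewrite /= linearP.
have [c cE] := linear_pack lc.
have sZ : submodule [set z : R * P | (c z).1 = 0].
  split=> [|a x y /= hx hy]; first by rewrite /= linear0.
  by rewrite linearP /= hx hy scaler0 addr0.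
have [Z [j [ji jP]]] := submodule_module sZ.
have cj z : (c (j z)).1 = 0 by apply/jP; exists z.
exists Z, (R * P)%type, j, (fst \o c : {linear _ -> _}).
have cs (y : K * Q) : exists z, c z = y.
  have [r qr] := qs (G y).1; exists (r, (G y).2); rewrite cE /= qr.
  by rewrite -surjective_pairing GF.
split; first exact: projective_prod.
  split=> //.
    by move=> y; have [z cz] := cs (y, 0); exists z; rewrite /= cz.
  by move=> z; rewrite jP.
have [tau0 tau0E] : exists s : {linear Q -> Z}, forall y, (c (j (s y))).2 = y.
  apply: (projective_section (p := snd \o (c \o j) : {linear _ -> _})) => // y.
  have [z cz] := cs (0, y); have [w wz] : exists w, j w = z by apply/jP; rewrite /= cz.
  by exists w; rewrite /= wz cz.
have ljx : linear (fun x : X => (i x, 0) : R * P).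
  by move=> a x y; congr (_, _); rewrite /= ?linearP // scaler0 addr0.
have [jx0 jx0E] := linear_pack ljx.
have [jx jxE] : exists g : {linear X -> Z}, forall x, j (g x) = jx0 x.
  apply: linear_lift_inj => // x; apply/jP; rewrite /= cE jx0E /=.
  by have -> : q (i x) = 0 by [apply/iq; exists x]; rewrite linear0.
(* The zero module ['rV_0] gives the isomorphism X + Q = Z the shape that the induction hypothesis
   expects. *)
have l0 : linear (fun z : X * Q => (jx z.1 + tau0 z.2, 0) : Z * 'rV[A]_0).
  move=> a [x y] [x' y']; congr (_, _); rewrite /= ?scaler0 ?addr0 //.
  by rewrite !linearP scalerDr addrACA.
have [H HE] := linear_pack l0.
apply: (IHn X Z Q ('rV[A]_0) H) => //; last exact: projective_rV.
have cjx x : c (jx0 x) = 0.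
  rewrite cE jx0E /=.
  by have -> : q (i x) = 0 by [apply/iq; exists x]; rewrite linear0.
have Hi : injective H.
  apply: linear_inj => -[x y]; rewrite HE => h.
  have e : jx x + tau0 y = 0 := congr1 fst h.
  have y0 : y = 0.
    have := congr1 (fun u : Z => (c (j u)).2) e.
    by rewrite !linearD /= jxE cjx add0r tau0E !linear0.
  move: e; rewrite y0 linear0 addr0 => e.
  congr (_, _) => //; apply: ii.
  move: (congr1 (fun u : Z => (j u).1) e); rewrite jxE jx0E !linear0.
  by [].
have Hs : forall z, exists x, H x = z.
  case=> z o; pose y := (c (j z)).2.
  pose z' := z - tau0 y.
  have cz' : c (j z') = 0.
    rewrite [LHS]surjective_pairing cj.
    suff -> : (c (j z')).2 = 0 by [].
    by rewrite !linearB /= tau0E subrr.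
  move: (cz'); rewrite cE => /(congr1 G); rewrite FG linear0 => -[q0 p0].
  have [x xE] : exists x, i x = (j z').1 by apply/iq.
  exists (x, y); rewrite HE /=; congr (_, _); last by apply/rowP; case.
  suff -> : jx x = z' by rewrite subrK.
  apply: ji; rewrite jxE jx0E [RHS]surjective_pairing xE p0.
  by [].
have /choice[H' H'E] := Hs.
by exists H' => z; [apply: Hi; rewrite H'E|rewrite H'E].
Qed.

(** Schanuel's lemma: any two projective covers of [M] have stably isomorphic kernels. The truncated
    predecessor also covers n = 0, where the sequence splits. *)
Lemma pd_le_kernel n M K P (i : {linear K -> P}) (p : {linear P -> M}) :
  short_exact i p -> projective P -> pd_le n M -> pd_le n.-1 K.
Proof.
move=> [ii ps ip] pP; case: n => [|n] /=.
  move=> pM; have [s sE] := projective_section ps pM.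
  have lr : linear (fun x : P => x - s (p x)).
    move=> a x y; have -> : s (p (a *: x + y)) = a *: s (p x) + s (p y).
      by rewrite !linearP.
    by rewrite scalerBr opprD addrACA.
  have [r0 r0E] := linear_pack lr.
  have [r rE] : exists r : {linear P -> K}, forall x, i (r x) = r0 x.
    apply: linear_lift_inj => // x; have [|z zE] := (ip (r0 x)).1; last by exists z.
    by rewrite r0E linearB sE subrr.
  apply: (projective_retract (s := i) (r := r)) => // x.
  apply: ii; rewrite rE r0E; have -> : p (i x) = 0 by apply/ip; exists x.
  by rewrite linear0 subr0.
move=> [K1 [P1 [i1 [p1 [pP1 [ii1 ps1 ip1] pK1]]]]].
have [al alE] := pP _ _ p1 p ps1; have [be beE] := pP1 _ _ p p1 ps.
(* Schanuel's isomorphism from K1 + P to K + P1 sends (x, y) to (y - be z, z) with z = i1 x + al y,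
   where [al] and [be] lift the two covers through each other. *)
have lF1 : linear (fun z : K1 * P => i1 z.1 + al z.2).
  by move=> a [x y] [x' y'] /=; rewrite !linearP scalerDr addrACA.
have [F1 F1E] := linear_pack lF1.
have lF2 : linear (fun z : K1 * P => z.2 - be (F1 z)).
  move=> a x y; have -> : be (F1 (a *: x + y)) = a *: be (F1 x) + be (F1 y).
    by rewrite !linearP.
  by rewrite /= scalerBr opprD addrACA.
have [F2 F2E] := linear_pack lF2.
have pF1 z : p1 (F1 z) = p z.2.
  rewrite F1E linearD alE; have -> : p1 (i1 z.1) = 0 by apply/ip1; exists z.1.
  by rewrite add0r.
have [F3 F3E] : exists g : {linear (K1 * P)%type -> K}, forall z, i (g z) = F2 z.
  apply: linear_lift_inj => // z; have [|x xE] := (ip (F2 z)).1; last by exists x.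
  by rewrite F2E linearB beE pF1 subrr.
have lF : linear (fun z : K1 * P => (F3 z, F1 z) : K * P1).
  by move=> a x y; congr (_, _); rewrite linearP.
have [F FE] := linear_pack lF.
apply: (pd_le_stable (F := F)) pP pP1 pK1.
have Fi : injective F.
  apply: linear_inj => -[x y]; rewrite FE => -[] /= e3 e1.
  have y0 : y = 0.
    have := F3E (x, y); rewrite e3 linear0 F2E e1 linear0 subr0 /=.
    by move=> <-.
  congr (_, _) => //; apply: ii1.
  by move: e1; rewrite F1E /= y0 !linear0 addr0.
have Fs : forall z, exists x, F x = z.
  case=> x y; pose w := i x + be y.
  have pw : p w = p1 y.
    rewrite linearD beE; have -> : p (i x) = 0 by apply/ip; exists x.
    by rewrite add0r.
  have [|u uE] := (ip1 (y - al w)).1; first by rewrite linearB alE pw subrr.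
  have F1uw : F1 (u, w) = y by rewrite F1E /= uE subrK.
  exists (u, w); rewrite FE F1uw; congr (_, _); apply: ii.
  by rewrite F3E F2E F1uw /= addrK.
have /choice[H' H'E] := Fs.
by exists H' => z; [apply: Fi; rewrite H'E|rewrite H'E].
Qed.

End StableEquivalence.

(** * Acyclic complexes of matrices and Shamash's construction *)

Section MatrixEntries.
Variables (R : nzRingType) (m n : nat).
Implicit Types X Y : 'M[R]_(m, n).

Lemma mxaddE X Y i j : (X + Y) i j = X i j + Y i j. Proof. exact: mxE. Qed.
Lemma mxoppE X i j : (- X) i j = - X i j. Proof. exact: mxE. Qed.
Lemma mxscaleE a X i j : (a *: X) i j = a * X i j. Proof. exact: mxE. Qed.
Lemma mxzeroE i j : (0 : 'M[R]_(m, n)) i j = 0. Proof. exact: mxE. Qed.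

End MatrixEntries.

(* The products are kept as atoms for ring. *)
Ltac mxring :=
  rewrite /= ?(mulmxDl, mulmxDr, mulmxBl, mulmxBr, mulmxN, mulNmx, mulmxA,
            =^~ scalemxAl, =^~ scalemxAr, mul_mx_scalar, mul_scalar_mx,
            mulmx1, mul1mx, mulmx0, mul0mx);
  apply/matrixP => ? ?; rewrite ?(mxaddE, mxoppE, mxscaleE, mxzeroE); ring.

Section MatricesModIdeal.
Variable A : comNzRingType.

Definition memx (J : set A) m n (X : 'M[A]_(m, n)) := forall i j, J (X i j).

Lemma ideal_sum (J : set A) (T : Type) (r : seq T) (P : pred T) (F : T -> A) :
  is_ideal J -> (forall i, P i -> J (F i)) -> J (\sum_(i <- r | P i) F i).
Proof. move=> [J0 JD _] h; by apply: (big_ind J); [exact: J0|exact: JD|exact: h]. Qed.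

Lemma idealN (J : set A) x : is_ideal J -> J x -> J (- x).
Proof. by move=> [_ _ JM] Jx; rewrite -mulN1r; apply: JM. Qed.

Lemma idealMr (J : set A) a x : is_ideal J -> J x -> J (x * a).
Proof. by move=> [_ _ JM] Jx; rewrite mulrC; apply: JM. Qed.

Section Mem.
Variable J : set A.
Hypothesis hJ : is_ideal J.

Lemma memx0 m n : memx J (0 : 'M_(m, n)).
Proof. by case: hJ => J0 _ _ i j; rewrite mxE. Qed.

Lemma memxD m n (X Y : 'M_(m, n)) : memx J X -> memx J Y -> memx J (X + Y).
Proof. by case: hJ => _ JD _ hX hY i j; rewrite mxE; apply: JD. Qed.

Lemma memxN m n (X : 'M_(m, n)) : memx J X -> memx J (- X).
Proof. by move=> hX i j; rewrite mxE; apply: idealN. Qed.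

Lemma memxB m n (X Y : 'M_(m, n)) : memx J X -> memx J Y -> memx J (X - Y).
Proof. by move=> hX hY; apply: memxD => //; apply: memxN. Qed.

Lemma memxMl m n p (Y : 'M_(p, m)) (X : 'M_(m, n)) : memx J X -> memx J (Y *m X).
Proof.
by move=> hX i j; rewrite mxE; apply: ideal_sum => // k _; case: hJ => _ _; apply.
Qed.

Lemma memxMr m n p (X : 'M_(m, n)) (Y : 'M_(n, p)) : memx J X -> memx J (X *m Y).
Proof. by move=> hX i j; rewrite mxE; apply: ideal_sum => // k _; apply: idealMr. Qed.

Lemma memx_row_mx m n p (X : 'M_(m, n)) (Y : 'M_(m, p)) :
  memx J (row_mx X Y) <-> memx J X /\ memx J Y.
Proof.
split=> [h|[hX hY] i j]; first split=> i j.
- by have := h i (lshift _ j); rewrite row_mxEl.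
- by have := h i (rshift _ j); rewrite row_mxEr.
- by rewrite mxE; case: fintype.split => a.
Qed.

Lemma memx_col_mx m n p (X : 'M_(m, n)) (Y : 'M_(p, n)) :
  memx J (col_mx X Y) <-> memx J X /\ memx J Y.
Proof.
split=> [h|[hX hY] i j]; first split=> i j.
- by have := h (lshift _ i) j; rewrite col_mxEu.
- by have := h (rshift _ i) j; rewrite col_mxEd.
- by rewrite mxE; case: fintype.split => a.
Qed.

Lemma memx_rows m n (X : 'M_(m, n)) : memx J X <-> forall i, memx J (row i X).
Proof.
split=> [h i a j|h i j]; first by rewrite mxE.
by have := h i 0 j; rewrite mxE.
Qed.

Lemma memx_lift m n p (X : 'M_(m, n)) (B : 'M_(p, n)) :
  (forall i, exists w : 'rV_p, memx J (row i X - w *m B)) ->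
  exists W : 'M_(m, p), memx J (X - W *m B).
Proof.
move=> /choice[w wE]; exists (\matrix_i w i); apply/memx_rows => i.
by rewrite linearB /= row_mul rowK.
Qed.

End Mem.

Lemma zero_ideal : is_ideal [set 0 : A].
Proof. by split=> [|x y -> ->|a x ->] //=; rewrite ?addr0 ?mulr0. Qed.

Lemma memx_zero m n (X : 'M[A]_(m, n)) : memx [set 0] X <-> X = 0.
Proof.
split=> [h|-> i j]; last by rewrite mxE.
by apply/matrixP => i j; rewrite mxE h.
Qed.

Definition adjoin (I : set A) (x : A) : set A :=
  [set y | exists a, I (y - x * a)].

Lemma adjoin_ideal I x : is_ideal I -> is_ideal (adjoin I x).
Proof.
move=> hI; case: (hI) => I0 ID IM; split.
- by exists 0; rewrite mulr0 subr0.
- move=> y z [a ha] [b hb]; exists (a + b).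
  by rewrite mulrDr opprD addrACA; apply: ID.
- by move=> c y [a ha]; exists (c * a); rewrite mulrCA -mulrBr; apply: IM.
Qed.

Lemma memx_adjoin I x m n (X : 'M[A]_(m, n)) :
  memx (adjoin I x) X <-> exists Y, memx I (X - x *: Y).
Proof.
split=> [h|[Y hY] i j]; last by exists (Y i j); have := hY i j; rewrite !mxE.
have /choice[F FE] : forall ij : 'I_m * 'I_n, exists a, I (X ij.1 ij.2 - x * a).
  by move=> ij; exact: h.
exists (\matrix_(i, j) F (i, j)) => i j.
by rewrite !mxE; exact: (FE (i, j)).
Qed.

Lemma memx_regular I x m n (X : 'M[A]_(m, n)) :
  (forall y, I (x * y) -> I y) -> memx I (x *: X) -> memx I X.
Proof. by move=> h hX i j; apply: h; have := hX i j; rewrite mxE. Qed.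

End MatricesModIdeal.

Section Complexes.
Variable A : comNzRingType.

(** Rank in degree n - 1, with rank 0 below degree 0; the dual complex then starts from 0, and the
    block matrices of the next section have one shape in all degrees. *)
Definition bprev (b : nat -> nat) n := if n is m.+1 then b m else 0%N.

Definition dprev (b : nat -> nat) (D : forall n, 'M[A]_(b n.+1, b n)) n :
    'M[A]_(b n, bprev b n) :=
  if n is m.+1 return 'M[A]_(b n, bprev b n) then D m else 0.

(* A complex of free modules modulo J, exact in positive degrees; maps act on row
   vectors. *)
Definition row_exact (J : set A) b (D : forall n, 'M[A]_(b n.+1, b n)) :=
  (forall n, memx J (D n.+1 *m D n)) /\
  (forall n (v : 'rV_(b n.+1)), memx J (v *m D n) ->
     exists w, memx J (v - w *m D n.+1)).

(* Exactness of the dual complex in degree n. *)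
Definition col_exact (J : set A) b (D : forall n, 'M[A]_(b n.+1, b n)) n :=
  forall u : 'cV_(b n), memx J (D n *m u) ->
    exists w, memx J (u - dprev D n *m w).

Lemma row_exact_dprev J b (D : forall n, 'M[A]_(b n.+1, b n)) n :
  is_ideal J -> row_exact J D -> memx J (D n *m dprev D n).
Proof. by move=> hJ [h _]; case: n => [|n]; rewrite /= ?mulmx0; [exact: memx0|]. Qed.

Lemma row_exact_lift J b (D : forall n, 'M[A]_(b n.+1, b n)) n m (X : 'M_(m, b n.+1)) :
  row_exact J D -> memx J (X *m D n) -> exists W, memx J (X - W *m D n.+1).
Proof.
move=> [_ h] hX; apply: memx_lift => i; apply: h.
by rewrite -row_mul; move=> a j; rewrite mxE.
Qed.

End Complexes.

Section Shamash.
Variables (A : comNzRingType) (I : set A) (x : A).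
Hypotheses (hI : is_ideal I) (xreg : forall y, I (x * y) -> I y).
Let J := adjoin I x.
Variables (b : nat -> nat) (D : forall n, 'M[A]_(b n.+1, b n)).
Hypothesis hD : row_exact J D.

Let hJ : is_ideal J. Proof. exact: adjoin_ideal. Qed.

(** Ranks of the mapping cone of multiplication by [x]. The cone is twisted, since the lifted maps
    compose to x T rather than to 0. *)
Let g n := (b n + bprev b n)%N.

(* The Eisenbud-Shamash construction: D D = x T modulo I, and D, x, T assemble
   into a resolution modulo I. *)
Theorem shamash : exists G : forall n, 'M[A]_(g n.+1, g n),
  [/\ row_exact I G,
      (forall v : 'rV_(g 0), (exists w, memx I (v - w *m G 0)) <->
         (exists w, memx J (lsubmx v - w *m D 0))),
      (forall n, col_exact I G n.+1 <-> col_exact J D n) &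
      col_exact I G 0].
Proof.
have /dep_choice[T TE] : forall n, exists T : 'M_(b n.+1, bprev b n),
    memx I (D n *m dprev D n - x *: T).
  by move=> n; apply/memx_adjoin; apply: row_exact_dprev.
(* Both products, multiplied by [x], are the triple product of differentials modulo [I]; then [x] is
   cancelled. *)
have TC n : memx I (D n.+1 *m T n - T n.+1 *m dprev D n).
  apply: (memx_regular xreg).
  have -> : x *: (D n.+1 *m T n - T n.+1 *m dprev D n) =
     (D n.+1 *m D n - x *: T n.+1) *m dprev D n
     - D n.+1 *m (D n *m dprev D n - x *: T n).
    by mxring.
  by apply: memxB => //; [apply: memxMr|apply: memxMl].
pose G n : 'M[A]_(g n.+1, g n) := block_mx (D n) (- T n) x%:M (- dprev D n).
exists G; split.
- split=> [n|n v].
  + rewrite /G mulmx_block /= !mulmxN !mulNmx !opprK.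
    rewrite mul_mx_scalar mul_scalar_mx mul_mx_scalar mul_scalar_mx.
    apply/memx_col_mx; split; apply/memx_row_mx; split.
    * exact: (TE n.+1).
    * rewrite [X in memx _ X](_ : _ = - (D n.+1 *m T n - T n.+1 *m dprev D n)).
        by apply: memxN.
      by rewrite opprB addrC.
    * by rewrite subrr; apply: memx0.
    * by rewrite addrC; exact: TE.
  + rewrite -[v]hsubmxK; move: (lsubmx v) (rsubmx v) => u w {v}.
    rewrite /G mul_row_block => /memx_row_mx[+ _].
    rewrite mul_mx_scalar => h1.
    have [|z hz] := (proj2 hD) n u.
      by apply/memx_adjoin; exists (- w); rewrite scalerN opprK.
    have [y hy] := (memx_adjoin I x _).1 hz.
    exists (row_mx z y); rewrite mul_row_block opp_row_mx add_row_mx.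
    have hu : memx I (u - (z *m D n.+1 + y *m x%:M)).
      by rewrite mul_mx_scalar opprD addrA.
    apply/memx_row_mx; split=> //.
    apply: (memx_regular xreg).
    have -> : x *: (w - (z *m - T n.+1 + y *m - dprev D n.+1)) =
      (u *m D n + x *: w) - (u - (z *m D n.+1 + y *m x%:M)) *m D n
      - z *m (D n.+1 *m D n - x *: T n.+1).
      by mxring.
    apply: memxB => //; last first.
      by apply: memxMl => //; apply: (TE n.+1).
    by apply: memxB => //; apply: memxMr.
- have memx00 m (X : 'M[A]_(m, 0)) : memx I X by move=> i [].
  move=> v; rewrite -[v]hsubmxK row_mxKl; move: (lsubmx v) (rsubmx v) => u w {v}.
  split=> -[z hz].
  + exists (lsubmx z); apply/memx_adjoin; exists (rsubmx z).
    move: hz; rewrite -[z]hsubmxK /G mul_row_block opp_row_mx add_row_mx => /memx_row_mx[+ _].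
    by rewrite row_mxKl row_mxKr mul_mx_scalar opprD addrA.
  + have [y hy] := (memx_adjoin I x _).1 hz.
    exists (row_mx z y); rewrite /G mul_row_block opp_row_mx add_row_mx.
    by apply/memx_row_mx; split=> //; rewrite mul_mx_scalar opprD addrA.
- move=> n; split=> hc.
  + move=> u /memx_adjoin[y hy].
    have [|w hw] := hc (col_mx y u).
      rewrite /G mul_block_col; apply/memx_col_mx; split.
        apply: (memx_regular xreg).
        have -> : x *: (D n.+1 *m y + - T n.+1 *m u) =
          (D n.+1 *m D n - x *: T n.+1) *m u - D n.+1 *m (D n *m u - x *: y).
          by mxring.
        by apply: memxB => //; [apply: memxMr|apply: memxMl].
      rewrite (_ : _ + _ = - (D n *m u - x *: y)); last by rewrite /=; mxring.
      by apply: memxN.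
    move: hw; rewrite -[w]vsubmxK /= /G mul_block_col opp_col_mx add_col_mx.
    move=> /memx_col_mx[_ hw]; exists (- dsubmx w); apply/memx_adjoin.
    exists (usubmx w); rewrite (_ : _ - _ = u - (x%:M *m usubmx w + - dprev D n *m dsubmx w)) //.
    by mxring.
  + move=> u; rewrite -[u]vsubmxK; move: (usubmx u) (dsubmx u) => p q {u}.
    rewrite /G mul_block_col => /memx_col_mx[h1 h2].
    have [|e he] := hc q.
      apply/memx_adjoin; exists p.
      rewrite (_ : _ - _ = - (x%:M *m p + - dprev D n.+1 *m q)); last by rewrite /=; mxring.
      by apply: memxN.
    have [z hz] := (memx_adjoin I x _).1 he.
    exists (col_mx z (- e)); rewrite /= /G mul_block_col opp_col_mx add_col_mx.
    have hq : memx I (q - (x%:M *m z + - dprev D n *m - e)).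
      rewrite (_ : _ - _ = q - dprev D n *m e - x *: z) //; by mxring.
    apply/memx_col_mx; split=> //; apply: (memx_regular xreg).
    have -> : x *: (p - (D n *m z + - T n *m - e)) =
       (x%:M *m p + - dprev D n.+1 *m q) + D n *m (q - (x%:M *m z + - dprev D n *m - e))
       + (D n *m dprev D n - x *: T n) *m e.
      by mxring.
    apply: memxD => //; last exact: memxMr.
    by apply: memxD => //; apply: memxMl.
(* Degree 0: a functional killed by [G 0] is killed by [x], hence lies in [I]. *)
- move=> u; rewrite -[u]vsubmxK; move: (usubmx u) (dsubmx u) => p q {u}.
  rewrite /G mul_block_col => /memx_col_mx[h1 h2].
  exists 0; rewrite mulmx0 subr0; apply/memx_col_mx; split; last by case.
  apply: (memx_regular xreg); move: h2.
  by rewrite mul_scalar_mx (_ : - dprev D 0 *m q = 0) ?addr0 // oppr0 mul0mx.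
Qed.
End Shamash.

(** * Ideals spanned by sequences, and Shamash's construction along a regular sequence *)

Section IdealSpan.
Variable A : comNzRingType.
Implicit Types (I : set A) (s : seq A).

Lemma ideal_gen_ideal (G : set A) : is_ideal (ideal_gen G).
Proof.
split=> [|x y [s [hs ->]] [t [ht ->]]|a x [s [hs ->]]].
- by exists [::]; rewrite big_nil.
- exists (s ++ t); rewrite big_cat; split=> // p; rewrite mem_cat => /orP[/hs|/ht] //.
- exists [seq (a * p.1, p.2) | p <- s]; split=> [p /mapP[q /hs[_ hq] ->]|] //=.
  by rewrite big_map mulr_sumr; apply: eq_bigr => i _; rewrite mulrA.
Qed.

Lemma ideal_gen_mem (G : set A) x : G x -> ideal_gen G x.
Proof.
move=> Gx; exists [:: (1, x)]; rewrite big_seq1 mul1r; split=> // p.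
by rewrite inE => /eqP->.
Qed.

Lemma ideal_gen_min (G I : set A) : is_ideal I -> G `<=` I -> ideal_gen G `<=` I.
Proof.
move=> hI GI x [s [hs ->]]; rewrite big_seq; apply: ideal_sum => // p /hs[_ /GI].
by case: hI => _ _; apply.
Qed.

Lemma ideal_span_ideal s : is_ideal (ideal_span s).
Proof. exact: ideal_gen_ideal. Qed.

Lemma ideal_span_mem s x : x \in s -> ideal_span s x.
Proof. by move=> xs; apply: ideal_gen_mem. Qed.

Lemma ideal_span_min s I :
  is_ideal I -> (forall x, x \in s -> I x) -> ideal_span s `<=` I.
Proof. by move=> hI h; apply: ideal_gen_min. Qed.

Lemma ideal_span_nil : ideal_span [::] = [set 0 : A].
Proof.
apply/seteqP; split=> [|x ->]; last by case: (ideal_span_ideal [::]).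
by apply: ideal_span_min => //; apply: zero_ideal.
Qed.

Lemma ideal_span_rcons s x : ideal_span (rcons s x) = adjoin (ideal_span s) x.
Proof.
have hs := ideal_span_ideal s; have hr := ideal_span_ideal (rcons s x).
apply/seteqP; split=> [|y [a ha]].
  apply: ideal_span_min; first exact: adjoin_ideal.
  move=> y; rewrite mem_rcons inE => /orP[/eqP->|ys].
    by exists 1; rewrite mulr1 subrr; case: hs.
  by exists 0; rewrite mulr0 subr0; apply: ideal_span_mem.
rewrite -(subrK (x * a) y); case: (hr) => _ hD _; apply: hD.
  apply: (@ideal_span_min s) ha => // z zs.
  by apply: ideal_span_mem; rewrite mem_rcons inE zs orbT.
by apply: idealMr => //; apply: ideal_span_mem; rewrite mem_rcons inE eqxx.
Qed.

Lemma ideal_span1 (x y : A) : ideal_span [:: x] y <-> exists a, y = x * a.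
Proof.
rewrite -[[:: x]]/(rcons [::] x) ideal_span_rcons ideal_span_nil; split.
  by move=> [a /eqP]; rewrite subr_eq0 => /eqP->; exists a.
by move=> [a ->]; exists a; rewrite subrr.
Qed.

End IdealSpan.

Lemma ideal_span_map (A B : comNzRingType) (p : {rmorphism A -> B}) (s : seq A) x :
  ideal_span s x -> ideal_span (map p s) (p x).
Proof.
have hi : is_ideal [set y | ideal_span (map p s) (p y)].
  case: (ideal_span_ideal (map p s)) => h0 hD hM; split=> [|y z hy hz|a y hy] /=.
  - by rewrite rmorph0.
  - by rewrite rmorphD; apply: hD.
  - by rewrite rmorphM; apply: hM.
by apply: (ideal_span_min hi) => y ys; apply/ideal_span_mem/map_f.
Qed.

Lemma noetherian_image (A B : comNzRingType) (p : {rmorphism A -> B}) :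
  (forall y, exists x, p x = y) -> is_noetherian A -> is_noetherian B.
Proof.
move=> ps nA I hI; have [I0 ID IM] := hI.
have [s sE] : exists s, [set x | I (p x)] = ideal_span s.
  apply: nA; split=> [|x y hx hy|a x hx] /=.
  - by rewrite rmorph0.
  - by rewrite rmorphD; apply: ID.
  - by rewrite rmorphM; apply: IM.
exists (map p s); apply/seteqP; split=> [y Iy|].
  have [x xy] := ps y; rewrite -xy; apply: ideal_span_map.
  by rewrite -sE /= xy.
apply: ideal_span_min => // _ /mapP[x xs ->].
by have : ideal_span s x by [exact: ideal_span_mem]; rewrite -sE.
Qed.

(** The elements are removed from the last to the first; each removal raises the degree of dual
    exactness, and the length of the complex, by one. The mutually inverse [e] and [e'] identify
    degree 0 of both complexes, whose ranks agree only up to added zeros. *)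
Theorem shamash_seq (A : comNzRingType) (s : seq A) j b
    (D : forall n, 'M[A]_(b n.+1, b n)) :
  regular_seq s -> (j <= size s)%N -> row_exact (ideal_span (take j s)) D ->
  exists (g : nat -> nat) (G : forall n, 'M[A]_(g n.+1, g n))
    (e : 'M_(g 0, b 0)) (e' : 'M_(b 0, g 0)),
  [/\ row_exact [set 0] G, e *m e' = 1%:M /\ e' *m e = 1%:M,
      (forall v : 'rV_(g 0), (exists w, v = w *m G 0) <->
         (exists w, memx (ideal_span (take j s)) (v *m e - w *m D 0))),
      (forall n, col_exact [set 0] G (n + j) <-> col_exact (ideal_span (take j s)) D n) /\
      (forall n, (n < j)%N -> col_exact [set 0] G n) &
      forall N, (forall n, (N < n)%N -> b n = 0%N) ->
        forall n, (N + j < n)%N -> g n = 0%N].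
Proof.
move=> [_ sreg]; elim: j b D => [|j IHj] b D js hD.
  rewrite take0 ideal_span_nil in hD *.
  exists b, D, 1%:M, 1%:M; split=> //.
  - by rewrite !mulmx1.
  - move=> v; split=> -[w hw]; exists w.
      by apply/memx_zero; rewrite mulmx1 hw subrr.
    by move/memx_zero/eqP: hw; rewrite mulmx1 subr_eq0 => /eqP.
  - by split=> // n; rewrite addn0.
  - by move=> N h n; rewrite addn0; exact: h.
rewrite (take_nth 0 js) ideal_span_rcons in hD *.
have [G [hG hG0 hGc hGc0]] := shamash (ideal_span_ideal _) (sreg _ js) hD.
have [g [H [e [e' [hH [ee' e'e] hH0 [hHc hHc0] hN]]]]] := IHj _ _ (ltnW js) hG.
exists g, H, (e *m col_mx 1%:M 0), (row_mx 1%:M 0 *m e'); split=> //.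
- have c1 : col_mx 1%:M 0 *m row_mx 1%:M 0 = 1%:M :> 'M[A]_(b 0 + 0).
    apply/matrixP => i k; rewrite -[i]splitK -[k]splitK.
    case: (fintype.split i) => [i'|[]//]; case: (fintype.split k) => [k'|[]//].
    by rewrite mul_col_row block_mxEul mulmx1 !mxE eq_lshift.
  split; first by rewrite mulmxA -(mulmxA e) c1 mulmx1.
  rewrite mulmxA -(mulmxA _ e') e'e mulmx1 mul_row_col mulmx1 mulmx0 addr0 //.
- move=> v; rewrite hH0.
  have -> : v *m (e *m col_mx 1%:M 0) = lsubmx (v *m e).
    by rewrite mulmxA -{1}[v *m e]hsubmxK mul_row_col mulmx1 mulmx0 addr0.
  exact: hG0.
- split=> [n|n nj]; first by rewrite -addSnnS hHc hGc.
  have [/hHc0 //|jn] := ltnP n j.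
  have -> : n = (0 + j)%N by apply/eqP; rewrite eqn_leq jn -ltnS nj.
  by apply/hHc.
- move=> N hb n hn; apply: (hN N.+1); last by rewrite addSnnS.
  move=> [|m] // hm; rewrite /= hb; last exact: ltnW.
  by rewrite hb.
Qed.

(** * Resolutions and projective dimension *)

Section Resolutions.
Variable A : comNzRingType.
Implicit Types M : lmodType A.

Definition resol M b (D : forall n, 'M[A]_(b n.+1, b n))
    (a : {linear 'rV[A]_(b 0) -> M}) :=
  [/\ forall y, exists v, a v = y, forall v, a v = 0 <-> exists w, v = w *m D 0 &
      row_exact [set 0] D].

Lemma row_exact0 b (D : forall n, 'M[A]_(b n.+1, b n)) :
  row_exact [set 0] D <->
  (forall n, D n.+1 *m D n = 0) /\
  (forall n (v : 'rV_(b n.+1)), v *m D n = 0 -> exists w, v = w *m D n.+1).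
Proof.
split=> [[h1 h2]|[h1 h2]]; split=> n; first exact/memx_zero.
- move=> v hv; have [|w hw] := h2 n v; first exact/memx_zero.
  by exists w; apply/eqP; rewrite -subr_eq0; apply/eqP/memx_zero.
- exact/memx_zero.
- move=> v /memx_zero/h2[w hw]; exists w; apply/memx_zero.
  by rewrite -hw subrr.
Qed.

Lemma row_exact0_lift b (D : forall n, 'M[A]_(b n.+1, b n)) n m (X : 'M_(m, b n.+1)) :
  row_exact [set 0] D -> X *m D n = 0 -> exists W, X = W *m D n.+1.
Proof.
move=> h hX; have [|W hW] := @row_exact_lift _ _ _ _ n m X h; first exact/memx_zero.
by exists W; apply/eqP; rewrite -subr_eq0; apply/eqP/memx_zero.
Qed.

Lemma col_exact0 b (D : forall n, 'M[A]_(b n.+1, b n)) n :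
  col_exact [set 0] D n <->
  forall u : 'cV_(b n), D n *m u = 0 -> exists w, u = dprev D n *m w.
Proof.
split=> h u hu.
  have [|w hw] := h u; first exact/memx_zero.
  by exists w; apply/eqP; rewrite -subr_eq0; apply/eqP/memx_zero.
have [w ->] := h u ((memx_zero _).1 hu); exists w; apply/memx_zero.
by rewrite subrr.
Qed.

Lemma mx_eq_rows m n (X Y : 'M[A]_(m, n)) :
  (forall v : 'rV_m, v *m X = v *m Y) -> X = Y.
Proof. by move=> h; apply/row_matrixP => i; rewrite !rowE h. Qed.

Lemma mx_rows_lift m n p (X : 'M[A]_(m, n)) (B : 'M_(p, n)) :
  (forall v : 'rV_m, exists w : 'rV_p, v *m X = w *m B) -> exists W, X = W *m B.
Proof.
move=> h; have [i|W hW] := @memx_lift _ [set 0] m n p X B.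
  have [w hw] := h 'e_i; exists w; apply/memx_zero.
  by rewrite rowE hw subrr.
by exists W; apply/eqP; rewrite -subr_eq0; apply/eqP/memx_zero.
Qed.

Lemma mx_cols_lift m n p (X : 'M[A]_(m, n)) (B : 'M_(m, p)) :
  (forall i, exists w : 'cV_p, col i X = B *m w) -> exists W, X = B *m W.
Proof.
move=> /choice[w hw]; exists (\matrix_(i, j) w j i 0).
apply/matrixP => i j; have /matrixP/(_ i 0) := hw j; rewrite !mxE => ->.
by apply: eq_bigr => l _; rewrite mxE.
Qed.

Lemma resol_lift M b (D : forall n, 'M[A]_(b n.+1, b n)) a m (X : 'M_(m, b 0)) :
  resol (M := M) D a -> (forall v, a (v *m X) = 0) -> exists W, X = W *m D 0.
Proof. by move=> [_ h _] hX; apply: mx_rows_lift => v; apply/h. Qed.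

Section Comparison.
Variable M : lmodType A.
Variables (b b' : nat -> nat) (D : forall n, 'M[A]_(b n.+1, b n))
  (D' : forall n, 'M[A]_(b' n.+1, b' n)).
Variables (a : {linear 'rV[A]_(b 0) -> M}) (a' : {linear 'rV[A]_(b' 0) -> M}).
Hypotheses (hD : resol D a) (hD' : resol D' a').

Lemma resol_lift_aug : exists U : 'M_(b 0, b' 0), forall v, a' (v *m U) = a v.
Proof.
have [as' _ _] := hD'.
have /choice[u uE] : forall i : 'I_(b 0), exists w, a' w = a 'e_i by [].
exists (\matrix_i u i) => v.
rewrite mulmx_sum_row linear_sum [in RHS](row_sum_delta v) linear_sum.
by apply: eq_bigr => i _; rewrite !linearZ /= rowK uE.
Qed.
End Comparison.

(* Whether Ext^(n+1)(M, A) vanishes can be read off any free resolution of M. The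
   chain maps and the homotopy are only constructed up to the degree needed. *)
Lemma col_exact_resol M b b' (D : forall n, 'M[A]_(b n.+1, b n))
    (D' : forall n, 'M[A]_(b' n.+1, b' n)) a a' n :
  resol (M := M) D a -> resol (M := M) D' a' ->
  col_exact [set 0] D' n.+1 -> col_exact [set 0] D n.+1.
Proof.
move=> hD hD'; have [_ _ eD] := hD; have [_ _ eD'] := hD'.
have [cD _] := (row_exact0 D).1 eD; have [cD' _] := (row_exact0 D').1 eD'.
(* Two consecutive components of the chain maps suffice. The third equation says that 1 - U V - D s
   lands in cycles, so it factors through the next differential, which is the next component of the
   homotopy. *)
have : exists (U0 : 'M_(b n, b' n)) (V0 : 'M_(b' n, b n))
    (U : 'M_(b n.+1, b' n.+1)) (V : 'M_(b' n.+1, b n.+1)) (s : 'M_(b n, b n.+1)),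
    [/\ D n *m U0 = U *m D' n, D' n *m V0 = V *m D n &
        (1%:M - U *m V - D n *m s) *m D n = 0].
  elim: n => [|n [U0 [V0 [U [V [s [hU hV hs]]]]]]].
    have [U0 U0E] := resol_lift_aug a hD'; have [V0 V0E] := resol_lift_aug a' hD.
    have [U hU] : exists U, D 0 *m U0 = U *m D' 0.
      apply: (resol_lift hD') => v; rewrite mulmxA U0E.
      by case: hD => _ h _; apply/h; exists v.
    have [V hV] : exists V, D' 0 *m V0 = V *m D 0.
      apply: (resol_lift hD) => v; rewrite mulmxA V0E.
      by case: hD' => _ h _; apply/h; exists v.
    have [s hs] : exists s, 1%:M - U0 *m V0 = s *m D 0.
      apply: (resol_lift hD) => v.
      by rewrite mulmxBr mulmx1 mulmxA linearB V0E U0E subrr.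
    exists U0, V0, U, V, s; split=> //.
    rewrite !mulmxBl mul1mx -(mulmxA _ s) -hs -(mulmxA U) -hV mulmxA -hU.
    by rewrite mulmxBr mulmx1 mulmxA subrr.
  have [t ht] := row_exact0_lift eD hs.
  have [U' hU'] : exists U', D n.+1 *m U = U' *m D' n.+1.
    by apply: (row_exact0_lift eD'); rewrite -mulmxA -hU mulmxA cD mul0mx.
  have [V' hV'] : exists V', D' n.+1 *m V = V' *m D n.+1.
    by apply: (row_exact0_lift eD); rewrite -mulmxA -hV mulmxA cD' mul0mx.
  exists U, V, U', V', t; split=> //.
  rewrite !mulmxBl mul1mx -(mulmxA _ t) -ht -(mulmxA U') -hV' mulmxA -hU'.
  by rewrite !mulmxBr mulmx1 !mulmxA cD mul0mx subr0 subrr.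
move=> [U0 [V0 [U [V [s [hU hV hs]]]]]].
have [t ht] := row_exact0_lift eD hs.
have [V' hV'] : exists V', D' n.+1 *m V = V' *m D n.+1.
  by apply: (row_exact0_lift eD); rewrite -mulmxA -hV mulmxA cD' mul0mx.
move=> /col_exact0 h; apply/col_exact0 => u hu.
have [|w hw] := h (V *m u); first by rewrite mulmxA hV' -mulmxA hu mulmx0.
exists (U0 *m w + s *m u); rewrite /= in hw *.
rewrite mulmxDr mulmxA hU -mulmxA -hw !mulmxA.
rewrite -[LHS]mul1mx -[in LHS](subrK (U *m V) 1%:M) -[in LHS](subrK (D n *m s) (_ - _)).
by rewrite ht !mulmxDl -mulmxA hu mulmx0 add0r addrC.
Qed.

(** Says that the row space of [B] is projective ([mprojP]): [E] kills the kernel of v |-> v B,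
    hence induces a section of this map onto its image. *)
Definition mproj q t (B : 'M[A]_(q, t)) :=
  exists2 E, E *m B = B & forall v : 'rV_q, v *m B = 0 -> v *m E = 0.

Lemma image_module q t (B : 'M[A]_(q, t)) :
  exists (Z : lmodType A) (i : {linear Z -> 'rV[A]_t}) (p : {linear 'rV[A]_q -> Z}),
  [/\ injective i, forall z, exists v, p v = z & forall v, i (p v) = v *m B].
Proof.
have sZ : submodule [set v : 'rV[A]_t | exists w : 'rV_q, v = w *m B].
  split=> [|c x y [w ->] [w' ->]]; first by exists 0; rewrite mul0mx.
  by exists (c *: w + w'); rewrite mulmxDl scalemxAl.
have [Z [i [ii iP]]] := submodule_module sZ.
have [p pE] : exists p : {linear 'rV[A]_q -> Z}, forall v, i (p v) = v *m B.
  apply: (linear_lift_inj (f := mulmxr B : {linear _ -> _})) => // x.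
  by apply/iP; exists x.
exists Z, i, p; split=> // z.
have [w hw] : exists w : 'rV_q, i z = w *m B by apply/iP; exists z.
by exists w; apply: ii; rewrite pE.
Qed.

Lemma linear_mxE q t (f : {linear 'rV[A]_q -> 'rV[A]_t}) :
  exists E : 'M_(q, t), forall v, f v = v *m E.
Proof. by exists (lin1_mx f) => v; rewrite mul_rV_lin1. Qed.

Lemma mprojP q t (B : 'M[A]_(q, t)) (Z : lmodType A) (i : {linear Z -> 'rV[A]_t})
    (p : {linear 'rV[A]_q -> Z}) :
  injective i -> (forall z, exists v, p v = z) -> (forall v, i (p v) = v *m B) ->
  projective Z <-> mproj B.
Proof.
move=> ii ps ip; split=> [pZ|[E EB E0]].
  have [s sE] := projective_section ps pZ.
  have [E EE] := linear_mxE (s \o p : {linear _ -> _}).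
  exists E => [|v hv].
    by apply: mx_eq_rows => v; rewrite mulmxA -EE -!ip /= sE.
  rewrite -EE /=; have -> : p v = 0 by apply: ii; rewrite ip hv linear0.
  by rewrite linear0.
have /choice[s sE] := ps.
have ls : linear (fun z => s z *m E).
  move=> c x y; apply/eqP; rewrite -subr_eq0 scalemxAl -mulmxDl -mulmxBl; apply/eqP/E0.
  by rewrite -ip linearB linearP !sE subrr linear0.
have [s' s'E] := linear_pack ls.
apply: (projective_retract (s := s') (r := p)); last exact: projective_rV.
by move=> z; apply: ii; rewrite s'E ip -mulmxA EB -ip sE.
Qed.

(** The columns of the projector [E] are cocycles, as [D n.+1] lands in the kernel of [D n].
    Exactness of the dual makes them coboundaries, E = D_n Y. *)
Lemma mproj_split b (D : forall n, 'M[A]_(b n.+1, b n)) n :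
  row_exact [set 0] D -> mproj (D n) -> col_exact [set 0] D n.+1 ->
  exists Y, D n *m Y *m D n = D n.
Proof.
move=> /row_exact0[cD _] [E ED E0] /col_exact0 cx.
have [Y hY] : exists Y, E = D n *m Y.
  apply: mx_cols_lift => j; apply: cx; rewrite colE mulmxA.
  suff -> : D n.+1 *m E = 0 by rewrite mul0mx.
  by apply: mx_eq_rows => v; rewrite mulmxA E0 ?mulmx0 // -mulmxA cD mulmx0.
by exists Y; rewrite -hY.
Qed.

(** If [D n.+1] splits, its image is a summand and the image of [D n] is the complement. *)
Lemma split_mproj b (D : forall n, 'M[A]_(b n.+1, b n)) n Y :
  row_exact [set 0] D -> D n.+1 *m Y *m D n.+1 = D n.+1 -> mproj (D n).
Proof.
move=> /row_exact0[cD eD] hY; exists (1%:M - Y *m D n.+1) => [|v /eD[w ->]].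
  by rewrite mulmxBl mul1mx -mulmxA cD mulmx0 subr0.
by rewrite mulmxBr mulmx1 -{1}hY !mulmxA subrr.
Qed.

(** A projective image of [D n] bounds the projective dimension by n + 1, so n + 2 is the first
    degree in which Ext must vanish. *)
Lemma mproj_col_exact b (D : forall n, 'M[A]_(b n.+1, b n)) n :
  row_exact [set 0] D -> mproj (D n) -> col_exact [set 0] D n.+2.
Proof.
move=> hD [E ED E0]; have [cD eD] := (row_exact0 D).1 hD.
have [Y hY] : exists Y, 1%:M - E = Y *m D n.+1.
  by apply: row_exact0_lift => //; rewrite mulmxBl mul1mx ED subrr.
have hE : D n.+1 *m E = 0.
  by apply: mx_eq_rows => v; rewrite mulmxA E0 ?mulmx0 // -mulmxA cD mulmx0.
have [Z hZ] : exists Z, 1%:M - D n.+1 *m Y = Z *m D n.+2.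
  apply: row_exact0_lift => //.
  by rewrite mulmxBl mul1mx -mulmxA -hY mulmxBr mulmx1 hE subr0 subrr.
apply/col_exact0 => u hu; exists (Y *m u) => /=; apply/eqP.
by rewrite mulmxA -subr_eq0 -{1}[u]mul1mx -mulmxBl hZ -mulmxA hu mulmx0.
Qed.

(** The image of [D m] is the syzygy of order m + 1, and each syzygy lowers the projective dimension
    by one. *)
Lemma pd_le_mproj M b (D : forall n, 'M[A]_(b n.+1, b n)) a n m :
  resol (M := M) D a -> pd_le n M -> (n <= m.+1)%N -> mproj (D m).
Proof.
move=> [as_ ak hD] pM nm; have [cD eD] := (row_exact0 D).1 hD.
have [Z [i [p [ii ps ip]]]] := image_module (D m).
apply/(mprojP ii ps ip).
suff : pd_le (n - m.+1) Z by rewrite (eqP nm).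
elim: m Z i p ii ps ip {nm} => [|m IHm] Z i p ii ps ip.
  rewrite subn1; apply: (pd_le_kernel (i := i) (p := a)) pM; last exact: projective_rV.
  split=> // v; rewrite ak; split=> [[w ->]|[z <-]]; first by exists (p w).
  by have [w <-] := ps z; exists w.
have [Z' [i' [p' [ii' ps' ip']]]] := image_module (D m).
rewrite subnS; apply: (pd_le_kernel (i := i) (p := p')) (IHm _ _ _ ii' ps' ip').
  split=> // v; split=> [pv|[z <-]].
    have [|w ->] := eD m v; first by rewrite -ip' pv linear0.
    by exists (p w).
  by have [w <-] := ps z; apply: ii'; rewrite ip ip' -mulmxA cD mulmx0 linear0.
exact: projective_rV.
Qed.

Lemma mproj_pd_le M b (D : forall n, 'M[A]_(b n.+1, b n)) a m :
  resol (M := M) D a -> mproj (D m) -> pd_le m.+1 M.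
Proof.
move=> [as_ ak hD] pm; have [cD eD] := (row_exact0 D).1 hD.
suff : forall n, (n <= m)%N -> forall (Z : lmodType A) (i : {linear Z -> 'rV[A]_(b n)})
    (p : {linear 'rV[A]_(b n.+1) -> Z}),
    injective i -> (forall z, exists v, p v = z) -> (forall v, i (p v) = v *m D n) ->
    pd_le (m - n) Z.
  move=> h; have [Z [i [p [ii ps ip]]]] := image_module (D 0).
  exists Z, 'rV[A]_(b 0), i, a; split; first exact: projective_rV.
    split=> // v; rewrite ak; split=> [[w ->]|[z <-]]; first by exists (p w).
    by have [w <-] := ps z; exists w.
  by have := h 0%N (leq0n _) _ _ _ ii ps ip; rewrite subn0.
(* Downward induction from the image of [D m], written as induction on m - n. *)
move=> n nm; rewrite -(subKn nm); move: (m - n)%N (leq_subr n m) => l lm {n nm}.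
elim: l lm => [|l IHl] lm Z i p ii ps ip.
  move: Z i p ii ps ip; rewrite subn0 subnn => Z i p ii ps ip.
  exact/(mprojP ii ps ip).
rewrite subKn //; move: IHl; rewrite subKn; last exact: ltnW.
have e : (m - l = (m - l.+1).+1)%N by rewrite subnSK.
rewrite e => IHl.
have [Z' [i' [p' [ii' ps' ip']]]] := image_module (D (m - l.+1).+1).
exists Z', 'rV[A]_(b (m - l.+1).+1), i', p; split; first exact: projective_rV.
  split=> // v; split=> [pv|[z <-]].
    have [|w ->] := eD _ v; first by rewrite -ip pv linear0.
    by exists (p' w).
  by have [w <-] := ps' z; apply: ii; rewrite ip ip' -mulmxA cD mulmx0 linear0.
by apply: (IHl (ltnW lm)) ii' ps' ip'.
Qed.

Lemma finite_resol_pd_le M b (D : forall n, 'M[A]_(b n.+1, b n)) a N :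
  resol (M := M) D a -> (forall n, (N < n)%N -> b n = 0%N) -> pd_le N M.
Proof.
move=> hD hb; case: N hb => [|N] hb.
  have [as_ ak _] := hD; have ai : injective a.
    apply: linear_inj => v /ak[w ->]; move: (D 0) w; rewrite hb // => B w.
    by rewrite (_ : w = 0) ?mul0mx //; apply/rowP; case.
  have /choice[s sE] := as_; have ls : linear s.
    by move=> c x y; apply: ai; rewrite linearP !sE.
  have [s' s'E] := linear_pack ls.
  apply: (projective_retract (s := s') (r := a)); last exact: projective_rV.
  by move=> x; rewrite s'E.
apply: (mproj_pd_le hD); exists 1%:M => [|v hv]; first exact: mul1mx.
have [_ _ /row_exact0[_ eD]] := hD.
have [w ->] := eD _ _ hv; move: (D N.+1) w; rewrite hb // => B w.
by rewrite (_ : w = 0) ?mul0mx //; apply/rowP; case.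
Qed.

(* If Ext^i(M, A) = 0 for i < c, a resolution of length less than c splits. *)
Lemma grade_le_pd M b (D : forall n, 'M[A]_(b n.+1, b n)) a c x p :
  resol (M := M) D a -> (forall n, (n < c)%N -> col_exact [set 0] D n) ->
  (forall y, x * y = 0 -> y = 0) -> (forall z : M, x *: z = 0) ->
  (p < c)%N -> pd_le p M -> forall z : M, z = 0.
Proof.
move=> hD hc xreg xM; have [as_ ak eD] := hD; case: p => [|p] pc pM.
  by move=> z; apply: (projective_torsion_free as_ pM xreg).
(* Splitting propagates downwards: a projective image and a vanishing Ext split [D p], which makes
   the image of the previous differential projective. *)
have [Y hY] : exists Y, D 0 *m Y *m D 0 = D 0.
  have mp : mproj (D p) by apply: (pd_le_mproj hD pM).
  elim: p mp pc {pM} => [|p IHp] mp pc; first exact: mproj_split eD mp (hc _ pc).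
  have [Y hY] := mproj_split eD mp (hc _ pc).
  by apply: IHp (ltnW pc); apply: split_mproj hY.
have [Z hZ] : exists Z, x%:M = Z *m D 0.
  by apply: (resol_lift hD) => v; rewrite mul_mx_scalar linearZ /= xM.
(* Now [M] is a summand of a free module and is killed by the nonzerodivisor [x], so the
   complementary projector is zero. *)
have e1 : 1%:M - Y *m D 0 = 0.
  apply/matrixP => i j; rewrite [RHS]mxE; apply: xreg.
  suff /matrixP/(_ i j) : x%:M *m (1%:M - Y *m D 0) = 0 by rewrite mul_scalar_mx !mxE.
  by rewrite hZ mulmxBr mulmx1 -{1}hY !mulmxA subrr.
move=> z; have [v <-] := as_ z; apply/ak; exists (v *m Y).
by apply/eqP; rewrite -mulmxA -subr_eq0 -{1}[v]mulmx1 -mulmxBr e1 mulmx0.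
Qed.

End Resolutions.

(** * Vanishing of Ext and periodic resolutions *)

Section ExtResolutions.
Variable A : comNzRingType.
Implicit Types M : lmodType A.

Lemma linear_formE q (g : {linear 'rV[A]_q -> A^o}) :
  exists u : 'cV_q, forall v, g v = (v *m u) 0 0.
Proof.
exists (\col_i g 'e_i) => v; rewrite {1}(row_sum_delta v) linear_sum mxE.
by apply: eq_bigr => i _; rewrite linearZ mxE.
Qed.

Lemma linear_form_of q (u : 'cV[A]_q) :
  exists g : {linear 'rV[A]_q -> A^o}, forall v, g v = (v *m u) 0 0.
Proof.
apply: linear_pack => c x y; rewrite mulmxDl -scalemxAl.
by rewrite mxaddE mxscaleE.
Qed.

Lemma ext_zero_resol M b (D : forall n, 'M[A]_(b n.+1, b n)) a n :
  resol (M := M) D a -> col_exact [set 0] D n.+1 -> ext_zero n.+1 M A^o.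
Proof.
move=> [as_ ak /row_exact0[cD eD]] /col_exact0 cx.
have ak' v : a v = 0 <-> exists w : 'rV_(b 1), (mulmxr (D 0) : {linear _ -> _}) w = v.
  by rewrite ak; split=> [[w ->]|[w <-]]; exists w.
have eD' i (v : 'rV_(b i.+1)) : (mulmxr (D i) : {linear _ -> _}) v = 0 <->
    exists w : 'rV_(b i.+2), (mulmxr (D i.+1) : {linear _ -> _}) w = v.
  split=> [hv|[w <-]]; first by have [w ->] := eD _ _ hv; exists w.
  by rewrite /= -mulmxA cD mulmx0.
exists (FreeResolution as_ ak' eD') => g hg; rewrite /= in g hg *.
have [u uE] := linear_formE g.
have [|w hw] := cx u.
  apply/matrixP => i j; rewrite ord1 [RHS]mxE.
  have := hg 'e_i; rewrite uE -mulmxA => <-.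
  by rewrite -rowE [RHS]mxE.
have [h hE] := linear_form_of w.
by exists h => v; rewrite uE hE hw mulmxA.
Qed.

Lemma ext_zero_inv M n : ext_zero n.+1 M A^o ->
  exists b (D : forall n, 'M[A]_(b n.+1, b n)) a,
    resol (M := M) D a /\ col_exact [set 0] D n.+1.
Proof.
case=> -[b d a as_ ak ed] /= cx; pose D i := lin1_mx (d i).
have dE i v : d i v = v *m D i by rewrite mul_rV_lin1.
exists b, D, a; split.
  split=> //.
    by move=> v; rewrite ak; split=> [[w <-]|[w ->]]; exists w; rewrite dE.
  apply/row_exact0; split=> i.
    by apply: mx_eq_rows => v; rewrite mulmxA mulmx0 -!dE; apply/ed; exists v.
  by move=> v hv; have [|w hw] := (ed i v).1; rewrite ?dE //; exists w; rewrite -dE.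
apply/col_exact0 => u hu; have [g gE] := linear_form_of u.
have [|h hE] := cx g; first by move=> v; rewrite gE dE -mulmxA hu mulmx0 mxE.
have [w wE] := linear_formE h; exists w; rewrite /=.
apply/matrixP => i j; rewrite ord1.
have := hE 'e_i; rewrite gE wE dE -mulmxA -!rowE !mxE => ->.
by apply: eq_bigr => k _; rewrite !mxE.
Qed.

End ExtResolutions.

Section Periodic.
Variables (A : comNzRingType) (b c : nat) (P : 'M[A]_(c, b)) (Q : 'M[A]_(b, c)).
Hypotheses (rP : forall v : 'rV_c, v *m P = 0 <-> exists w, v = w *m Q)
  (rQ : forall v : 'rV_b, v *m Q = 0 <-> exists w, v = w *m P).

Definition per_rank n := if odd n then c else b.

(** Matching on [odd n] makes both dimensions compute, since [odd n.+1] unfolds to the negation of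
    [odd n]. *)
Definition per_mx n : 'M[A]_(per_rank n.+1, per_rank n) :=
  match odd n as o return 'M[A]_(if ~~ o then c else b, if o then c else b) with
  | true => Q | false => P
  end.

Lemma per_resol (M : lmodType A) (a : {linear 'rV[A]_b -> M}) :
  (forall y, exists v, a v = y) -> (forall v, a v = 0 <-> exists w, v = w *m P) ->
  resol (b := per_rank) (M := M) per_mx a.
Proof.
move=> as_ ak; split=> //; apply/row_exact0; rewrite /per_mx /per_rank /=; split=> n.
  case: (odd n) => /=; apply: mx_eq_rows => v; rewrite mulmxA mulmx0.
    by apply/rQ; exists v.
  by apply/rP; exists v.
by case: (odd n) => /= v; [move/rQ|move/rP].
Qed.

Hypotheses (cP : forall u : 'cV_b, P *m u = 0 <-> exists w, u = Q *m w)
  (cQ : forall u : 'cV_c, Q *m u = 0 <-> exists w, u = P *m w).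

Lemma per_ext_zero (M : lmodType A) (a : {linear 'rV[A]_b -> M}) i :
  (forall y, exists v, a v = y) -> (forall v, a v = 0 <-> exists w, v = w *m P) ->
  (0 < i)%N -> ext_zero i M A^o.
Proof.
move=> as_ ak; case: i => // n _; apply: (ext_zero_resol (per_resol as_ ak)).
apply/col_exact0; rewrite /per_mx /per_rank /=.
by case: (odd n) => /= u; [move/cP|move/cQ].
Qed.

End Periodic.

Lemma dual_exists (A : comNzRingType) (M : lmodType A) (f : M -> A^o) :
  linear f -> exists d : dual M, forall x, d x = f x.
Proof.
move=> lf; have hf : f \in @dual_pred A M by apply/asboolP.
by exists (Dual hf).
Qed.

Lemma dual_linear (A : comNzRingType) (M : lmodType A) (d : dual M) c x y :
  d (c *: x + y) = c * d x + d y.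
Proof. by case: d => d /= /asboolP; apply. Qed.

Lemma dual_ext (A : comNzRingType) (M : lmodType A) (d e : dual M) :
  (forall x, d x = e x) -> d = e.
Proof. by move=> h; apply: val_inj; apply/funext. Qed.

Lemma dual_applyP (A : comNzRingType) (M : lmodType A) (d e : dual M) c x :
  (c *: d + e : dual M) x = c * d x + e x.
Proof. by []. Qed.

Lemma dual_ind (A : comNzRingType) (M : lmodType A) (d : dual M) :
  exists g : {linear M -> A^o}, forall x, g x = d x.
Proof. by apply: linear_pack => c x y; rewrite dual_linear. Qed.

(** The pair (P, Q) is a totally acyclic 2-periodic complex with cokernel [M]. The dual of [M] is
    the cokernel of the transpose of [P], so it satisfies the same hypotheses with transposed
    matrices. *)
Theorem Gdim_zero_periodic (A : comNzRingType) b c (P : 'M[A]_(c, b))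
    (Q : 'M[A]_(b, c)) (M : lmodType A) (a : {linear 'rV[A]_b -> M}) :
  (forall v : 'rV_c, v *m P = 0 <-> exists w, v = w *m Q) ->
  (forall v : 'rV_b, v *m Q = 0 <-> exists w, v = w *m P) ->
  (forall u : 'cV_b, P *m u = 0 <-> exists w, u = Q *m w) ->
  (forall u : 'cV_c, Q *m u = 0 <-> exists w, u = P *m w) ->
  (forall y, exists v, a v = y) -> (forall v, a v = 0 <-> exists w, v = w *m P) ->
  Gdim_zero M.
Proof.
move=> rP rQ cP cQ as_ ak.
have /choice[s sE] := as_.
have sP v : exists w, s (a v) = v + w *m P.
  have [w hw] : exists w, s (a v) - v = w *m P by apply/ak; rewrite linearB sE subrr.
  by exists w; rewrite -hw addrC subrK.
have QP (w : 'rV_c) : w *m P *m Q = 0 by apply/rQ; exists w.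
have PQ (w : 'cV_c) : P *m (Q *m w) = 0 by apply/cP; exists w.
(* The map v |-> v Q identifies [M] with the row space of [Q]; exactness of the columns makes every
   functional on [M] of the form v |-> v Q w. *)
have /choice[f fE] : forall w : 'cV_c, exists d : dual M,
    forall v, d (a v) = (v *m Q *m w) 0 0.
  move=> w.
  have [|d dE] := @dual_exists A M (fun x => (s x *m Q *m w) 0 0).
    move=> e x y; have [w1 hw1] := sP (e *: s x + s y).
    rewrite linearP !sE in hw1; rewrite hw1 mulmxDl QP addr0.
    by rewrite !mulmxDl -!scalemxAl mxaddE mxscaleE.
  exists d => v; rewrite dE; have [w1 ->] := sP v.
  by rewrite mulmxDl QP addr0.
have fs (d : dual M) : exists w, d = f w.
  have [g gE] := dual_ind d.
  have [u uE] := linear_formE (g \o a : {linear _ -> _}).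
  have [w hw] : exists w, u = Q *m w.
    apply/cP/matrixP => i j; rewrite ord1 [RHS]mxE.
    have : (g \o a : {linear _ -> _}) ('e_i *m P) = 0.
      by rewrite /=; have -> : a ('e_i *m P) = 0 by [apply/ak; exists 'e_i]; rewrite linear0.
    by rewrite uE -mulmxA -rowE mxE.
  exists w; apply: dual_ext => x; have [v <-] := as_ x.
  by rewrite fE -gE -[LHS]/((g \o a : {linear _ -> _}) v) uE hw mulmxA.
have flin : linear (fun w : 'rV_c => f w^T).
  move=> e x y; apply: dual_ext => z; have [v <-] := as_ z.
  rewrite dual_applyP !fE linearP /= mulmxDr -scalemxAr.
  by rewrite mxaddE mxscaleE.
have [a' a'E] := linear_pack flin.
have f0 w : f w = 0 -> Q *m w = 0.
  move=> fw; apply/matrixP => i j; rewrite ord1 [RHS]mxE.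
  have := fE w 'e_i; rewrite fw -mulmxA -rowE mxE => <- //.
split.
- by exists b, a.
- have bi : injective (@to_bidual A M).
    move=> x y exy; have [v vE] := as_ x; have [v' v'E] := as_ y.
    rewrite -vE -v'E; apply/eqP; rewrite -subr_eq0 -linearB; apply/eqP/ak/rQ.
    apply/trmx_inj/matrixP => i j; rewrite ord1 mxE [RHS]mxE [RHS]mxE.
    have := congr1 (fun F : dual (dual M) => F (f (delta_mx i 0))) exy.
    rewrite /= /biduality -vE -v'E !fE => e.
    suff : col i ((v - v') *m Q) 0 0 = 0 by rewrite mxE.
    by rewrite colE !mulmxBl mxaddE mxoppE e subrr.
  have bs (F : dual (dual M)) : exists x, to_bidual x = F.
    have [Fl FlE] := dual_ind F.
    have [u uE] := linear_formE (Fl \o a' : {linear _ -> _}).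
    have [v hv] : exists v, u^T = v *m Q.
      apply/rP/trmx_inj/matrixP => i j; rewrite ord1 trmx_mul trmxK trmx0 [RHS]mxE.
      have fz : f (P *m ('e_i)^T) = 0.
        apply: dual_ext => x; have [v <-] := as_ x.
        by rewrite fE -mulmxA [Q *m _](_ : _ = 0) ?mulmx0 ?mxE //; apply/cQ; exists ('e_i)^T.
      have := uE ('e_i *m P^T); rewrite /= a'E trmx_mul trmxK fz linear0 => /esym.
      by rewrite -mulmxA -rowE mxE.
    exists (a v); apply: dual_ext => d; have [w ->] := fs d.
    rewrite -FlE -[w]trmxK -a'E -[RHS]/((Fl \o a' : {linear _ -> _}) w^T) uE.
    have -> : w^T *m u = (u^T *m w)^T by rewrite trmx_mul trmxK.
    by rewrite [RHS]mxE a'E trmxK /= /biduality fE hv.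
  have /choice[g gE] := bs.
  by exists g => x; [apply: bi; rewrite gE|rewrite gE].
- by move=> i; apply: per_ext_zero as_ ak.
- move=> i; apply: (@per_ext_zero A c b P^T Q^T _ _ _ _ (dual M) a').
  + move=> v; split=> [h|[w ->]].
      have [w hw] : exists w, v^T = Q *m w by apply/cP/trmx_inj; rewrite trmx_mul trmxK h trmx0.
      by exists w^T; rewrite -[v]trmxK hw trmx_mul.
    by apply: trmx_inj; rewrite !trmx_mul !trmxK trmx0 PQ.
  + move=> v; split=> [h|[w ->]].
      have [w hw] : exists w, v^T = P *m w by apply/cQ/trmx_inj; rewrite trmx_mul trmxK h trmx0.
      by exists w^T; rewrite -[v]trmxK hw trmx_mul.
    by apply: trmx_inj; rewrite !trmx_mul !trmxK trmx0; apply/cQ; exists w^T.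
  + move=> u; split=> [h|[w ->]].
      have [w hw] : exists w, u^T = w *m Q by apply/rP/trmx_inj; rewrite trmx_mul trmxK h trmx0.
      by exists w^T; rewrite -[u]trmxK hw trmx_mul.
    by apply: trmx_inj; rewrite !trmx_mul !trmxK trmx0; apply/rP; exists w^T.
  + move=> u; split=> [h|[w ->]].
      have [w hw] : exists w, u^T = w *m P by apply/rQ/trmx_inj; rewrite trmx_mul trmxK h trmx0.
      by exists w^T; rewrite -[u]trmxK hw trmx_mul.
    by apply: trmx_inj; rewrite !trmx_mul !trmxK trmx0 QP.
  + by move=> d; have [w ->] := fs d; exists w^T; rewrite a'E trmxK.
  + move=> v; rewrite a'E; split=> [/f0/cQ[w hw]|[w ->]].
      by exists w^T; rewrite -[v]trmxK hw trmx_mul.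
    apply: dual_ext => x; have [u <-] := as_ x.
    rewrite fE trmx_mul trmxK -mulmxA [Q *m _](_ : _ = 0) ?mulmx0 ?mxE //.
    by apply/cQ; exists w^T.
Qed.

(** * Splicing resolutions *)

Section Syzygies.
Variable A : comNzRingType.
Implicit Types M K Z : lmodType A.

Lemma resol_iso M K b (D : forall n, 'M[A]_(b n.+1, b n)) a (f : {linear M -> K}) :
  bijective f -> resol (M := K) D a -> exists a', resol (M := M) D a'.
Proof.
move=> bf [as_ ak eD]; have [g [fg gf]] := linear_bij bf.
exists (g \o a : {linear _ -> _}); split=> // [y|v] /=.
  by have [v hv] := as_ (f y); exists v; rewrite hv.
rewrite -ak; split=> [h|->]; last exact: linear0.
by rewrite -(gf (a v)) h linear0.
Qed.

Lemma resol_splice M K n (i : {linear K -> 'rV[A]_n}) (p : {linear 'rV[A]_n -> M})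
    b (D : forall n, 'M[A]_(b n.+1, b n)) a m :
  short_exact i p -> resol (M := K) D a ->
  (forall l, (m <= l)%N -> col_exact [set 0] D l.+1) ->
  exists b' (D' : forall n, 'M[A]_(b' n.+1, b' n)) a', resol (M := M) D' a' /\
    (forall l, (m < l)%N -> col_exact [set 0] D' l.+1).
Proof.
move=> [ii ps ip] [as_ ak eD] hc; have [cD xD] := (row_exact0 D).1 eD.
have [B BE] := linear_mxE (i \o a : {linear _ -> _}).
pose b' l := if l is l'.+1 then b l' else n.
pose D' l : 'M[A]_(b' l.+1, b' l) :=
  if l is l'.+1 return 'M[A]_(b' l.+1, b' l) then D l' else B.
exists b', D', p; split; last by case=> // l; rewrite ltnS => /hc.
split=> //.
  move=> v; rewrite ip; split=> [[z <-]|[w ->]]; last by exists (a w); rewrite -BE.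
  by have [w <-] := as_ z; exists w; rewrite -BE.
apply/row_exact0; split=> [[|l]|[|l]] /=; rewrite ?cD //.
- apply: mx_eq_rows => v; rewrite mulmxA -BE /= mulmx0.
  by have -> : a (v *m D 0) = 0 by [apply/ak; exists v]; rewrite linear0.
- by move=> v; rewrite -BE /= => h; apply/ak/ii; rewrite h linear0.
- exact: xD.
Qed.

(** [ext_zero] may use a different resolution in each degree; by independence of the resolution, a
    single one serves all degrees. Splicing n covers then shifts the degrees by n. *)
Lemma Gdim_le_resol n M : Gdim_le n M ->
  exists b (D : forall n, 'M[A]_(b n.+1, b n)) a, resol (M := M) D a /\
    (forall l, (n <= l)%N -> col_exact [set 0] D l.+1).
Proof.
case=> Z; elim: n M => [|n IHn] M /=.
  move=> [f bf] [_ _ hZ _].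
  have [b [D [a [hD _]]]] := ext_zero_inv (hZ 1%N isT).
  have [a' ha'] := resol_iso bf hD; exists b, D, a'; split=> // l _.
  have [b' [D' [a1 [hD' cD']]]] := ext_zero_inv (hZ l.+1 isT).
  exact: (col_exact_resol hD hD').
move=> [K [m [i [p [se sy]]]]] gZ.
have [b [D [a [hD hc]]]] := IHn K sy gZ.
exact: resol_splice se hD hc.
Qed.

End Syzygies.

(** * Free resolutions over Noetherian rings *)

Section NoetherianResolution.
Variable A : comNzRingType.
Hypothesis nA : is_noetherian A.

(** Induction on the rank: the first coordinates form a finitely generated ideal, and the vectors
    with first coordinate 0 form a submodule of smaller rank. *)
Lemma noetherian_rV q (P : set 'rV[A]_q) : submodule P ->
  exists m (C : 'M[A]_(m, q)), forall v, P v <-> exists w, v = w *m C.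
Proof.
elim: q P => [|q IHq]; last rewrite -[q.+1]/(1 + q)%N; move=> P [P0 PD].
  exists 0%N, 0 => v; have -> : v = 0 by apply/rowP; case.
  by split=> // _; exists 0; rewrite mulmx0.
have PM m (C : 'M_(m, 1 + q)) (w : 'rV_m) : (forall i, P (row i C)) -> P (w *m C).
  move=> hC; rewrite mulmx_sum_row; elim/big_rec: _ => // i x _ Px.
  exact: PD.
have [s sE] : exists s, [set x | exists v : 'rV_q, P (row_mx x%:M v)] = ideal_span s.
  apply: nA; split=> [|x y [u hu] [v hv]|a x [u hu]] /=.
  - by exists 0; rewrite -scalemx1 scale0r row_mx0.
  - exists (u + v); rewrite -scalemx1 scalerDl !scalemx1 -add_row_mx.
    by rewrite -[row_mx x%:M u]scale1r; apply: PD.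
  - exists (a *: u); rewrite scalar_mxM mul_scalar_mx -scale_row_mx.
    by rewrite -[X in P X]addr0; apply: PD.
have [B BE] : exists B : 'M[A]_(size s, q), forall i : 'I_(size s), P (row_mx (s`_i)%:M (row i B)).
  have /choice[f fE] : forall i : 'I_(size s), exists v : 'rV_q, P (row_mx (s`_i)%:M v).
    move=> i; have : ideal_span s s`_i by apply/ideal_span_mem/mem_nth.
    by rewrite -sE.
  by exists (\matrix_i f i) => i; rewrite rowK.
pose C1 : 'M[A]_(size s, 1 + q) := row_mx (\col_i s`_i) B.
have C1E i : row i C1 = row_mx (s`_i)%:M (row i B).
  rewrite row_row_mx; congr row_mx; apply/rowP => j.
  by rewrite ord1 !mxE eqxx.
have sP : submodule [set v : 'rV_q | P (row_mx (0 : 'M_1) v)].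
  split=> [|c x y hx hy] /=; first by rewrite row_mx0.
  have -> : row_mx 0 (c *: x + y) = c *: row_mx 0 x + row_mx 0 y :> 'rV_(1 + q).
    by rewrite scale_row_mx add_row_mx scaler0 addr0.
  exact: PD.
have [m [C2 C2E]] := IHq _ sP.
exists (size s + m)%N, (col_mx C1 (row_mx 0 C2)) => v; split.
  rewrite -[v]hsubmxK => Pv.
  have hx : ideal_span s (lsubmx v 0 0).
    rewrite -sE /=; exists (rsubmx v).
    suff -> : (lsubmx v 0 0)%:M = lsubmx v by [].
    by rewrite -mx11_scalar.
  have [w1 w1E] : exists w1 : 'rV_(size s), lsubmx v = w1 *m \col_i s`_i.
    suff [w1 hw1] : exists w1 : 'rV_(size s), lsubmx v 0 0 = (w1 *m \col_i s`_i) 0 0.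
      by exists w1; rewrite [LHS]mx11_scalar hw1 -mx11_scalar.
    apply: (@ideal_span_min _ s [set x | exists w1 : 'rV_(size s), x = (w1 *m \col_i s`_i) 0 0]) hx.
      split=> [|x y [w ->] [w' ->]|c x [w ->]] /=; first by exists 0; rewrite mul0mx mxE.
        by exists (w + w'); rewrite mulmxDl [RHS]mxE.
      by exists (c *: w); rewrite -scalemxAl [RHS]mxE.
    move=> x xs /=; have xi : (index x s < size s)%N by rewrite index_mem.
    exists 'e_(Ordinal xi); rewrite -rowE !mxE /=.
    by rewrite nth_index.
  have [w2 w2E] : exists w2 : 'rV_m, rsubmx v - w1 *m B = w2 *m C2.
    apply/C2E => /=; have -> : row_mx 0 (rsubmx v - w1 *m B) = (-1) *: (w1 *m C1) + v.
      rewrite scaleN1r -{2}[v]hsubmxK /C1 mul_mx_row opp_row_mx add_row_mx w1E addNr.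
      by rewrite [in RHS]addrC.
    apply: PD; last by rewrite -[v]hsubmxK.
    by apply: PM => i; rewrite C1E.
  exists (row_mx w1 w2); rewrite mul_row_col /C1 !mul_mx_row add_row_mx mulmx0 addr0 -w1E.
  by rewrite -w2E addrC subrK.
move=> [w ->]; apply: PM => i; rewrite -[i]splitK; case: (fintype.split i) => j.
  by rewrite /= rowKu C1E.
rewrite /= rowKd row_row_mx row0.
have : exists w, row j C2 = w *m C2 by exists 'e_j; rewrite -rowE.
by move/C2E.
Qed.

Lemma noetherian_resol (M : lmodType A) : fin_gen M ->
  exists b (D : forall n, 'M[A]_(b n.+1, b n)) a, resol (M := M) D a.
Proof.
case=> b0 [a as_].
have sP0 : submodule [set v | a v = 0].
  split=> [|c x y hx hy] /=; first exact: linear0.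
  by rewrite linearP /= hx hy scaler0 addr0.
have [b1 [D0 D0E]] := noetherian_rV sP0.
(* The iterated state is a matrix packed with its two dimensions; the row count of one stage is, by
   computation, the column count of the next. *)
have nxt (s : {pq : nat * nat & 'M[A]_(pq.1, pq.2)}) :
    exists t : {m : nat & 'M[A]_(m, (tag s).1)},
      forall v : 'rV_(tag s).1, v *m tagged s = 0 <-> exists w, v = w *m tagged t.
  have sP : submodule [set v : 'rV_(tag s).1 | v *m tagged s = 0].
    split=> [|c x y hx hy] /=; first exact: mul0mx.
    by rewrite mulmxDl -scalemxAl hx hy scaler0 addr0.
  have [m [C CE]] := noetherian_rV sP.
  by exists (Tagged (fun m => 'M[A]_(m, (tag s).1)) C).
have [f fE] := dep_choice nxt.
pose T := {pq : nat * nat & 'M[A]_(pq.1, pq.2)}.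
pose step (s : T) : T :=
  Tagged (fun pq : nat * nat => 'M[A]_(pq.1, pq.2)) (i := (tag (f s), (tag s).1)) (tagged (f s)).
pose st n := iter n step (Tagged (fun pq : nat * nat => 'M[A]_(pq.1, pq.2)) (i := (b1, b0)) D0).
pose b n := (tag (st n)).2.
have bE n : (tag (st n)).1 = b n.+1 by [].
exists b, (fun n => tagged (st n)), a; split=> //.
apply/row_exact0; split=> n.
  apply: mx_eq_rows => v; rewrite mulmxA mulmx0.
  by apply/fE; exists v.
by move=> v /fE.
Qed.

End NoetherianResolution.

(** * Flat base change and quasi-deformations *)

Lemma linear_factor (A : comNzRingType) (U V W : lmodType A) (p : {linear U -> V})
    (f : {linear U -> W}) :
  (forall y, exists x, p x = y) -> (forall x, p x = 0 -> f x = 0) ->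
  exists h : {linear V -> W}, forall x, h (p x) = f x.
Proof.
move=> /choice[s sE] pf.
have hE x : f (s (p x)) = f x.
  by apply/eqP; rewrite -subr_eq0 -linearB; apply/eqP/pf; rewrite linearB sE subrr.
have lh : linear (fun y => f (s y)).
  move=> c x y; rewrite -linearP -[RHS]hE; congr (f (s _)).
  by rewrite linearP !sE.
have [h h_E] := linear_pack lh.
by exists h => x; rewrite h_E hE.
Qed.

Section BaseChanges.
Variables (A B : comNzRingType) (phi : {rmorphism A -> B}).

Lemma semilinear_sum (M : lmodType A) (N : lmodType B) (g : M -> N) n
    (c : 'I_n -> A) (x : 'I_n -> M) :
  semilinear_map phi g -> g (\sum_i c i *: x i) = \sum_i phi (c i) *: g (x i).
Proof.
move=> lg; have g0 : g 0 = 0.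
  have := lg 1 0 0; rewrite scale1r rmorph1 scale1r addr0 => /eqP.
  by rewrite -subr_eq0 opprD addrA subrr add0r oppr_eq0 => /eqP.
elim: n c x => [|n IHn] c x; first by rewrite !big_ord0.
by rewrite !big_ord_recl lg IHn.
Qed.

Lemma semilinear0 (M : lmodType A) (N : lmodType B) (g : M -> N) :
  semilinear_map phi g -> g 0 = 0.
Proof.
by move=> /(@semilinear_sum _ _ _ 0 (fun=> 0) (fun=> 0)); rewrite !big_ord0.
Qed.

Lemma base_change_free q :
  is_base_change phi (fun v : 'rV[A]_q => map_mx phi v : 'rV[B]_q).
Proof.
split=> [a x y|P g lg].
  by apply/rowP => i; rewrite !mxE rmorphD rmorphM.
have [h hE] := rV_linear_map (fun i => g 'e_i).
have hg v : h (map_mx phi v) = g v.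
  rewrite hE {2}(row_sum_delta v) semilinear_sum //.
  by apply: eq_bigr => i _; rewrite mxE.
exists h; split=> // h' h'E; apply: rV_linear_ext => i.
have -> : 'e_i = map_mx phi 'e_i :> 'rV[B]_q by rewrite map_delta_mx.
by rewrite h'E hg.
Qed.

(* Base change is right exact: M = A^q / K gives B^q / B K. *)
Lemma base_change_quotient (M : lmodType A) q (p : {linear 'rV[A]_q -> M}) :
  (forall y, exists v, p v = y) ->
  exists (N : lmodType B) (j : M -> N) (r : {linear 'rV[B]_q -> N}),
  [/\ is_base_change phi j, forall y, exists v, r v = y,
      forall v, j (p v) = r (map_mx phi v) &
      forall v, r v = 0 <-> exists m (C : 'M[A]_(m, q)) (c : 'rV_m),
        (forall i, p (row i C) = 0) /\ v = c *m map_mx phi C].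
Proof.
move=> ps; pose P := [set v : 'rV[B]_q | exists m (C : 'M[A]_(m, q)) (c : 'rV_m),
        (forall i, p (row i C) = 0) /\ v = c *m map_mx phi C].
have sP : submodule P.
  split=> [|a x y [m [C [c [hC ->]]]] [m' [C' [c' [hC' ->]]]]].
    by exists 0%N, 0, 0; rewrite mul0mx; split=> // -[].
  exists (m + m')%N, (col_mx C C'), (row_mx (a *: c) c'); split.
    by move=> i; rewrite -[i]splitK; case: (fintype.split i) => k; rewrite /= ?rowKu ?rowKd.
  by rewrite map_col_mx mul_row_col scalemxAl.
have [N [r [rs rk]]] := quotient_module sP.
have /choice[s sE] := ps.
have kP v : p v = 0 -> r (map_mx phi v) = 0.
  move=> pv; apply/rk; exists 1%N, v, 1%:M; split; last by rewrite mul1mx.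
  by move=> i; rewrite row_id.
pose j x := r (map_mx phi (s x)).
have jp v : j (p v) = r (map_mx phi v).
  apply/eqP; rewrite -subr_eq0 -linearB -map_mxB; apply/eqP/kP.
  by rewrite linearB sE subrr.
exists N, j, r; split=> //; split=> [a x y|P' g lg].
  rewrite -{1}(sE x) -{1}(sE y) -linearP jp /j.
  by rewrite (base_change_free q).1 linearP.
have lgp : semilinear_map phi (fun v => g (p v)).
  by move=> a x y; rewrite linearP lg.
have [h0 [h0E _]] := (base_change_free q).2 _ _ lgp.
have [|h hE] := linear_factor rs (f := h0).
  move=> v /rk[m [C [c [hC ->]]]]; rewrite mulmx_sum_row linear_sum big1 // => i _.
  by rewrite linearZ /= -map_row h0E hC (semilinear0 lg) scaler0.
exists h; split=> [x|h' h'E y]; first by rewrite -(sE x) jp hE h0E.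
have [v <-] := rs y; rewrite hE.
apply: (rV_linear_ext (f := h' \o r : {linear _ -> _})) => i /=.
have -> : 'e_i = map_mx phi 'e_i :> 'rV[B]_q by rewrite map_delta_mx.
by rewrite h0E -jp h'E.
Qed.

Lemma base_change_unique (M : lmodType A) (N N' : lmodType B) (j : M -> N) (j' : M -> N') :
  is_base_change phi j -> is_base_change phi j' ->
  exists (f : {linear N -> N'}) (g : {linear N' -> N}),
    [/\ cancel f g, cancel g f & forall x, f (j x) = j' x].
Proof.
move=> [lj uj] [lj' uj']; have [f [fE _]] := uj _ _ lj'; have [g [gE _]] := uj' _ _ lj.
have [h [_ hu]] := uj _ _ lj; have [h' [_ hu']] := uj' _ _ lj'.
exists f, g; split=> // x.
  have -> : g (f x) = h x.
    by apply: (hu (g \o f : {linear _ -> _})) => z /=; rewrite fE gE.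
  by rewrite -(hu (idfun : {linear _ -> _})).
have -> : f (g x) = h' x.
  by apply: (hu' (f \o g : {linear _ -> _})) => z /=; rewrite gE fE.
by rewrite -(hu' (idfun : {linear _ -> _})).
Qed.

Hypothesis fphi : flat_morphism phi.

(** Equational criterion of flatness: the row space of [D] embeds in a free module, the embedding
    survives base change, and the presentation of the base change then describes all relations. *)
Lemma flat_equational q t (D : 'M[A]_(q, t)) (v : 'rV[B]_q) :
  v *m map_mx phi D = 0 ->
  exists m (C : 'M[A]_(m, q)) (c : 'rV_m), C *m D = 0 /\ v = c *m map_mx phi C.
Proof.
move=> hv; have [Z [i [p [ii ps ip]]]] := image_module D.
have [N [j [r [bj rs jp rk]]]] := base_change_quotient ps.
have pD w : p w = 0 <-> w *m D = 0.
  by rewrite -ip; split=> [->|h]; [rewrite linear0|apply: ii; rewrite h linear0].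
have [|fB fBE] := linear_factor rs (f := mulmxr (map_mx phi D) : {linear _ -> _}).
  move=> w /rk[m [C [c [hC ->]]]] /=; rewrite -mulmxA -map_mxM.
  suff -> : C *m D = 0 by rewrite map_mx0 mulmx0.
  by apply/row_matrixP => k; rewrite row_mul row0; apply/pD.
have [|m [C [c [hC ->]]]] := (rk v).1.
  have fi : injective fB.
    apply: (fphi bj (base_change_free t) _ ii) => x.
    have [w <-] := ps x; rewrite jp fBE ip /=.
    by rewrite map_mxM.
  by apply: fi; rewrite fBE linear0.
exists m, C, c; split=> //.
by apply/row_matrixP => k; rewrite row_mul row0; apply/pD.
Qed.

Lemma flat_resol (M : lmodType A) b (D : forall n, 'M[A]_(b n.+1, b n)) a
    (N : lmodType B) (j : M -> N) :
  resol (M := M) D a -> is_base_change phi j ->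
  exists a' : {linear 'rV[B]_(b 0) -> N}, resol (fun n => map_mx phi (D n)) a'.
Proof.
move=> [as_ ak /row_exact0[cD eD]] bj.
have [N1 [j1 [r [bj1 rs jp rk]]]] := base_change_quotient as_.
have [f [g [fg gf _]]] := base_change_unique bj1 bj.
have lift m n (C : 'M[A]_(m, b n)) : (forall i, exists w, row i C = w *m D n) ->
    exists W, C = W *m D n.
  move=> h; apply: mx_rows_lift => v.
  have /choice[w wE] := h; exists (v *m \matrix_i w i).
  rewrite -mulmxA; congr (_ *m _); apply/row_matrixP => i.
  by rewrite row_mul rowK.
exists (f \o r : {linear _ -> _}); split=> /=.
- by move=> y; have [v hv] := rs (g y); exists v; rewrite hv gf.
- move=> v; have -> : f (r v) = 0 <-> r v = 0.
    by split=> [h|->]; [rewrite -(fg (r v)) h linear0|rewrite linear0].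
  rewrite rk; split=> [[m [C [c [hC ->]]]]|[w ->]].
    have [|W ->] := @lift m 0%N C; first by move=> i; apply/ak.
    by exists (c *m map_mx phi W); rewrite map_mxM mulmxA.
  by exists (b 1), (D 0), w; split=> // i; apply/ak; exists 'e_i; rewrite -rowE.
- apply/row_exact0; split=> n; first by rewrite -map_mxM cD map_mx0.
  move=> v /flat_equational[m [C [c [hC ->]]]].
  have [|W ->] := @lift m n.+1 C.
    by move=> i; apply: eD; rewrite -row_mul hC row0.
  by exists (c *m map_mx phi W); rewrite map_mxM mulmxA.
Qed.

Section Descent.
Variables (P : set A) (P' : set B).
Hypotheses (hP : forall x, ~ P x -> exists y, x * y = 1).
Hypotheses (hP' : is_ideal P') (P'1 : ~ P' 1) (PP' : forall x, P x -> P' (phi x)).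

(** Faithful flatness of a local flat morphism: a linear system over [A] solvable over [B] is
    solvable over [A]. The relation (v, -1) between the rows of [D] and [u] comes from relations
    over [A], one of which has a unit coefficient at [u]. *)
Lemma flat_descent q t (D : 'M[A]_(q, t)) (u : 'rV[A]_t) (v : 'rV[B]_q) :
  map_mx phi u = v *m map_mx phi D -> exists w, u = w *m D.
Proof.
move=> hv; have := @flat_equational _ _ (col_mx D u) (row_mx v (- 1%:M)).
rewrite map_col_mx mul_row_col mulNmx mul1mx hv subrr => /(_ erefl).
move=> [m [C [c [hC hc]]]].
pose C1 := lsubmx C; pose c2 := rsubmx C.
have hC' : C1 *m D + c2 *m u = 0 by rewrite -mul_row_col hsubmxK.
move: hc; rewrite -[C]hsubmxK map_row_mx mul_mx_row -/C1 -/c2 => /eq_row_mx[_ hc2].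
(* Otherwise all these coefficients lie in [P], and -1, a combination of their images, would lie in
   [P']. *)
have [k hk] : exists k, ~ P (c2 k 0).
  apply: contrapT => /forallNP h; apply: P'1.
  have -> : 1 = - (c *m map_mx phi c2) 0 0 by rewrite -hc2 !mxE eqxx opprK.
  apply: idealN => //; rewrite mxE; apply: ideal_sum => // k _.
  by case: hP' => _ _; apply; rewrite mxE; apply: PP'; apply: contrapT (h k).
have [y hy] := hP hk.
exists (- y *: row k C1); rewrite -scalemxAl -row_mul.
have := congr1 (row k) hC'; rewrite row0 linearD /= => /eqP.
rewrite addr_eq0 => /eqP->; rewrite scalerN scaleNr opprK row_mul.
have -> : row k c2 = (c2 k 0)%:M by rewrite [LHS]mx11_scalar mxE.
by rewrite mul_scalar_mx scalerA mulrC hy scale1r.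
Qed.

Lemma col_exact_descent b (D : forall n, 'M[A]_(b n.+1, b n)) n :
  col_exact [set 0] (fun n => map_mx phi (D n)) n -> col_exact [set 0] D n.
Proof.
move=> /col_exact0 h; apply/col_exact0 => u hu.
have [|w hw] := h (map_mx phi u); first by rewrite -map_mxM hu map_mx0.
have [|w' hw'] := @flat_descent _ _ (dprev D n)^T u^T w^T.
  rewrite -map_trmx hw trmx_mul; congr (_ *m _).
  by case: n {h hu} u w hw => [|n] u w _ /=; rewrite -?map_trmx ?map_mx0.
by exists w'^T; rewrite -[u]trmxK hw' trmx_mul trmxK.
Qed.

Lemma flat_descent_zero (M : lmodType A) b (D : forall n, 'M[A]_(b n.+1, b n)) a
    (N : lmodType B) (a' : {linear 'rV[B]_(b 0) -> N}) :
  resol (M := M) D a -> resol (fun n => map_mx phi (D n)) a' ->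
  (forall y : N, y = 0) -> forall x : M, x = 0.
Proof.
move=> [as_ ak _] [_ ak' _] N0 x; have [v <-] := as_ x; apply/ak.
have [w hw] := (ak' (map_mx phi v)).1 (N0 _).
exact: flat_descent hw.
Qed.

End Descent.
End BaseChanges.

(** * Change of rings along a quotient by a regular sequence *)

Section Lifting.
Variables (Q B : comNzRingType) (psi : {rmorphism Q -> B}) (s : seq Q).
Hypotheses (psis : forall x, exists y, psi y = x) (hs : regular_seq s)
  (hk : kernel psi = ideal_span s).

Lemma memx_kernel m n (X : 'M[Q]_(m, n)) :
  memx (ideal_span s) X <-> map_mx psi X = 0.
Proof.
rewrite -hk; split=> [h|/matrixP h i j].
  by apply/matrixP => i j; rewrite !mxE; exact: h.
by have := h i j; rewrite !mxE.
Qed.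

Lemma lift_mx m n (X : 'M[B]_(m, n)) : exists Y, map_mx psi Y = X.
Proof.
have /choice[f fE] : forall ij : 'I_m * 'I_n, exists y, psi y = X ij.1 ij.2 by [].
by exists (\matrix_(i, j) f (i, j)); apply/matrixP => i j; rewrite !mxE fE.
Qed.

(** Arbitrary lifts of the matrices are exact modulo the ideal of [s], which is all that
    [shamash_seq] asks for. *)
Lemma regular_lift_resol (N : lmodType B) b (D : forall n, 'M[B]_(b n.+1, b n)) a :
  resol (M := N) D a ->
  exists g (G : forall n, 'M[Q]_(g n.+1, g n)) (a' : {linear 'rV[Q]_(g 0) -> restr psi N}),
  [/\ resol G a',
      (forall n, col_exact [set 0] G (n + size s) <-> col_exact [set 0] D n),
      (forall n, (n < size s)%N -> col_exact [set 0] G n) &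
      forall m, (forall n, (m < n)%N -> b n = 0%N) ->
        forall n, (m + size s < n)%N -> g n = 0%N].
Proof.
move=> [as_ ak hD]; have [cD eD] := (row_exact0 D).1 hD.
have [E EE] := dep_choice (fun n => lift_mx (D n)).
have dE n : map_mx psi (dprev E n) = dprev D n.
  by case: n => [|n] /=; rewrite ?map_mx0 ?EE.
have EJ m n (X : 'M[Q]_(m, n)) Y : memx (ideal_span s) (X - Y) <-> map_mx psi X = map_mx psi Y.
  rewrite memx_kernel map_mxB; split=> [/eqP|->]; last exact: subrr.
  by rewrite subr_eq0 => /eqP.
have hE : row_exact (ideal_span s) E.
  split=> n; first by apply/memx_kernel; rewrite map_mxM !EE cD.
  move=> v /memx_kernel; rewrite map_mxM EE => /eD[w hw].
  have [w' hw'] := lift_mx w; exists w'; apply/EJ.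
  by rewrite map_mxM EE hw' hw.
have hE' : row_exact (ideal_span (take (size s) s)) E by rewrite take_size.
have [g [G [e [e' [hG [ee' e'e] hG0 [hGc hGc0] hN]]]]] := shamash_seq hs (leqnn _) hE'.
rewrite take_size in hG0 hGc.
pose al := fun v : 'rV[Q]_(g 0) => a (map_mx psi (v *m e)) : restr psi N.
have lal : linear al.
  move=> c x y; rewrite /al mulmxDl -scalemxAl map_mxD map_mxZ linearD linearZ.
  by [].
have [a' a'E] := linear_pack lal.
exists g, G, a'; split=> //.
  split=> // [y|v].
    have [v hv] := as_ y; have [v' hv'] := lift_mx v.
    by exists (v' *m e'); rewrite a'E /al -mulmxA e'e mulmx1 hv'.
  rewrite hG0 a'E; split=> [/ak[w hw]|[w /EJ hw]].
    have [w' hw'] := lift_mx w; exists w'; apply/EJ.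
    by rewrite [RHS]map_mxM EE hw' hw.
  by apply/ak; exists (map_mx psi w); rewrite hw [LHS]map_mxM EE.
move=> n; rewrite hGc; split=> h.
  apply/col_exact0 => u hu; have [u' hu'] := lift_mx u.
  have [|w /EJ hw] := h u'; first by apply/memx_kernel; rewrite map_mxM EE hu'.
  by exists (map_mx psi w); rewrite -hu' hw map_mxM dE.
move=> u /memx_kernel; rewrite map_mxM EE => hu.
have [w hw] := (col_exact0 _ _).1 h _ hu; have [w' hw'] := lift_mx w.
by exists w'; apply/EJ; rewrite hw map_mxM hw' dE.
Qed.

(** The resolution of [B] over itself has length 0, so the lifted one has length at most
    [size s]. *)
Lemma pd_quotient_le : pd_le (size s) (restr psi B^o).
Proof.
pose b n := if n is 0 then 1%N else 0%N.
pose D n : 'M[B]_(b n.+1, b n) := 0.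
have la : linear (fun v : 'rV[B]_(b 0) => v 0 0 : B^o).
  by move=> c x y; rewrite mxaddE mxscaleE.
have [a aE] := linear_pack la.
have hD : resol (M := B^o) D a.
  split=> [y|v|]; first by exists y%:M; rewrite aE mxE eqxx.
    rewrite aE; split=> [h|[w ->]]; last by rewrite mulmx0 mxE.
    by exists 0; rewrite mul0mx; apply/rowP => i; rewrite ord1 h mxE.
  apply/row_exact0; split=> [n|n v _]; first by rewrite mulmx0.
  by exists 0; rewrite mul0mx; apply/rowP; case.
have [g [G [a' [hG _ _ hN]]]] := regular_lift_resol hD.
apply: (finite_resol_pd_le hG) => n hn; apply: (hN 0%N) => //.
by case.
Qed.

(** Finite projective dimension over [Q] makes the dual of the lifted resolution exact in high
    degrees; the degree shift brings this back to [B]. *)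
Lemma pd_le_col_exact (N : lmodType B) b (D : forall n, 'M[B]_(b n.+1, b n)) a p n :
  resol (M := N) D a -> pd_le p (restr psi N) -> (p.+1 < n)%N -> col_exact [set 0] D n.
Proof.
move=> hD pN pn; have [g [G [a' [hG hGc _ _]]]] := regular_lift_resol hD.
apply/hGc; have [_ _ eG] := hG; case: n pn => [|[|n]] // pn.
rewrite !addSn; apply: mproj_col_exact => //; apply: (pd_le_mproj hG pN).
by apply: leqW; apply: leq_trans (leq_addr _ _).
Qed.

(** The dual of the lifted resolution is exact in all degrees below [size s], and the elements of
    [s] kill [N], so [grade_le_pd] applies. *)
Lemma regular_le_pd (N : lmodType B) b (D : forall n, 'M[B]_(b n.+1, b n)) a p :
  resol (M := N) D a -> pd_le p (restr psi N) -> (p < size s)%N ->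
  forall y : N, y = 0.
Proof.
move=> hD pN ps; have [g [G [a' [hG _ hGc0 _]]]] := regular_lift_resol hD.
have s0 : (0 < size s)%N by apply: leq_ltn_trans ps.
apply: (grade_le_pd (x := s`_0) hG hGc0 _ _ ps pN).
  move=> y xy; have [_ /(_ 0%N s0 y)] := hs; rewrite take0 ideal_span_nil; exact.
move=> z; rewrite -[LHS]/(psi s`_0 *: (z : N)).
suff -> : psi s`_0 = 0 by rewrite scale0r.
by have : ideal_span s s`_0 by [apply/ideal_span_mem/mem_nth]; rewrite -hk.
Qed.

End Lifting.

(** * Matrices over an augmented ring *)

Section MinimalMultiplicity.
Variables (k : fieldType) (S : comAlgType k) (eps : {rmorphism S -> k}) (l : S).
Hypotheses (epsK : forall c : k, eps c%:A = c) (epsl : eps l = 0).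
Hypothesis lreg : forall x, l * x = 0 -> x = 0.
Hypothesis max2 : forall x y, eps x = 0 -> eps y = 0 -> exists z, x * y = l * z.

Let L : set S := [set x | exists z, x = l * z].

Lemma L_ideal : is_ideal L.
Proof.
split=> [|x y [a ->] [b ->]|c x [a ->]]; first by exists 0; rewrite mulr0.
  by exists (a + b); rewrite mulrDr.
by exists (c * a); rewrite mulrCA.
Qed.

Let hL := L_ideal.

Lemma memL m n (X : 'M[S]_(m, n)) : memx L X <-> exists Y, X = l *: Y.
Proof.
split=> [h|[Y ->] i j]; last by exists (Y i j); rewrite mxE.
have /choice[F FE] : forall ij : 'I_m * 'I_n, exists a, X ij.1 ij.2 = l * a.
  by move=> ij; exact: h.
by exists (\matrix_(i, j) F (i, j)); apply/matrixP => i j; rewrite !mxE (FE (i, j)).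
Qed.

Lemma lreg_mx m n (X : 'M[S]_(m, n)) : l *: X = 0 -> X = 0.
Proof.
move=> /matrixP h; apply/matrixP => i j; rewrite [RHS]mxE; apply: lreg.
by have := h i j; rewrite !mxE.
Qed.

Notation emx X := (map_mx eps X).
Notation imx X := (map_mx (in_alg S) X).

Lemma emx_imx m n (X : 'M[k]_(m, n)) : emx (imx X) = X.
Proof. by apply/matrixP => i j; rewrite !mxE epsK. Qed.

Lemma max2_mx m n p (X : 'M[S]_(m, n)) (Y : 'M[S]_(n, p)) :
  emx X = 0 -> emx Y = 0 -> memx L (X *m Y).
Proof.
move=> /matrixP hX /matrixP hY i j; rewrite mxE; apply: ideal_sum => // a _.
by apply: max2; [have := hX i a|have := hY a j]; rewrite !mxE.
Qed.

Lemma max2_scale m n x (X : 'M[S]_(m, n)) : eps x = 0 -> emx X = 0 -> memx L (x *: X).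
Proof.
move=> hx /matrixP hX i j; rewrite mxE.
by apply: max2 => //; have := hX i j; rewrite !mxE.
Qed.

(* With N the row space of B: N/lN is projective, respectively free, over S/l. *)
Definition lproj q t (B : 'M[S]_(q, t)) := exists E U,
  (1%:M - E) *m B = l *: (U *m B) /\
  forall v w : 'rV_q, v *m B = l *: (w *m B) -> memx L (v *m E).

Definition lfree q t (B : 'M[S]_(q, t)) :=
  exists c (G : 'M_(c, q)) W U, B = W *m (G *m B) + l *: (U *m B) /\
  forall w u, w *m (G *m B) = l *: (u *m B) -> memx L (w : 'rV_c).

Lemma mulmx_split_row m c n (X : 'M[S]_(m, c.+1)) (Y : 'M_(c.+1, n)) i :
  X *m Y = col i X *m row i Y + col' i X *m row' i Y.
Proof.
apply/matrixP => a b; rewrite !mxE big_ord1 (bigD1_ord i) //= !mxE.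
by congr (_ + _); apply: eq_bigr => j _; rewrite !mxE.
Qed.

(** A relation with a coefficient outside the kernel of [eps] would express one generator by the
    others modulo [l], against minimality of [c]. *)
Lemma minimal_generators q t (B : 'M[S]_(q, t)) :
  exists c (G : 'M_(c, q)) W U, B = W *m (G *m B) + l *: (U *m B) /\
  forall (w : 'rV_c) u, w *m (G *m B) = l *: (u *m B) -> emx w = 0.
Proof.
pose gen c := `[< exists (G : 'M_(c, q)) W U, B = W *m (G *m B) + l *: (U *m B) >].
have : exists c, gen c.
  by exists q; apply/asboolP; exists 1%:M, 1%:M, 0; rewrite !mul1mx mul0mx scaler0 addr0.
move=> /ex_minnP[c /asboolP[G [W [U BE]]] cmin]; exists c, G, W, U; split=> // w u hw.
apply/rowP => i; rewrite [RHS]mxE mxE; apply: contrapT => /eqP wi.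
case: c i G W BE w hw wi cmin => [[]//|c] i G W BE w hw wi cmin.
suff : gen c by move/cmin; rewrite ltnn.
pose a := eps (w 0 i); pose nu : S := 1 - a^-1%:A * w 0 i.
have enu : eps nu = 0.
  by rewrite /nu rmorphB rmorphM rmorph1 epsK /= mulVf ?subrr.
have [z hz] := max2 enu enu.
pose g := row i G *m B; pose G' := row' i G; pose w' := col' i w.
have GB : row' i (G *m B) = G' *m B.
  by apply/matrixP => x y; rewrite !mxE; apply: eq_bigr => j _; rewrite !mxE.
have hg : w 0 i *: g = l *: (u *m B) - w' *m (G' *m B).
  rewrite -hw (mulmx_split_row w _ i) GB addrK row_mul.
  have -> : col i w = (w 0 i)%:M by rewrite [LHS]mx11_scalar mxE.
  by rewrite mul_scalar_mx.
(* An inverse of the coefficient modulo [l]: the product with it is (1 + nu)(1 - nu) = 1 - nu^2, and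
   nu^2 = l z. *)
pose e : S := (1 + nu) * a^-1%:A.
have gE : g = (- e *: w') *m (G' *m B) + l *: ((z *: row i G + e *: u) *m B).
  have -> : g = (e * w 0 i) *: g + (l * z) *: g.
    rewrite -scalerDl -hz.
    have -> : e * w 0 i = (1 + nu) * (1 - nu) by rewrite /e /nu subKr mulrA.
    have -> : (1 + nu) * (1 - nu) + nu * nu = 1 by ring.
    by rewrite scale1r.
  rewrite -(scalerA e) hg /g; mxring.
apply/asboolP; exists G', (col i W *m (- e *: w') + col' i W),
  (col i W *m (z *: row i G + e *: u) + U).
rewrite {1}BE (mulmx_split_row W _ i) GB row_mul -/g gE; mxring.
Qed.

(** Projective modules over the local ring S/l are free: minimality of the generators puts X = 1 - G
    E W in the maximal ideal, whose square vanishes modulo [l]. *)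
Lemma lproj_lfree q t (B : 'M[S]_(q, t)) : lproj B -> lfree B.
Proof.
move=> [E [U' [hE hE']]]; have [c [G [W [U [BE min]]]]] := minimal_generators B.
exists c, G, W, U; split=> // w u hw.
pose X := 1%:M - G *m E *m W.
have hX : X *m (G *m B) = l *: ((G *m U' + G *m E *m U) *m B).
  have -> : X *m (G *m B) = G *m ((1%:M - E) *m B)
      + G *m E *m (B - W *m (G *m B)) by rewrite /X; mxring.
  have -> : B - W *m (G *m B) = l *: (U *m B) by rewrite {1}BE addrC addKr.
  by rewrite hE; mxring.
have eX : emx X = 0.
  apply/row_matrixP => i; rewrite row0 -map_row.
  by apply: (min _ (row i (G *m U' + G *m E *m U))); rewrite -!row_mul hX linearZ.
have hwE : memx L (w *m G *m E) by apply: (hE' _ u); rewrite -mulmxA.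
(* With Y = 1 - X this is the identity 1 = Y + Y X + X^2. *)
have -> : w = w *m (G *m E *m W) + (w *m (G *m E *m W)) *m X + w *m (X *m X).
  by rewrite /X; mxring.
apply: memxD => //; last by apply: memxMl => //; apply: max2_mx.
have h1 : memx L (w *m (G *m E *m W)) by rewrite !mulmxA; apply: memxMr.
by apply: memxD => //; apply: memxMr.
Qed.

Hypothesis sepl : forall x, (forall N, exists y, x = l ^+ N * y) -> x = 0.

(** A relation is divisible by [l]; cancelling [l] gives another relation, so the first is divisible
    by every power of [l]. *)
Lemma lfree_inj q t (B : 'M[S]_(q, t)) c (G : 'M_(c, q)) :
  (forall w u, w *m (G *m B) = l *: (u *m B) -> memx L (w : 'rV_c)) ->
  forall w : 'rV_c, w *m (G *m B) = 0 -> w = 0.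
Proof.
move=> h w hw; have pw N : exists y : 'rV_c, w = l ^+ N *: y /\ y *m (G *m B) = 0.
  elim: N => [|N [y [wE hy]]]; first by exists w; rewrite expr0 scale1r.
  have [|y' yE] := (memL y).1; first by apply: (h y 0); rewrite hy mul0mx scaler0.
  exists y'; split; first by rewrite wE yE scalerA -exprSr.
  by apply: lreg_mx; rewrite scalemxAl -yE.
apply/rowP => i; rewrite [RHS]mxE; apply: sepl => N.
by have [y [-> _]] := pw N; exists (y 0 i); rewrite mxE.
Qed.

Section MatrixFactorization.
Variables (f z0 : S) (q t : nat) (B : 'M[S]_(q, t)) (Phi : 'M[S]_(t, q)).
Hypotheses (lf : l ^+ 3 = f * z0) (BPhi : Phi *m B = f%:M).

(* By Nakayama, a lift of a basis of N/lN generates uN for some u = 1 mod l. *)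
Lemma lfree_factorization : lfree B -> exists c (P : 'M[S]_(c, t)) (Psi : 'M_(t, c)) a,
  let u := 1 - l * a in
  [/\ P *m Psi = (u * f)%:M, Psi *m P = (u * f)%:M,
      exists G, P = G *m B, exists W, u *: B = W *m P & mproj B].
Proof.
move=> [c [G [W [U [BE hG]]]]]; have Pinj := lfree_inj hG; pose P := G *m B.
have hB : (1%:M - l *: U) *m B = W *m P.
  by rewrite mulmxBl mul1mx -scalemxAl {1}BE addrK.
have L1 : ~ L 1.
  by move=> [z hz]; have /eqP := congr1 eps hz; rewrite rmorph1 rmorphM epsl mul0r oner_eq0.
(* The determinant is 1 modulo [l], and the adjugate turns invertibility modulo [l] into
   multiplication by u = 1 - l a. *)
have [a aE] : exists a, \det (1%:M - l *: U) = 1 - l * a.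
  have [Sl [p [_ pk]]] := quotient_ring hL L1.
  have pl : p l = 0 by apply/pk; exists 1; rewrite mulr1.
  have /pk[a ha] : p (1 - \det (1%:M - l *: U)) = 0.
    rewrite rmorphB rmorph1 -det_map_mx map_mxB map_mx1 map_mxZ pl scale0r subr0.
    by rewrite det1 subrr.
  by exists a; rewrite -ha subKr.
pose u := 1 - l * a; pose W' := \adj (1%:M - l *: U) *m W.
have uB : u *: B = W' *m P.
  by rewrite -mulmxA -hB mulmxA mul_adj_mx aE mul_scalar_mx.
have e2 : (Phi *m W') *m P = (u * f)%:M.
  by rewrite -mulmxA -uB -scalemxAr BPhi scale_scalar_mx.
have Pinj_mx m (X : 'M_(m, c)) : X *m P = 0 -> X = 0.
  move=> hX; apply/row_matrixP => i; rewrite row0; apply: Pinj.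
  by rewrite -row_mul hX row0.
exists c, P, (Phi *m W'), a; split; [|exact: e2|by exists G|by exists W'|].
  apply/eqP; rewrite -subr_eq0; apply/eqP/Pinj_mx.
  by rewrite mulmxBl -mulmxA e2 mul_mx_scalar mul_scalar_mx subrr.
(* A geometric series: al u = 1 - l^3 a^3, and l^3 is a multiple of [f], so [u] and [f] are
   comaximal. *)
pose al := 1 + l * a + l ^+ 2 * a ^+ 2; pose be := z0 * a ^+ 3.
have ab : al * u + be * f = 1.
  have -> : be * f = l ^+ 3 * a ^+ 3 by rewrite lf /be; ring.
  by rewrite /al /u; ring.
(* The projector glues two partial ones: multiplication by [u] factors through the free module on
   the rows of [P], and multiplication by [f] through [Phi]. *)
exists (al *: (W' *m G) + be *: (B *m Phi)).
  have -> : (al *: (W' *m G) + be *: (B *m Phi)) *m B =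
      al *: (W' *m P) + be *: (B *m (Phi *m B)) by rewrite /P; mxring.
  by rewrite -uB BPhi mul_mx_scalar !scalerA -scalerDl ab scale1r.
move=> v hv; have : v *m W' *m P = 0 by rewrite -mulmxA -uB -scalemxAr hv scaler0.
move=> /Pinj_mx hW; have -> : v *m (al *: (W' *m G) + be *: (B *m Phi)) =
    al *: (v *m W' *m G) + be *: (v *m B *m Phi) by mxring.
by rewrite hW hv !mul0mx !scaler0 addr0.
Qed.

End MatrixFactorization.

(** * Descent of freeness and growth of homology modulo l *)

Section Descent.
Variables (lam : {additive S -> k}) (s : S).
Hypotheses (lamM : forall x y, lam (x * y) = lam x * eps y + eps x * lam y)
  (laml : forall x, lam (l * x) = 0).
Hypotheses (eps_s : eps s = 0) (lam_s : lam s = 1).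

(** Over S/l, whose maximal ideal is killed by [s], a free submodule of a free module is a summand.
    A relation of its basis modulo the maximal ideal becomes a relation over S/l after
    multiplication by [s]; freeness puts its coefficients in [l S], and the derivation [lam], which
    kills [l S] and sends [s] to 1, shows that they vanish. *)
Lemma lfree_descent p q t (B' : 'M[S]_(p, q)) (B : 'M[S]_(q, t)) :
  B' *m B = 0 -> (forall v : 'rV_q, v *m B = 0 -> exists w, v = w *m B') ->
  lfree B' -> lfree B.
Proof.
move=> B'B exB [c [G [W [U [BE hG]]]]]; apply: lproj_lfree; pose P := G *m B'.
have fr : row_free (emx P).
  rewrite -kermx_eq0; apply/eqP/row_matrixP => i; rewrite row0.
  have : row i (kermx (emx P)) *m emx P = 0 by rewrite -row_mul mulmx_ker row0.
  move: (row i _) => v hv.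
  have [y hy] : exists y, (s *: imx v) *m P = l *: y.
    by rewrite -scalemxAl; apply/memL/max2_scale; rewrite // map_mxM emx_imx hv.
  have [u hu] : exists u, y = u *m B'.
    apply: exB; apply: lreg_mx; rewrite scalemxAl -hy /P -!mulmxA B'B.
    by rewrite !mulmx0.
  have /memL[w hw] : memx L (s *: imx v) by apply: (hG _ u); rewrite -/P hy hu.
  apply/rowP => j; have := congr1 (fun X : 'rV_c => lam (X 0 j)) hw.
  rewrite !mxE laml => <-.
  by rewrite lamM lam_s eps_s mul0r addr0 mul1r epsK.
have /row_freeP[R hR] := fr.
(* [R] inverts [P] on the right only modulo the maximal ideal; as C^2 vanishes modulo [l], the
   factor 1 - C corrects it to an inverse modulo [l]. *)
pose C := P *m imx R - 1%:M.
have eC : emx C = 0 by rewrite map_mxB map_mxM emx_imx hR map_mx1 subrr.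
have /memL[Z hZ] := max2_mx eC eC.
pose B1 := imx R *m (1%:M - C).
have PB1 : P *m B1 = 1%:M - l *: Z.
  have -> : P *m B1 = (C + 1%:M) *m (1%:M - C) by rewrite /B1 mulmxA subrK.
  by rewrite -hZ; mxring.
exists (1%:M - B1 *m P), 0; split.
  by rewrite subKr /P -!mulmxA B'B !mulmx0 mul0mx scaler0.
move=> v w hv; have [|u hu] := exB (v - l *: w).
  by rewrite mulmxBl -scalemxAl hv subrr.
have -> : v *m (1%:M - B1 *m P) =
  l *: ((w + u *m U *m B') *m (1%:M - B1 *m P) + u *m W *m Z *m P).
  have -> : v = l *: w + u *m B' by rewrite -hu addrC subrK.
  have e : u *m B' = u *m W *m P + l *: (u *m U *m B').
    by rewrite {1}BE mulmxDr -scalemxAr !mulmxA.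
  have e1 : u *m W *m P *m (1%:M - B1 *m P) = l *: (u *m W *m Z *m P).
    have -> : u *m W *m P *m (1%:M - B1 *m P) = u *m W *m (1%:M - P *m B1) *m P by mxring.
    by rewrite PB1; mxring.
  rewrite e scalerDr -e1; move: (1%:M - B1 *m P) (u *m W *m P) (u *m U *m B').
  by move=> E X Y; rewrite !mulmxDl -!scalemxAl scalerDr addrAC addrA.
by apply/memL; eexists.
Qed.

Lemma lfree_descent_complex b (D : forall n, 'M[S]_(b n.+1, b n)) n :
  row_exact [set 0] D -> lfree (D n) -> lfree (D 0%N).
Proof.
move=> /row_exact0[cD eD]; elim: n => // n IHn h; apply: IHn.
exact: lfree_descent (cD n) (eD n) h.
Qed.

Lemma mproj_lfree q t (B : 'M[S]_(q, t)) : mproj B -> lfree B.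
Proof.
move=> [E EB E0]; apply: lproj_lfree; exists E, 0; split.
  by rewrite mulmxBl mul1mx EB mul0mx scaler0 subrr.
move=> v w hv; apply/memL; exists (w *m E); apply/eqP.
by rewrite -subr_eq0 scalemxAl -mulmxBl E0 // mulmxBl hv -scalemxAl subrr.
Qed.

Variables (mu : {additive S -> k}) (t : S).
Hypotheses (muM : forall x y, mu (x * y) = mu x * eps y + eps x * mu y)
  (mul_ : forall x, mu (l * x) = 0).
Hypotheses (eps_t : eps t = 0) (mu_t : mu t = 1) (lam_t : lam t = 0) (mu_s : mu s = 0).

Let emx_derM (d : {additive S -> k}) m n p (X : 'M[S]_(m, n)) (Y : 'M[S]_(n, p)) :
  (forall x y, d (x * y) = d x * eps y + eps x * d y) -> emx X = 0 ->
  map_mx d (X *m Y) = map_mx d X *m emx Y.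
Proof.
move=> dM /matrixP eX; apply/matrixP => i j; rewrite !mxE raddf_sum.
apply: eq_bigr => a _; rewrite dM !mxE; have := eX i a; rewrite !mxE => ->.
by rewrite mul0r addr0.
Qed.

(* The maximal ideal of S/l has square zero and two independent elements s and t,
   so homology of the reduction of an exact complex at least doubles from one
   degree to the next. *)
Lemma betti_double o p q r (C : 'M[S]_(o, p)) (A : 'M_(p, q)) (B : 'M_(q, r)) :
  C *m A = 0 -> A *m B = 0 ->
  (forall v : 'rV_q, memx L (v *m B) -> exists w, memx L (v - w *m A)) ->
  (2 * (q - \rank (emx B) - \rank (emx A)) <=
     p - \rank (emx A) - \rank (emx C))%N.
Proof.
move=> CA AB exB.
have kAB : (emx A <= kermx (emx B))%MS by apply/sub_kermxP; rewrite -map_mxM AB map_mx0.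
have kCA : (emx C <= kermx (emx A))%MS by apply/sub_kermxP; rewrite -map_mxM CA map_mx0.
(* A complement of the boundaries in the cycles of the reduced complex: its rank is the dimension of
   the homology. *)
set K := (kermx (emx B) :\: emx A)%MS.
have hK : (\rank K = q - \rank (emx B) - \rank (emx A))%N.
  rewrite -mxrank_ker -(mxrank_cap_compl (kermx (emx B)) (emx A)) -/K.
  by rewrite (capmx_idPr kAB) addKn.
pose X := row_base K.
have XB : X *m emx B = 0.
  apply/sub_kermxP; rewrite eq_row_base; exact: diffmxSl.
have X0 u : (u *m X <= emx A)%MS -> u = 0.
  move=> uA; apply: (row_free_inj (row_base_free K)); rewrite mul0mx.
  apply/eqP; rewrite -submx0 -(capmx_diff (kermx (emx B)) (emx A)) sub_capmx uA andbT.
  by rewrite -/K -(eq_row_base K) submxMl.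
(* A cycle of the residue complex times an element of the maximal ideal is a cycle modulo [l], hence
   a boundary there. The lifts for [s] and [t] are the new cycles one degree higher. *)
have lift x : eps x = 0 -> exists W, memx L (x *: imx X - W *m A).
  move=> ex; apply: memx_lift => i; apply: exB.
  rewrite -row_mul -scalemxAl; apply: (proj1 (memx_rows L _)).
  by apply: max2_scale => //; rewrite map_mxM emx_imx.
have [Ws hs] := lift s eps_s; have [Wt ht] := lift t eps_t.
have eW x W : eps x = 0 -> memx L (x *: imx X - W *m A) -> emx W *m emx A = 0.
  move=> ex /memL[Y hY]; have := congr1 (fun X => emx X) hY.
  rewrite map_mxB !map_mxZ ex epsl !scale0r sub0r map_mxM => /eqP.
  by rewrite oppr_eq0 => /eqP.
pose Y := col_mx (emx Ws) (emx Wt).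
(* The derivations [lam] and [mu], dual to [s] and [t], read off the two parts of a relation: each
   turns out to be a boundary, hence zero by the choice of [K]. *)
have key (u1 u2 : 'rV_(\rank K)) (z : 'rV_o) : u1 *m emx Ws + u2 *m emx Wt = z *m emx C -> u1 = 0 /\ u2 = 0.
  move=> e; pose nu := imx u1 *m Ws + imx u2 *m Wt - imx z *m C.
  have enu : emx nu = 0 by rewrite map_mxB map_mxD !map_mxM !emx_imx e subrr.
  have : memx L (s *: imx (u1 *m X) + t *: imx (u2 *m X) - nu *m A).
    have -> : s *: imx (u1 *m X) + t *: imx (u2 *m X) - nu *m A =
       imx u1 *m (s *: imx X - Ws *m A) + imx u2 *m (t *: imx X - Wt *m A)
       + imx z *m (C *m A).
      by rewrite /nu !map_mxM; mxring.
    by rewrite CA mulmx0 addr0; apply: memxD => //; apply: memxMl.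
  move=> /memL[Z hZ].
  have der (d : {additive S -> k}) x : (forall x y, d (x * y) = d x * eps y + eps x * d y) ->
      (forall x, d (l * x) = 0) -> eps x = 0 ->
      forall w : 'rV_q, map_mx d (x *: imx w) = d x *: w.
    move=> dM dl ex w; apply/rowP => i; rewrite !mxE dM ex mul0r addr0.
    by rewrite epsK.
  have use (d : {additive S -> k}) : (forall x y, d (x * y) = d x * eps y + eps x * d y) ->
      (forall x, d (l * x) = 0) ->
      ((d s *: (u1 *m X) + d t *: (u2 *m X))%R <= emx A)%MS.
    move=> dM dl; have := congr1 (fun X => map_mx d X) hZ.
    have -> : map_mx d (l *: Z) = 0 by apply/matrixP => i j; rewrite !mxE dl.
    rewrite map_mxB map_mxD !der // emx_derM // => h.
    have e1 : d s *: (u1 *m X) + d t *: (u2 *m X) = map_mx d nu *m emx A.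
      by apply/eqP; rewrite -subr_eq0; apply/eqP.
    by rewrite e1 submxMl.
  split.
    by apply: X0; have := use lam lamM laml; rewrite lam_s lam_t scale1r scale0r addr0.
  by apply: X0; have := use mu muM mul_; rewrite mu_s mu_t scale1r scale0r add0r.
have YA : (Y <= kermx (emx A))%MS.
  by apply/sub_kermxP; rewrite mul_col_mx (eW s) // (eW t) // col_mx0.
have rY : row_free Y.
  rewrite -kermx_eq0; apply/eqP/row_matrixP => i; rewrite row0.
  have : row i (kermx Y) *m Y = 0 by rewrite -row_mul mulmx_ker row0.
  move: (row i _) => u; rewrite -[u]hsubmxK mul_row_col => e.
  by have [|-> ->] := key (lsubmx u) (rsubmx u) 0; rewrite ?mul0mx // row_mx0.
have YC : (Y :&: emx C)%MS = 0.
  apply/eqP; rewrite -submx0; apply/rV_subP => v.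
  rewrite sub_capmx => /andP[/submxP[u ->] /submxP[z]].
  rewrite -[u]hsubmxK mul_row_col => e.
  by have [-> ->] := key _ _ _ e; rewrite !mul0mx addr0 sub0mx.
have : (\rank (Y + emx C)%MS <= p - \rank (emx A))%N.
  by rewrite -mxrank_ker mxrankS // addsmx_sub YA kCA.
rewrite mxrank_disjoint_sum // (eqnP rY) => h.
by rewrite -hK leq_subRL ?mul2n -?addnn; [rewrite addnC|apply: leq_trans h; rewrite leq_addl].
Qed.

Lemma row_exact_modl b (D : forall n, 'M[S]_(b n.+1, b n)) n :
  row_exact [set 0] D -> forall v : 'rV_(b n.+2), memx L (v *m D n.+1) ->
  exists w, memx L (v - w *m D n.+2).
Proof.
move=> /row_exact0[cD eD] v /memL[w hw].
have [w' hw'] : exists w', w = w' *m D n.+1.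
  by apply: eD; apply: lreg_mx; rewrite scalemxAl -hw -mulmxA cD mulmx0.
have [|u hu] := eD n.+1 (v - l *: w').
  by rewrite mulmxBl hw hw' scalemxAl subrr.
by exists u; apply/memL; exists w'; rewrite -hu subKr.
Qed.

(** Exactness modulo [l] uses two degrees: the higher one to divide the defect by [l], the lower one
    to lift the corrected vector. [row_exact_modl] is the same argument on rows. *)
Lemma col_exact_modl b (D : forall n, 'M[S]_(b n.+1, b n)) n :
  row_exact [set 0] D -> col_exact [set 0] D n.+1 -> col_exact [set 0] D n.+2 ->
  forall u : 'cV_(b n.+1), memx L (D n.+1 *m u) -> exists w, memx L (u - D n *m w).
Proof.
move=> /row_exact0[cD eD] /col_exact0 c1 /col_exact0 c2 u /memL[w hw].
have [w' hw'] : exists w', w = D n.+1 *m w'.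
  by apply: c2; apply: lreg_mx; rewrite scalemxAr -hw mulmxA cD mul0mx.
have [|v hv] := c1 (u - l *: w').
  by rewrite mulmxBr hw hw' scalemxAr subrr.
by exists v; apply/memL; exists w'; rewrite -hv subKr.
Qed.

Lemma acyclic_lfree b (D : forall n, 'M[S]_(b n.+1, b n)) n :
  row_exact [set 0] D -> col_exact [set 0] D n.+3 -> col_exact [set 0] D n.+4 ->
  lfree (D 0%N).
Proof.
move=> hD c3 c4; have [cD eD] := (row_exact0 D).1 hD.
have h1 := betti_double (cD n.+2) (cD n.+1) (row_exact_modl hD).
have trT m1 m2 m3 (X : 'M[S]_(m1, m2)) (Y : 'M_(m2, m3)) : X *m Y = 0 -> Y^T *m X^T = 0.
  by move=> h; rewrite -trmx_mul h trmx0.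
have := betti_double (trT _ _ _ _ _ (cD n.+1)) (trT _ _ _ _ _ (cD n.+2)) _.
have rT m1 m2 (X : 'M[S]_(m1, m2)) : \rank (emx X^T) = \rank (emx X).
  by rewrite -map_trmx mxrank_tr.
rewrite !rT => h2.
have {}h2 : (2 * (b n.+3 - \rank (emx (D n.+3)) - \rank (emx (D n.+2))) <=
    b n.+2 - \rank (emx (D n.+2)) - \rank (emx (D n.+1)))%N.
  apply: h2 => v hv.
  have [|w hw] := col_exact_modl hD c3 c4 (u := v^T).
    by move=> i j; have := hv j i; rewrite -[v]trmxK -trmx_mul !mxE trmxK.
  exists w^T => i j; have := hw j i; rewrite -[v]trmxK -trmx_mul -linearB /=.
  by rewrite !mxE.
have {h1 h2} h0 : (b n.+3 - \rank (emx (D n.+3)) - \rank (emx (D n.+2)) = 0)%N.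
  by move: h1 h2; lia.
have kC : (kermx (emx (D n.+2)) <= emx (D n.+3))%MS.
  have CA : (emx (D n.+3) <= kermx (emx (D n.+2)))%MS.
    by apply/sub_kermxP; rewrite -map_mxM cD map_mx0.
  rewrite -(geq_leqif (mxrank_leqif_sup CA)) mxrank_ker.
  by move: h0; lia.
apply: (lfree_descent_complex (n := n.+1) hD); apply: lproj_lfree.
(* [Y] lifts a pseudo-inverse of the residue matrix of [A]. Vanishing homology gives A E0 = nu A
   with [nu] in the maximal ideal, so A E0^2 = nu^2 A lies in [l S], and E0^2 is the projector
   required by [lproj]. *)
pose A := D n.+2; pose Y := imx (pinvmx (emx A)); pose E0 := 1%:M - Y *m A.
have [U hU] : exists U, emx (1%:M - A *m Y) = U *m emx (D n.+3).
  apply/submxP/(submx_trans _ kC)/sub_kermxP.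
  by rewrite -map_mxM mulmxBl mul1mx map_mxB !map_mxM emx_imx mulmxKpV ?subrr.
pose nu := 1%:M - A *m Y - imx U *m D n.+3.
have enu : emx nu = 0 by rewrite map_mxB hU map_mxM emx_imx subrr.
have AE : A *m E0 = nu *m A.
  have -> : nu *m A = A *m E0 - imx U *m (D n.+3 *m A) by rewrite /nu /E0; mxring.
  by rewrite cD mulmx0 subr0.
have AEE : memx L (A *m (E0 *m E0)).
  by rewrite mulmxA AE -mulmxA AE mulmxA; apply: memxMr => //; apply: max2_mx.
exists (E0 *m E0), 0; split.
  have -> : (1%:M - E0 *m E0) *m D n.+1 = (1%:M + E0) *m (Y *m (A *m D n.+1)).
    by rewrite /E0; mxring.
  by rewrite cD !mulmx0 mul0mx scaler0.
move=> v w hv; have [|u hu] := eD n.+1 (v - l *: w).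
  by rewrite mulmxBl -scalemxAl hv subrr.
have -> : v *m (E0 *m E0) = l *: (w *m (E0 *m E0)) + u *m (A *m (E0 *m E0)).
  have e : v = l *: w + u *m A by rewrite -hu addrC subrK.
  by rewrite {1}e mulmxDl -scalemxAl -mulmxA.
apply: memxD => //; last exact: memxMl.
by apply/memL; eexists.
Qed.

End Descent.

End MinimalMultiplicity.

(** * Localization *)

Section Localization.
Variables (A : comNzRingType) (U : pred A).
Hypotheses (U1 : U 1) (UM : forall u v, U u -> U v -> U (u * v))
  (Ureg : forall u x, U u -> u * x = 0 -> x = 0).

(* A pair whose second component is not in U stands for a fraction with
   denominator 1. *)
Definition loc_den (p : A * A) := if U p.2 then p.2 else 1.

Let Uden p : U (loc_den p). Proof. by rewrite /loc_den; case: ifP. Qed.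
Let denE a u : U u -> loc_den (a, u) = u. Proof. by rewrite /loc_den /= => ->. Qed.

Definition loc_rel (p q : A * A) := p.1 * loc_den q == q.1 * loc_den p.

Fact loc_rel_equiv : equiv_class_of loc_rel.
Proof.
split=> [p|p q|q p r]; rewrite /loc_rel; [exact: eqxx|exact: eq_sym|].
move=> /eqP h1 /eqP h2; rewrite -subr_eq0; apply/eqP/(Ureg (Uden q)).
rewrite mulrBr (mulrCA _ p.1) (mulrCA _ r.1).
have -> : p.1 * (loc_den q * loc_den r) = q.1 * loc_den r * loc_den p.
  by rewrite mulrA h1; ring.
by rewrite h2; ring.
Qed.

Canonical loc_equiv := EquivRelPack loc_rel_equiv.

Definition loc : Type := {eq_quot loc_rel}%qT.

HB.instance Definition _ := Choice.on loc.
HB.instance Definition _ := Quotient.on loc.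

Definition frac (a u : A) : loc := \pi_(loc)%qT (a, u).

Lemma frac_eq a u b v : U u -> U v -> frac a u = frac b v <-> a * v = b * u.
Proof.
move=> Uu Uv; rewrite /frac; split=> [/eqquotP|h].
  by rewrite /= /loc_rel !denE // => /eqP.
by apply/eqquotP; rewrite /= /loc_rel !denE // h.
Qed.

Lemma loc_fracE (x : loc) : exists a u, U u /\ x = frac a u.
Proof.
exists (repr x).1, (loc_den (repr x)); split=> //.
by rewrite -[LHS]reprK; apply/eqquotP; rewrite /= /loc_rel denE //.
Qed.

Definition loc_add (x y : loc) :=
  let p := repr x in let q := repr y in
  frac (p.1 * loc_den q + q.1 * loc_den p) (loc_den p * loc_den q).
Definition loc_opp (x : loc) := frac (- (repr x).1) (loc_den (repr x)).
Definition loc_mul (x y : loc) :=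
  let p := repr x in let q := repr y in frac (p.1 * q.1) (loc_den p * loc_den q).

Let reprE a u : U u -> (repr (frac a u)).1 * u = a * loc_den (repr (frac a u)).
Proof.
move=> Uu; apply/(frac_eq _ _ _ Uu) => //.
by rewrite -[RHS](reprK (frac a u)); apply/eqquotP; rewrite /= /loc_rel denE.
Qed.

Lemma loc_addE a u b v : U u -> U v ->
  loc_add (frac a u) (frac b v) = frac (a * v + b * u) (u * v).
Proof.
move=> Uu Uv; rewrite /loc_add; move: (reprE a Uu) (reprE b Uv).
move: (repr (frac a u)) (repr (frac b v)) => p q hp hq.
apply/frac_eq; [exact: UM|exact: UM|].
have -> : (p.1 * loc_den q + q.1 * loc_den p) * (u * v) =
   (p.1 * u) * (loc_den q * v) + (q.1 * v) * (loc_den p * u) by ring.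
by rewrite hp hq; ring.
Qed.

Lemma loc_oppE a u : U u -> loc_opp (frac a u) = frac (- a) u.
Proof.
move=> Uu; rewrite /loc_opp; apply/frac_eq => //.
by rewrite mulNr reprE // mulNr.
Qed.

Lemma loc_mulE a u b v : U u -> U v ->
  loc_mul (frac a u) (frac b v) = frac (a * b) (u * v).
Proof.
move=> Uu Uv; rewrite /loc_mul; move: (reprE a Uu) (reprE b Uv).
move: (repr (frac a u)) (repr (frac b v)) => p q hp hq.
apply/frac_eq; [exact: UM|exact: UM|].
have -> : p.1 * q.1 * (u * v) = (p.1 * u) * (q.1 * v) by ring.
by rewrite hp hq; ring.
Qed.

Let W (Q : loc -> Prop) : (forall a u, U u -> Q (frac a u)) -> forall x, Q x.
Proof. by move=> h x; have [a [u [Uu ->]]] := loc_fracE x; apply: h. Qed.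

Fact loc_addA : associative loc_add.
Proof.
elim/W=> a u Uu; elim/W=> b v Uv; elim/W=> c w Uw.
rewrite !loc_addE //; do ?exact: UM.
by apply/frac_eq => //; do ?apply: UM => //; ring.
Qed.
Fact loc_addC : commutative loc_add.
Proof.
elim/W=> a u Uu; elim/W=> b v Uv; rewrite !loc_addE //.
by apply/frac_eq => //; do ?apply: UM => //; ring.
Qed.
Fact loc_add0 : left_id (frac 0 1) loc_add.
Proof.
elim/W=> a u Uu; rewrite !loc_addE //.
by apply/frac_eq => //; do ?apply: UM => //; ring.
Qed.
Fact loc_addN : left_inverse (frac 0 1) loc_opp loc_add.
Proof.
elim/W=> a u Uu; rewrite loc_oppE // loc_addE //.
by apply/frac_eq => //; do ?apply: UM => //; ring.
Qed.

HB.instance Definition _ := GRing.isZmodule.Build loc loc_addA loc_addC loc_add0 loc_addN.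

Fact loc_mulA : associative loc_mul.
Proof.
elim/W=> a u Uu; elim/W=> b v Uv; elim/W=> c w Uw.
rewrite !loc_mulE //; do ?exact: UM.
by apply/frac_eq => //; do ?apply: UM => //; ring.
Qed.
Fact loc_mulC : commutative loc_mul.
Proof.
elim/W=> a u Uu; elim/W=> b v Uv; rewrite !loc_mulE //.
by apply/frac_eq => //; do ?apply: UM => //; ring.
Qed.
Fact loc_mul1 : left_id (frac 1 1) loc_mul.
Proof.
elim/W=> a u Uu; rewrite !loc_mulE //.
by apply/frac_eq => //; do ?apply: UM => //; ring.
Qed.
Fact loc_mulDl : left_distributive loc_mul +%R.
Proof.
elim/W=> a u Uu; elim/W=> b v Uv; elim/W=> c w Uw.
change (loc_mul (loc_add (frac a u) (frac b v)) (frac c w) =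
  loc_add (loc_mul (frac a u) (frac c w)) (loc_mul (frac b v) (frac c w))).
have Uuv := UM Uu Uv; have Uuw := UM Uu Uw; have Uvw := UM Uv Uw.
rewrite loc_addE // !loc_mulE // loc_addE //.
by apply/frac_eq => //; do ?apply: UM => //; ring.
Qed.
Fact loc_1neq0 : frac 1 1 != 0.
Proof.
apply/eqP => /(frac_eq 1 0 U1 U1)/eqP; rewrite mul0r mulr1.
by rewrite oner_eq0.
Qed.

HB.instance Definition _ := GRing.Zmodule_isComNzRing.Build loc
  loc_mulA loc_mulC loc_mul1 loc_mulDl loc_1neq0.

Theorem localization : exists (Q : comNzRingType) (i : {rmorphism A -> Q}),
  [/\ injective i, forall u, U u -> exists y, i u * y = 1,
      forall x, exists a u, U u /\ x * i u = i a &
      forall (R : comNzRingType) (h : {rmorphism A -> R}),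
        (forall u, U u -> exists y, h u * y = 1) ->
        exists g : {rmorphism Q -> R}, forall a, g (i a) = h a].
Proof.
pose i a : loc := frac a 1.
have iB : {morph i : x y / x - y}.
  move=> a b; change (frac (a - b) 1 = loc_add (frac a 1) (loc_opp (frac b 1))).
  rewrite loc_oppE // loc_addE //; apply/frac_eq; do ?exact: UM; by [|ring].
have iM : monoid_morphism i.
  split=> // a b; change (frac (a * b) 1 = loc_mul (frac a 1) (frac b 1)).
  rewrite loc_mulE //; apply/frac_eq; do ?exact: UM; by [|ring].
pose i' := HB.pack_for {rmorphism A -> loc} i
  (GRing.isZmodMorphism.Build _ _ i iB) (GRing.isMonoidMorphism.Build _ _ i iM).
exists (loc : comNzRingType), i'; split.
- by move=> a b /frac_eq; rewrite !mulr1; apply.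
- move=> u Uu; exists (frac 1 u); change (loc_mul (frac u 1) (frac 1 u) = frac 1 1).
  by rewrite loc_mulE //; apply/frac_eq => //; do ?apply: UM => //; ring.
- move=> x; have [a [u [Uu ->]]] := loc_fracE x; exists a, u; split=> //.
  change (loc_mul (frac a u) (frac u 1) = frac a 1).
  by rewrite loc_mulE //; apply/frac_eq => //; do ?apply: UM => //; ring.
move=> R h hU.
have /choice[inv invE] : forall u, exists y, U u -> h u * y = 1.
  move=> u; have [Uu|nU] := boolP (U u); last by exists 0.
  by have [y hy] := hU u Uu; exists y.
pose g (x : loc) := h (repr x).1 * inv (loc_den (repr x)).
have gE a u : U u -> g (frac a u) * h u = h a.
  move=> Uu; rewrite /g; have := reprE a Uu; move: (repr _) => p /(congr1 h).
  rewrite !rmorphM => e; rewrite mulrAC e -mulrA invE ?mulr1 //.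
have hreg u x y : U u -> x * h u = y * h u -> x = y.
  move=> Uu /(congr1 (fun z => z * inv u)).
  by rewrite -!mulrA invE // !mulr1.
have gB : {morph g : x y / x - y}.
  elim/W=> a u Uu; elim/W=> b v Uv; apply: (hreg (u * v)); first exact: UM.
  change (g (loc_add (frac a u) (loc_opp (frac b v))) * h (u * v) =
    (g (frac a u) - g (frac b v)) * h (u * v)).
  rewrite loc_oppE // loc_addE // gE; last exact: UM.
  rewrite rmorphD !rmorphM rmorphN mulrBl mulrA gE // (mulrC (h u)) mulrA gE //.
  by rewrite mulNr.
have gM : monoid_morphism g.
  split; first by rewrite -[RHS](rmorph1 h) -(gE 1 1 U1) rmorph1 mulr1.
  elim/W=> a u Uu; elim/W=> b v Uv; apply: (hreg (u * v)); first exact: UM.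
  change (g (loc_mul (frac a u) (frac b v)) * h (u * v) =
    (g (frac a u) * g (frac b v)) * h (u * v)).
  rewrite loc_mulE // gE; last exact: UM.
  by rewrite !rmorphM mulrACA !gE.
pose g' := HB.pack_for {rmorphism loc -> R} g
  (GRing.isZmodMorphism.Build _ _ g gB) (GRing.isMonoidMorphism.Build _ _ g gM).
by exists g' => a; rewrite /= -(gE a 1 U1) rmorph1 mulr1.
Qed.

End Localization.

(** * Hypersurfaces of minimal multiplicity *)

Section LeastDim.
Variables (A : comNzRingType) (M : lmodType A) (P : nat -> Prop).

Lemma least_dim0 : (forall x : M, x = 0) -> least_dim M P = -oo%E.
Proof. by move=> h; rewrite /least_dim asboolT. Qed.

Lemma least_dim_oo : (exists x : M, x <> 0) -> (forall n, ~ P n) -> least_dim M P = +oo%E.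
Proof.
move=> [x x0] h; rewrite /least_dim asboolF => [|h0]; last exact/x0/h0.
case: pselect => // ex; exfalso.
by case: ex => n /asboolP Pn; case: (h n).
Qed.

Lemma least_dim_eq n : (exists x : M, x <> 0) -> P n ->
  (forall m, (m < n)%N -> ~ P m) -> least_dim M P = (n%:Z)%:E.
Proof.
move=> [x x0] Pn h; rewrite /least_dim asboolF => [|h0]; last exact/x0/h0.
case: pselect => [ex|[]]; last by exists n; apply/asboolP.
case: ex_minnP => m /asboolP Pm /(_ n) mn.
have {}mn : (m <= n)%N by apply: mn; apply/asboolP.
congr (_%:E); congr (_%:Z); apply/eqP; rewrite eqn_leq mn leqNgt /=.
by apply/negP => mn'; exact: h mn' Pm.
Qed.

Lemma least_dim_leq n : (exists x : M, x <> 0) -> P n ->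
  exists2 m, (m <= n)%N & least_dim M P = (m%:Z)%:E.
Proof.
move=> [x x0] Pn; rewrite /least_dim asboolF => [|h0]; last exact/x0/h0.
case: pselect => [ex|[]]; last by exists n; apply/asboolP.
case: ex_minnP => m _ /(_ n) mn; exists m => //.
by apply: mn; apply/asboolP.
Qed.

Lemma least_dim_cases : (exists x : M, x <> 0) ->
  (forall n, ~ P n) \/ exists2 n, P n & least_dim M P = (n%:Z)%:E.
Proof.
move=> [x x0]; have [[n Pn]|h] := pselect (exists n, P n); last first.
  by left=> n Pn; apply: h; exists n.
right; rewrite /least_dim asboolF => [|h0]; last exact/x0/h0.
case: pselect => [ex|[]]; last by exists n; apply/asboolP.
by case: ex_minnP => m /asboolP Pm _; exists m.
Qed.

End LeastDim.

Lemma infimum_min d (T : porderType d) (x0 x : T) (V : set T) :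
  V x -> (forall y, V y -> (x <= y)%O) -> infimum x0 V = x.
Proof.
move=> Vx h; rewrite /infimum; case: eqP => [V0|_]; first by rewrite V0 in Vx.
case: xgetP => [y -> [h1 h2]|/(_ x)[]].
  by apply/eqP; rewrite eq_le h1 //= h2.
by split=> // y; apply.
Qed.

(** The default value is the constant itself, so the empty set gives the same answer. *)
Lemma infimum_cst d (T : porderType d) (x : T) (V : set T) :
  (forall y, V y -> y = x) -> infimum x V = x.
Proof.
move=> h; have [->|/set0P[y Vy]] := eqVneq V set0; first by rewrite /infimum eqxx.
by apply: infimum_min => [|z /h ->//]; rewrite -(h y Vy).
Qed.

Section Factorization.
Variables (A B : comNzRingType) (p : {rmorphism A -> B}) (f u : A).
Hypotheses (ps : forall y, exists x, p x = y)
  (pk : forall x, p x = 0 <-> exists a, x = f * a).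
Hypotheses (pu : exists y, p u * y = 1) (freg : forall x, f * x = 0 -> x = 0).

Lemma kernel_mx a b (Z : 'M[A]_(a, b)) : map_mx p Z = 0 -> exists W, Z = f *: W.
Proof.
move=> /matrixP h.
have /choice[g gE] : forall ij : 'I_a * 'I_b, exists c, Z ij.1 ij.2 = f * c.
  by move=> ij; apply/pk; have := h ij.1 ij.2; rewrite !mxE.
by exists (\matrix_(i, j) g (i, j)); apply/matrixP => i j; rewrite !mxE (gE (i, j)).
Qed.

Lemma regular_mx a b (Z : 'M[A]_(a, b)) : f *: Z = 0 -> Z = 0.
Proof.
move=> /matrixP h; apply/matrixP => i j; rewrite [RHS]mxE; apply: freg.
by have := h i j; rewrite !mxE.
Qed.

Lemma map_kernel : p f = 0. Proof. by apply/pk; exists 1; rewrite mulr1. Qed.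

(** Eisenbud's argument: if v X = f W, then multiplying by [Y] gives u f v = f W Y; [f] cancels in
    [A], and [u] is a unit in [B]. *)
Lemma factorization_exact m n (X : 'M[A]_(m, n)) (Y : 'M_(n, m)) :
  X *m Y = (u * f)%:M -> Y *m X = (u * f)%:M ->
  forall v : 'rV[B]_m, v *m map_mx p X = 0 <-> exists w, v = w *m map_mx p Y.
Proof.
move=> XY YX v; have [y hy] := pu.
split=> [hv|[w ->]]; last first.
  rewrite -mulmxA -map_mxM YX map_scalar_mx rmorphM map_kernel mulr0.
  by rewrite mul_mx_scalar scale0r.
have [v' v'E] := lift_mx ps v; rewrite -v'E in hv *.
have [W hW] : exists W, v' *m X = f *: W by apply: kernel_mx; rewrite map_mxM.
have e : u *: v' = W *m Y.
  apply/eqP; rewrite -subr_eq0; apply/eqP/regular_mx.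
  rewrite scalerBr scalemxAl -hW -mulmxA XY mul_mx_scalar scalerA (mulrC u).
  by rewrite subrr.
exists (y *: map_mx p W); rewrite -scalemxAl -map_mxM -e map_mxZ scalerA mulrC.
by rewrite hy scale1r.
Qed.

Variables (t c : nat) (P : 'M[A]_(c, t)) (Q : 'M[A]_(t, c)).
Hypotheses (PQ : P *m Q = (u * f)%:M) (QP : Q *m P = (u * f)%:M).
Variables (M : lmodType B) (a : {linear 'rV[B]_t -> M}).
Hypotheses (as_ : forall y, exists v, a v = y)
  (ak : forall v, a v = 0 <-> exists w, v = w *m map_mx p P).

Lemma factorization_Gdim_zero : Gdim_zero M.
Proof.
have tT m n q (X : 'M[A]_(m, n)) (Y : 'M_(n, q)) (d : A) (D : 'M_(m, q)) :
    X *m Y = D -> Y^T *m X^T = D^T by move=> <-; rewrite trmx_mul.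
have col m n (X : 'M[A]_(m, n)) (Y : 'M_(n, m)) : X *m Y = (u * f)%:M ->
    Y *m X = (u * f)%:M -> forall v : 'cV[B]_n,
    map_mx p X *m v = 0 <-> exists w, v = map_mx p Y *m w.
  move=> XY YX v; have h := @factorization_exact _ _ X^T Y^T _ _ v^T.
  have {h} [h1 h2] : v^T *m map_mx p X^T = 0 <-> exists w, v^T = w *m map_mx p Y^T.
    by apply: h; rewrite -trmx_mul ?XY ?YX tr_scalar_mx.
  split=> [hv|[w hw]].
    have [|w hw] := h1; first by rewrite -map_trmx -trmx_mul hv trmx0.
    by exists w^T; rewrite -[v]trmxK hw trmx_mul map_trmx trmxK.
  apply: trmx_inj; rewrite trmx_mul map_trmx trmx0; apply: h2.
  by exists w^T; rewrite hw trmx_mul map_trmx.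
apply: (Gdim_zero_periodic (P := map_mx p P) (Q := map_mx p Q) (a := a)) => //.
- exact: factorization_exact.
- exact: factorization_exact.
- exact: col.
- exact: col.
Qed.

(** Here [u] must be invertible in [A] itself, which is why this is applied to the localization of
    [S]. *)
Lemma factorization_pd_le1 : (exists y, u * y = 1) -> pd_le 1 (restr p M).
Proof.
move=> [y hy]; have [j jE] := linear_mxE (mulmxr P : {linear 'rV[A]_c -> 'rV[A]_t}).
have lb : linear (fun v : 'rV[A]_t => a (map_mx p v) : restr p M).
  by move=> e v w; rewrite map_mxD map_mxZ linearP.
have [b bE] := linear_pack lb.
exists ('rV[A]_c : lmodType A), ('rV[A]_t : lmodType A),
  (mulmxr P : {linear 'rV[A]_c -> 'rV[A]_t}), b.
split; [exact: projective_rV| |exact: projective_rV]; split.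
- apply: linear_inj => v /= hv; have := congr1 (mulmx^~ Q) hv.
  rewrite /= -mulmxA PQ mul0mx mul_mx_scalar => h.
  rewrite -[v]scale1r -hy mulrC -scalerA -[RHS](scaler0 _ y); congr (_ *: _).
  by apply: regular_mx; rewrite scalerA mulrC.
- by move=> z; have [v hv] := as_ z; have [v' hv'] := lift_mx ps v; exists v'; rewrite bE hv'.
- move=> v; rewrite bE; split=> [/ak[w hw]|[w <-]]; last first.
    by apply/ak; exists (map_mx p w); rewrite -map_mxM.
  have [w' hw'] := lift_mx ps w.
  have [z hz] : exists z, v - w' *m P = f *: z.
    by apply: kernel_mx; rewrite map_mxB map_mxM hw' hw subrr.
  exists (w' + y *: (z *m Q)) => /=.
  rewrite mulmxDl -scalemxAl -mulmxA QP mul_mx_scalar scalerA mulrA (mulrC y) hy mul1r.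
  by rewrite -hz addrC subrK.
Qed.

End Factorization.

Lemma local_ring_of_units (A : comNzRingType) (P : set A) :
  is_ideal P -> ~ P 1 -> (forall x, ~ P x -> exists y, x * y = 1) ->
  maximal_ideal P /\ forall J, maximal_ideal J -> J = P.
Proof.
move=> hP P1 hU; have h J : is_ideal J -> ~ J 1 -> J `<=` P.
  move=> hJ J1 y Jy; apply: contrapT => /hU[z hz]; apply: J1.
  by rewrite -hz; apply: idealMr.
split=> [|J [hJ J1 hmax]]; last by symmetry; apply: hmax => //; apply: h.
by split=> // J hJ J1 sJ; apply/seteqP; split=> //; apply: h.
Qed.

Lemma flat_id (A : comNzRingType) : flat_morphism (idfun : {rmorphism A -> A}).
Proof.
move=> M M' f N N' j j' fB [lj uj] [lj' uj'] fj fi.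
have inj (P Q : lmodType A) (i : P -> Q) : is_base_change (idfun : {rmorphism A -> A}) i ->
    injective i /\ forall y, exists x, i x = y.
  move=> [li ui].
  have [|h [hE _]] := ui P (fun x => x); first by [].
  have [h' [_ h'u]] := ui Q i li.
  have lih : linear (fun y => i (h y)) by move=> a x y; rewrite linearP li.
  have [ih ihE] := linear_pack lih.
  split=> [x y /(congr1 h)|y]; first by rewrite !hE.
  exists (h y); rewrite -ihE -[RHS]/((idfun : {linear Q -> Q}) y).
  by rewrite (h'u ih) ?(h'u (idfun : {linear Q -> Q})) // => x; rewrite ihE hE.
have [_ js] := inj _ _ j (conj lj uj); have [j'i _] := inj _ _ j' (conj lj' uj').
move=> y y'; have [x <-] := js y; have [x' <-] := js y'.
by rewrite !fj => /j'i/fi->.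
Qed.

Lemma base_change_id (A : comNzRingType) (M : lmodType A) :
  is_base_change (idfun : {rmorphism A -> A}) (fun x : M => x).
Proof.
split=> [a x y|P g lg] //; have [h hE] := linear_pack (lg : linear g).
by exists h; split=> // h' h'E x; rewrite h'E hE.
Qed.

Lemma fin_gen_regular (A : comNzRingType) : fin_gen (A^o : lmodType A).
Proof.
have [|p pE] := @linear_pack A 'rV[A]_1 A^o (fun v => v 0 0).
  by move=> c x y; rewrite mxaddE mxscaleE.
by exists 1%N, p => y; exists y%:M; rewrite pE mxE eqxx.
Qed.

Section Hypersurface.
Variables (k : fieldType) (S : comAlgType k) (eps : {rmorphism S -> k}) (l f z0 : S).
Hypotheses (epsK : forall c : k, eps c%:A = c) (epsl : eps l = 0) (epsf : eps f = 0).
Hypotheses (lreg : forall x, l * x = 0 -> x = 0) (freg : forall x, f * x = 0 -> x = 0).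
Hypothesis max2 : forall x y, eps x = 0 -> eps y = 0 -> exists z, x * y = l * z.
Hypothesis sepl : forall x, (forall N, exists y, x = l ^+ N * y) -> x = 0.
Hypothesis lf : l ^+ 3 = f * z0.
Variables (R : comNzRingType) (phi : {rmorphism S -> R}).
Hypotheses (phis : forall y, exists x, phi x = y)
  (phik : forall x, phi x = 0 <-> exists a, x = f * a).
Hypothesis nS : is_noetherian S.

(** An inverse modulo [l] only, obtained from (1 - nu)(1 + nu) = 1 - nu^2 with nu^2 in [l S]. *)
Lemma unit_eps x : eps x != 0 -> exists y a, x * y = 1 - l * a.
Proof.
move=> ex; pose c := eps x; pose nu := 1 - c^-1%:A * x.
have enu : eps nu = 0 by rewrite /nu rmorphB rmorph1 rmorphM epsK mulVf ?subrr.
have [z hz] := max2 enu enu.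
exists (c^-1%:A * (1 + nu)), z; rewrite -hz.
have -> : x * (c^-1%:A * (1 + nu)) = (1 - nu) * (1 + nu) by rewrite /nu; ring.
by ring.
Qed.

Lemma unit_phi x : eps x != 0 -> exists y, phi x * y = 1.
Proof.
(* Three terms of the geometric series invert 1 - l a, since l^3 maps to 0 in [R]. *)
move=> /unit_eps[y [a h]]; exists (phi (y * (1 + l * a + l ^+ 2 * a ^+ 2))).
rewrite -rmorphM mulrA h.
have -> : (1 - l * a) * (1 + l * a + l ^+ 2 * a ^+ 2) = 1 - f * (z0 * a ^+ 3).
  by rewrite mulrA -lf; ring.
by rewrite rmorphB rmorph1 rmorphM map_kernel // mul0r subr0.
Qed.

(** From u x = 0 one gets x = l a x, so x is divisible by all powers of [l]. This allows localizing
    at the kernel of [eps]. *)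
Lemma regular_eps u x : eps u != 0 -> u * x = 0 -> x = 0.
Proof.
move=> /unit_eps[y [a h]] ux.
have e : x = l * a * x.
  apply/eqP; rewrite -subr_eq0 -[X in X - _]mul1r -mulrBl -h.
  by rewrite mulrAC ux mul0r.
apply: sepl => N; exists (a ^+ N * x).
elim: N => [|N IHN]; first by rewrite !mul1r.
by rewrite {1}IHN {1}e !exprSr; ring.
Qed.

Let PR : set R := [set y | exists2 x, eps x = 0 & phi x = y].

Lemma residue_ideal : is_ideal PR.
Proof.
split=> [|_ _ [x ex <-] [y ey <-]|z _ [x ex <-]].
- by exists 0; rewrite rmorph0.
- by exists (x + y); rewrite rmorphD // ex ey addr0.
- by have [w <-] := phis z; exists (w * x); rewrite rmorphM // ex mulr0.
Qed.

Lemma residue_proper : ~ PR 1.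
Proof.
move=> [x ex] e; have [a ha] : exists a, x - 1 = f * a.
  by apply/phik; rewrite rmorphB rmorph1 e subrr.
have /eqP := congr1 eps ha.
by rewrite rmorphB rmorph1 ex sub0r rmorphM epsf mul0r oppr_eq0 oner_eq0.
Qed.

Lemma residue_unit y : ~ PR y -> exists z, y * z = 1.
Proof.
have [x <-] := phis y => h; apply: unit_phi; apply/eqP => ex; apply: h.
by exists x.
Qed.

Lemma residue_local : maximal_ideal PR /\ forall J, maximal_ideal J -> J = PR.
Proof.
exact: local_ring_of_units residue_ideal residue_proper residue_unit.
Qed.

Lemma hypersurface_regular : regular_seq [:: f].
Proof.
split=> [/ideal_span1[a e]|[|//] _ x].
  have /eqP := congr1 eps e.
  by rewrite rmorph1 rmorphM epsf mul0r oner_eq0.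
by rewrite /= ideal_span_nil => /freg.
Qed.

Lemma hypersurface_kernel : kernel phi = ideal_span [:: f].
Proof. by apply/seteqP; split=> x; rewrite /kernel /= phik ideal_span1. Qed.

Lemma noetherian_hypersurface : is_noetherian R.
Proof. exact: noetherian_image phis nS. Qed.

Section Module.
Variable M : lmodType R.
Variables (b : nat -> nat) (D : forall n, 'M[R]_(b n.+1, b n)) (a : {linear 'rV[R]_(b 0) -> M}).
Hypothesis hD : resol D a.
Variables (g : nat -> nat) (G : forall n, 'M[S]_(g n.+1, g n))
  (aS : {linear 'rV[S]_(g 0) -> restr phi M}).
Hypotheses (hG : resol G aS)
  (hGc : forall n, col_exact [set 0] G (n + 1) <-> col_exact [set 0] D n).

(* K_1 / l K_1 is free over S/l, with K_1 the first syzygy of M over S. *)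
Hypothesis hfree : lfree l (G 0).

Lemma syzygy_multiple : exists Phi, Phi *m G 0 = f%:M.
Proof.
have [Phi hPhi] : exists Phi, f%:M = Phi *m G 0; last by exists Phi.
apply: (resol_lift hG) => v; rewrite mul_mx_scalar linearZ /=.
by rewrite -[LHS]/(phi f *: (aS v : M)) map_kernel // scale0r.
Qed.

(** The row spaces of [P] and [G 0] may differ over [S], but u G_0 factors through [P] and [P]
    through [G 0]; since [u] is a unit in [R], both present the same [R]-module [M]. *)
Lemma factorization_of_lfree :
  exists c (P : 'M[S]_(c, g 0)) (Q : 'M[S]_(g 0, c)) u (al : {linear 'rV[R]_(g 0) -> M}),
  [/\ eps u = 1, P *m Q = (u * f)%:M, Q *m P = (u * f)%:M, (forall y, exists v, al v = y) &
      forall v, al v = 0 <-> exists w, v = w *m map_mx phi P].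
Proof.
have [Phi hPhi] := syzygy_multiple.
have [c [P [Q [e [PQ QP [H PE] [W WE] _]]]]] :=
  lfree_factorization epsl lreg sepl lf hPhi hfree.
have eu : eps (1 - l * e) = 1 by rewrite rmorphB rmorph1 rmorphM epsl mul0r subr0.
have [al alE] := rV_linear_map (fun i => aS 'e_i : M).
have alp v : al (map_mx phi v) = aS v.
  rewrite alE (linear_rVE aS); apply: eq_bigr => i _.
  by rewrite mxE.
have [aSs aSk eG] := hG.
exists c, P, Q, (1 - l * e), al; split=> //.
  by move=> y; have [v hv] := aSs y; exists (map_mx phi v); rewrite alp.
move=> v; have [v' <-] := lift_mx phis v; rewrite alp.
have -> : aS v' = 0 :> M <-> exists w, v' = w *m G 0 by exact: aSk.
split=> [[w hw]|[w hw]].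
  have [|y hy] := unit_phi (x := 1 - l * e); first by rewrite eu oner_eq0.
  exists (y *: map_mx phi (w *m W)).
  rewrite -scalemxAl -map_mxM -mulmxA -WE -scalemxAr -hw map_mxZ scalerA mulrC hy.
  by rewrite scale1r.
have [w' hw'] := lift_mx phis w.
have [z hz] : exists z, v' - w' *m P = f *: z.
  by apply: (kernel_mx phik); rewrite map_mxB map_mxM hw' hw subrr.
exists (w' *m H + z *m Phi).
have -> : (w' *m H + z *m Phi) *m G 0 = w' *m (H *m G 0) + z *m (Phi *m G 0).
  by rewrite mulmxDl !mulmxA.
by rewrite -PE hPhi mul_mx_scalar -hz addrC subrK.
Qed.

Lemma lfree_pd_le1 : pd_le 1 (restr phi M).
Proof.
have [Phi hPhi] := syzygy_multiple.
have [c [P [Q [e [_ _ _ _ mp]]]]] := lfree_factorization epsl lreg sepl lf hPhi hfree.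
exact: mproj_pd_le hG mp.
Qed.

Lemma lfree_Gdim_zero : Gdim_zero M.
Proof.
have [c [P [Q [u [al [eu PQ QP als alk]]]]]] := factorization_of_lfree.
apply: (factorization_Gdim_zero phis phik _ freg PQ QP als alk).
by apply: unit_phi; rewrite eu oner_eq0.
Qed.

End Module.

(** * The quasi-deformation given by the localization of S *)

Section LocalRing.
Variables (Q : comNzRingType) (i : {rmorphism S -> Q}) (psi : {rmorphism Q -> R}).
Hypotheses (ii : injective i) (iU : forall u, eps u != 0 -> exists y, i u * y = 1)
  (iQ : forall x, exists a u, eps u != 0 /\ x * i u = i a)
  (psii : forall a, psi (i a) = phi a).
Variable epsQ : {rmorphism Q -> k}.
Hypothesis epsQi : forall a, epsQ (i a) = eps a.

Lemma localization_noetherian : is_noetherian Q.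
Proof.
move=> I hI; have [I0 ID IM] := hI.
have [s sE] : exists s, [set a | I (i a)] = ideal_span s.
  apply: nS; split=> [|x y hx hy|a x hx] /=.
  - by rewrite rmorph0.
  - by rewrite rmorphD; apply: ID.
  - by rewrite rmorphM; apply: IM.
exists (map i s); apply/seteqP; split=> [x Ix|].
  have [a [u [hu xu]]] := iQ x; have [y hy] := iU hu.
  have -> : x = y * i a by rewrite -xu mulrCA (mulrC y) hy mulr1.
  case: (ideal_span_ideal (map i s)) => _ _; apply; apply: ideal_span_map.
  by rewrite -sE /= -xu mulrC; apply: IM.
apply: ideal_span_min => // _ /mapP[x xs ->].
by have : ideal_span s x by [exact: ideal_span_mem]; rewrite -sE.
Qed.

Lemma localization_local : maximal_ideal (kernel epsQ) /\
  forall J, maximal_ideal J -> J = kernel epsQ.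
Proof.
apply: local_ring_of_units.
- split=> [|x y|a x]; rewrite /kernel /=; first by rewrite rmorph0.
    by move=> hx hy; rewrite rmorphD hx hy addr0.
  by move=> hx; rewrite rmorphM hx mulr0.
- by rewrite /kernel /= rmorph1 => /eqP; rewrite oner_eq0.
move=> x /eqP ex; have [a [u [hu xu]]] := iQ x.
have [|y hy] := iU (u := a).
  by rewrite -epsQi -xu rmorphM epsQi mulf_neq0.
by exists (i u * y); rewrite mulrA xu.
Qed.

Lemma localization_quasi_deformation :
  quasi_deformation (idfun : {rmorphism R -> R}) psi /\
  [/\ forall y, exists x, psi x = y, regular_seq [:: i f],
      kernel psi = ideal_span [:: i f] & forall x, i f * x = 0 -> x = 0].
Proof.
have psis y : exists x, psi x = y by have [x <-] := phis y; exists (i x).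
have regQ x : i f * x = 0 -> x = 0.
  move=> hx; have [a [u [hu xu]]] := iQ x; have [y hy] := iU hu.
  have a0 : a = 0.
    by apply: freg; apply: ii; rewrite rmorphM -xu mulrA hx mul0r rmorph0.
  by rewrite -[x]mulr1 -hy mulrA xu a0 rmorph0 mul0r.
have pif : psi (i f) = 0 by rewrite psii map_kernel.
have kQ : kernel psi = ideal_span [:: i f].
  apply/seteqP; split=> x; rewrite /kernel /= ideal_span1; last first.
    by move=> [z ->]; rewrite rmorphM pif mul0r.
  move=> px; have [a [u [hu xu]]] := iQ x; have [y hy] := iU hu.
  have [z hz] : exists z, a = f * z by apply/phik; rewrite -psii -xu rmorphM px mul0r.
  exists (i z * y); rewrite -[x]mulr1 -hy mulrA xu hz rmorphM.
  by rewrite mulrA.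
have sreg : regular_seq [:: i f].
  split=> [/ideal_span1[z /(congr1 psi)/eqP]|[|//] _ x].
    by rewrite rmorph1 rmorphM pif mul0r oner_eq0.
  by rewrite /= ideal_span_nil => /regQ.
split=> //; have [mR uR] := residue_local; have [mQ uQ] := localization_local.
split.
- by split; [exact: noetherian_hypersurface|exists PR].
- by split; [exact: localization_noetherian|exists (kernel epsQ)].
- split; last exact: flat_id.
  by move=> P P' /uR-> /uR->.
- split=> // P P' /uQ-> /uR-> x ex; have [a [u [hu xu]]] := iQ x.
  have [y hy] := unit_phi hu.
  have ea : eps a = 0 by rewrite -epsQi -xu rmorphM ex mul0r.
  change (PR (psi x)); have -> : psi x = phi a * y by rewrite -psii -xu rmorphM psii -mulrA hy mulr1.
  by apply: idealMr residue_ideal _; exists a.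
- by exists [:: i f].
Qed.

End LocalRing.

Variables (lam mu : {additive S -> k}) (s t : S).
Hypotheses (lamM : forall x y, lam (x * y) = lam x * eps y + eps x * lam y)
  (laml : forall x, lam (l * x) = 0) (muM : forall x y, mu (x * y) = mu x * eps y + eps x * mu y)
  (mul_ : forall x, mu (l * x) = 0).
Hypotheses (eps_s : eps s = 0) (eps_t : eps t = 0) (lam_s : lam s = 1) (mu_t : mu t = 1)
  (lam_t : lam t = 0) (mu_s : mu s = 0).

(** What an arbitrary quasi-deformation yields: its contribution to the CI-dimension is at least 0,
    because pd A' <= length of the sequence <= pd N; and if it is finite, the resolution [D] is
    eventually exact after dualizing, by descent along the flat map. *)
Lemma quasi_deformation_lower (M : lmodType R) b (D : forall n, 'M[R]_(b n.+1, b n)) a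
    (A' Q : comNzRingType) (phi' : {rmorphism R -> A'}) (psi : {rmorphism Q -> A'})
    (N : lmodType A') (j : M -> N) :
  resol (M := M) D a -> (exists x : M, x <> 0) ->
  quasi_deformation phi' psi -> is_base_change phi' j ->
  (exists2 m : nat, pd (restr psi A'^o) = (m%:Z)%:E &
   ((forall p, ~ pd_le p (restr psi N)) /\ pd (restr psi N) = +oo%E \/
    exists p, [/\ pd_le p (restr psi N), pd (restr psi N) = (p%:Z)%:E & (m <= p)%N])) /\
  forall p, pd_le p (restr psi N) -> forall n, (p.+1 < n)%N -> col_exact [set 0] D n.
Proof.
move=> hD M0 [[_ [P' mP' _]] _ [lphi fphi] [_ psis] [s0 [sreg sk]]] bj.
have [a' ha'] := flat_resol fphi hD bj.
have [mR _] := residue_local; have [hP' P'1 _] := mP'.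
have lP x : PR x -> P' (phi' x) := lphi _ _ mR mP' x.
have N0 : exists y : N, y <> 0.
  apply: contrapT => /forallNP h; case: M0 => x; apply.
  apply: (flat_descent_zero fphi residue_unit hP' P'1 lP hD ha') => y.
  exact: contrapT (h y).
split=> [|p pN n pn].
  have R0 : exists y : restr psi A'^o, y <> 0.
    by exists (1 : A'); apply/eqP; rewrite oner_eq0.
  have [m mc mE] := @least_dim_leq _ _ (fun n => pd_le n (restr psi A'^o)) _ R0 (pd_quotient_le psis sreg sk).
  exists m => //; have [h|[p hp pE]] := least_dim_cases (fun n => pd_le n (restr psi N)) N0.
    by left; split=> //; apply: least_dim_oo.
  right; exists p; split=> //; apply: (leq_trans mc); rewrite leqNgt; apply/negP => pc.
  by case: N0 => y; apply; apply: (regular_le_pd psis sreg sk ha' hp pc).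
apply: (col_exact_descent fphi residue_unit hP' P'1 lP).
exact: (pd_le_col_exact psis sreg sk ha' pN pn).
Qed.

(** The infimum defining the CI-dimension is attained by R = R <- Q with [Q] the localization of [S]
    at the kernel of [eps], where [M] and [R] both have projective dimension 1. *)
Lemma lfree_dims (M : lmodType R) b (D : forall n, 'M[R]_(b n.+1, b n)) a
    g (G : forall n, 'M[S]_(g n.+1, g n)) aS :
  resol (M := M) D a -> resol (M := restr phi M) G aS ->
  (exists x : M, x <> 0) -> lfree l (G 0%N) ->
  [/\ Gdim M = 0%:E, pd (restr phi M) = 1%:E & CIdim M = 0%:E].
Proof.
move=> hD hG M0 hfree.
(* Projective dimension 0 is excluded because a nonzero module killed by a nonzerodivisor is not
   projective. *)
have zdiv (Q : comNzRingType) (psi : {rmorphism Q -> R}) f0 (M' : lmodType R) :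
    (forall x, exists y, psi y = x) -> regular_seq [:: f0] ->
    kernel psi = ideal_span [:: f0] -> fin_gen M' -> (exists x : M', x <> 0) ->
    pd_le 1 (restr psi M') -> pd (restr psi M') = 1%:E.
  move=> psis fr fk fgM [x x0] p1; apply: (@least_dim_eq _ _ _ 1) => //; first by exists x.
  case=> // _ p0; have [b' [D' [a' hD']]] := noetherian_resol noetherian_hypersurface fgM.
  by apply/x0/(regular_le_pd psis fr fk hD' p0).
have fgM : fin_gen M by case: hD => as_ _ _; exists (b 0%N), a.
split.
- apply: (@least_dim_eq _ _ _ 0) => //; exists M; last exact: lfree_Gdim_zero hG hfree.
  by exists (idfun : {linear M -> M}), (fun x => x).
- apply: (zdiv _ _ f) => //; [exact: hypersurface_regular|exact: hypersurface_kernel|].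
  exact: lfree_pd_le1 hG hfree.
apply: infimum_min; last first.
  move=> v [A' [Q [phi' [psi [N [j [qd bj ->]]]]]]].
  have [[m -> h] _] := quasi_deformation_lower hD M0 qd bj.
  case: h => [[_ ->]|[p [_ -> mp]]]; first by [].
  by rewrite -EFinB lee_fin subr_ge0 lez_nat.
have Ureg u x : eps u != 0 -> u * x = 0 -> x = 0 by exact: regular_eps.
have [|u v hu hv|Q [i [ii iU iQ iuniv]]] :=
    @localization S (fun u => eps u != 0) _ _ Ureg.
- by rewrite /= rmorph1 oner_eq0.
- by rewrite /= rmorphM mulf_neq0.
have [psi psii] := iuniv R phi (fun u => @unit_phi u).
have [epsQ epsQi] : exists g : {rmorphism Q -> k}, forall a, g (i a) = eps a.
  by apply: iuniv => u hu; exists (eps u)^-1; rewrite mulfV.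
have [qd [psis sreg sk freg']] := localization_quasi_deformation ii iU iQ psii epsQi.
exists R, Q, (idfun : {rmorphism R -> R}), psi, M, (fun x => x).
split=> //; first exact: base_change_id.
have [c [P [P' [u [al [eu PP' P'P als alk]]]]]] := factorization_of_lfree hG hfree.
have pk x : psi x = 0 <-> exists a, x = i f * a.
  by rewrite -ideal_span1 -sk.
have mpE m n (X : 'M[S]_(m, n)) : map_mx psi (map_mx i X) = map_mx phi X.
  by apply/matrixP => x y; rewrite !mxE psii.
have -> : pd (restr psi M) = 1%:E.
  apply: (zdiv _ _ (i f)) => //.
  apply: (@factorization_pd_le1 _ _ psi (i f) (i u) psis pk freg' _ _
            (map_mx i P) (map_mx i P') _ _ _ al als).
  - by rewrite -map_mxM PP' map_scalar_mx rmorphM.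
  - by rewrite -map_mxM P'P map_scalar_mx rmorphM.
  - by move=> v; rewrite mpE.
  - by apply: iU; rewrite eu oner_eq0.
have -> : pd (restr psi R^o) = 1%:E; last by [].
apply: (zdiv _ _ (i f)) => //; first exact: fin_gen_regular.
  by exists (1 : R); apply/eqP; rewrite oner_eq0.
exact: (pd_quotient_le psis sreg sk).
Qed.

Theorem Gdim_pd_CIdim (M : lmodType R) : fin_gen M ->
  Gdim M = (pd (restr phi M) - 1)%E /\ ((exists x : M, x <> 0) -> Gdim M = CIdim M).
Proof.
move=> fgM; have [M0|nM0] := pselect (exists x : M, x <> 0); last first.
  split=> [|//]; have M0 (x : M) : x = 0.
    (* For the zero module both sides of the formula are -oo. *)
    by apply: contrapT => h; apply: nM0; exists x.
  by rewrite /Gdim /pd !least_dim0.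
have [b [D [a hD]]] := noetherian_resol noetherian_hypersurface fgM.
have [g [G [aS [hG hGc _ _]]]] :=
  regular_lift_resol phis hypersurface_regular hypersurface_kernel hD.
have [_ _ eG] := hG.
have [h|h] := pselect (lfree l (G 0%N)).
  by have [-> -> ->] := lfree_dims hD hG M0 h.
(* [acyclic_lfree] needs dual exactness of [G] in degrees n0 + 3 and n0 + 4, which are degrees n0 +
   2 and n0 + 3 of [D]. *)
have colD n0 : ~ (forall n, (n0 <= n)%N -> col_exact [set 0] D n).
  move=> hn; apply: h; have e n : (n.+1 = n + size [:: f])%N by rewrite addn1.
  apply: (acyclic_lfree epsK epsl lreg max2 lamM laml eps_s lam_s muM mul_ eps_t mu_t
            lam_t mu_s (n := n0) eG).
    by rewrite (e n0.+2); apply/hGc/hn; rewrite !leqW.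
  by rewrite (e n0.+3); apply/hGc/hn; rewrite !leqW.
have -> : Gdim M = +oo%E.
  apply: least_dim_oo => // n /Gdim_le_resol[b' [D' [a' [hD' cD']]]].
  apply: (colD n.+1) => -[|m] // nm.
  exact: (col_exact_resol hD hD' (cD' m nm)).
have -> : pd (restr phi M) = +oo%E.
  apply: least_dim_oo => // n pn; apply: h.
  have mp : mproj (G n) by apply: (pd_le_mproj hG pn).
  apply: (lfree_descent_complex epsK lreg max2 lamM laml eps_s lam_s (n := n) eG).
  exact: mproj_lfree epsK max2 _ _ _ mp.
split=> // _; symmetry; apply: infimum_cst => v.
move=> [A' [Q [phi' [psi [N [j [qd bj ->]]]]]]].
have [[m -> hN] hcol] := quasi_deformation_lower hD M0 qd bj.
case: hN => [[_ ->] //|[p [pN _ _]]].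
by case: (colD p.+2) => n; exact: hcol.
Qed.

End Hypersurface.

(** * Homogeneous components *)

Lemma homog_mpoly0 (k : fieldType) n (p : mpoly.mpoly n k) :
  p \is mpoly.ishomog1 0 mpoly.mdeg -> exists c, p = c *: 1.
Proof.
move=> /mpoly.dhomogP hp; rewrite [p]mpoly.mpolyE big_seq.
elim/big_ind: _ => [|_ _ [c ->] [d ->]|m mp]; first by exists 0; rewrite scale0r.
  by exists (c + d); rewrite scalerDl.
exists (mpoly.mcoeff m p); congr (_ *: _).
have /eqP := hp m mp; rewrite mpoly.mdeg_eq0 => /eqP ->.
exact: mpoly.mpolyX0.
Qed.

Lemma homog_mpolyS (k : fieldType) n d (p : mpoly.mpoly n k) :
  p \is mpoly.ishomog1 d.+1 mpoly.mdeg ->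
  exists q : 'I_n -> mpoly.mpoly n k,
    (forall i, q i \is mpoly.ishomog1 d mpoly.mdeg) /\
    p = \sum_i mpoly.mpolyX k (mpoly.mnm1 i) * q i.
Proof.
move=> /mpoly.dhomogP hp; rewrite [p]mpoly.mpolyE big_seq.
elim/big_ind: _ => [|_ _ [q [hq ->]] [r [hr ->]]|m mp].
- exists (fun=> 0); split=> [i|]; first exact: rpred0.
  by rewrite big1 // => i _; rewrite mulr0.
- exists (fun i => q i + r i); split=> [i|]; first exact: rpredD.
  by rewrite -big_split; apply: eq_bigr => i _; rewrite mulrDr.
have hm : mpoly.mdeg m = d.+1 := hp m mp.
have [i mi] : exists i, mpoly.fun_of_multinom m i != 0%N.
  apply: contrapT => /forallNP h; move: hm; rewrite mpoly.mdegE big1 // => i _.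
  by have /negP := h i; rewrite negbK => /eqP.
pose m' := mpoly.mnm_sub m (mpoly.mnm1 i).
have mE : m = mpoly.mnm_add (mpoly.mnm1 i) m'.
  apply/mpoly.mnmP => j; rewrite mpoly.mnmDE mpoly.mnmBE mpoly.mnm1E.
  by case: eqP => [<-|] /=; [rewrite subnKC // lt0n|rewrite subn0].
exists (fun j => if j == i then mpoly.mcoeff m p *: mpoly.mpolyX k m' else 0); split.
  move=> j; case: eqP => _; last exact: rpred0.
  apply: rpredZ; rewrite mpoly.dhomogX.
  apply/eqP; rewrite -[LHS]/(mpoly.mdeg m'); move: hm.
  by rewrite {1}mE mpoly.mdegD mpoly.mdeg1 add1n => -[].
rewrite (bigD1 i) //= eqxx big1 => [|j /negPf ->]; last by rewrite mulr0.
by rewrite addr0 -scalerAr -mpoly.mpolyXD -mE.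
Qed.

Section Graded.
Variables (k : fieldType) (S : homog_ring k).
Implicit Types x y : S.

Local Notation pres := (hr_pres S).

Lemma hr_surj x : exists p, pres p = x.
Proof. by case: S x => A n p h1 h2 x; exact: h1. Qed.

Lemma hr_kernel p d : pres p = 0 -> pres (mpoly.pihomog mpoly.mdeg d p) = 0.
Proof. by case: S p => A n q h1 h2 p; exact: h2. Qed.

(* The component of degree i; by hcE the chosen preimage is irrelevant. *)
Definition hc i x : S := pres (mpoly.pihomog mpoly.mdeg i (projT1 (cid (hr_surj x)))).

Lemma hcE i p : hc i (pres p) = pres (mpoly.pihomog mpoly.mdeg i p).
Proof.
rewrite /hc; case: cid => q /= hq; apply/eqP; rewrite -subr_eq0 -!linearB /=.
by apply/eqP/hr_kernel; rewrite linearB /= hq subrr.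
Qed.

Lemma hc_is_linear i : linear (hc i).
Proof.
move=> c x y; have [p <-] := hr_surj x; have [q <-] := hr_surj y.
by rewrite -linearP !hcE -linearP -linearP.
Qed.

HB.instance Definition _ i := GRing.isLinear.Build k S S _ (hc i) (hc_is_linear i).

Lemma hc_comp i x : hr_comp i (hc i x).
Proof.
have [p <-] := hr_surj x; rewrite hcE.
by exists (mpoly.pihomog mpoly.mdeg i p) => //; exact: mpoly.pihomogP.
Qed.

Lemma hc_id i x : hr_comp i x -> hc i x = x.
Proof. by move=> [p hp <-]; rewrite hcE mpoly.pihomog_dE. Qed.

Lemma hc_ne i j x : hr_comp j x -> i != j -> hc i x = 0.
Proof.
move=> [p hp <-] ij; rewrite hcE (mpoly.pihomog_ne0 _ hp) ?rmorph0 //.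
by rewrite eq_sym.
Qed.

Lemma hc_sum x : exists N, forall m, (N <= m)%N -> x = \sum_(i < m) hc i x.
Proof.
have [p <-] := hr_surj x; exists (mpoly.mmeasure mpoly.mdeg p) => m hm.
rewrite {1}(mpoly.pihomog_partitionE hm) rmorph_sum.
by apply: eq_bigr => i _; rewrite hcE.
Qed.

Lemma hc_eq0 x : (forall i, hc i x = 0) -> x = 0.
Proof.
by move=> h; have [N hN] := hc_sum x; rewrite (hN N (leqnn _)) big1.
Qed.

Lemma hcompP i x : hr_comp i x <-> hc i x = x.
Proof. by split=> [/hc_id|<-] //; exact: hc_comp. Qed.

Lemma hcomp0 i : hr_comp i (0 : S).
Proof. by apply/hcompP; rewrite linear0. Qed.

Lemma hcompD i x y : hr_comp i x -> hr_comp i y -> hr_comp i (x + y).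
Proof. by move=> /hcompP hx /hcompP hy; apply/hcompP; rewrite linearD /= hx hy. Qed.

Lemma hcompZ i c x : hr_comp i x -> hr_comp i (c *: x).
Proof. by move=> /hcompP hx; apply/hcompP; rewrite linearZ /= hx. Qed.

Lemma hcompN i x : hr_comp i x -> hr_comp i (- x).
Proof. by rewrite -scaleN1r; exact: hcompZ. Qed.

Lemma hcompB i x y : hr_comp i x -> hr_comp i y -> hr_comp i (x - y).
Proof. by move=> hx hy; apply/hcompD/hcompN. Qed.

Lemma hcomp_sum i (T : Type) (r : seq T) (P : pred T) (F : T -> S) :
  (forall t, P t -> hr_comp i (F t)) -> hr_comp i (\sum_(t <- r | P t) F t).
Proof. by move=> h; apply: big_ind => //; [exact: hcomp0|exact: hcompD]. Qed.

Lemma hcompM i j x y : hr_comp i x -> hr_comp j y -> hr_comp (i + j) (x * y).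
Proof.
move=> [p hp <-] [q hq <-]; exists (p * q); last by rewrite rmorphM.
exact: mpoly.dhomogM.
Qed.

Lemma hcomp1 : hr_comp 0 (1 : S).
Proof. by exists 1; [exact: mpoly.dhomog1|rewrite rmorph1]. Qed.

Lemma hcompX i n x : hr_comp i x -> hr_comp (i * n) (x ^+ n).
Proof.
move=> hx; elim: n => [|n IHn]; first by rewrite muln0; exact: hcomp1.
by rewrite exprS mulnS; apply: hcompM.
Qed.

Lemma hcomp0P x : hr_comp 0 x <-> exists c : k, x = c%:A.
Proof.
split=> [[p /homog_mpoly0[c ->] <-]|[c ->]]; last exact/hcompZ/hcomp1.
by exists c; rewrite linearZ /= rmorph1.
Qed.

Lemma hc_mul i j x y : hr_comp i x -> hc (i + j) (x * y) = x * hc j y.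
Proof.
move=> hx; have [N hN] := hc_sum y; pose m := maxn N j.+1.
rewrite {1}(hN m (leq_maxl _ _)) mulr_sumr linear_sum /=.
have jm : (j < m)%N by rewrite leq_maxr.
rewrite (bigD1 (Ordinal jm)) //= big1 => [|l lj]; last first.
  apply: (@hc_ne _ (i + l)); first by apply: hcompM => //; exact: hc_comp.
  rewrite eqn_add2l; apply: contraNneq lj => e; apply/eqP/val_inj.
  by rewrite /= e.
by rewrite addr0 hc_id //; apply: hcompM => //; exact: hc_comp.
Qed.

Lemma hc_mul0 i m x y : hr_comp i x -> (m < i)%N -> hc m (x * y) = 0.
Proof.
move=> hx mi; have [N hN] := hc_sum y; rewrite (hN N (leqnn _)) mulr_sumr linear_sum big1 //= => l _.
apply: (@hc_ne _ (i + l)); first by apply: hcompM => //; exact: hc_comp.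
by rewrite neq_ltn (leq_trans mi) ?leq_addr.
Qed.

Lemma scaleA_inj (c : k) : (c%:A : S) = 0 -> c = 0.
Proof.
move=> /eqP h; apply/eqP; move: h; apply: contraTT => c0.
apply/eqP => /(congr1 (fun x : S => c^-1 *: x)).
by rewrite scalerA mulVf // scale1r scaler0 => /eqP; rewrite oner_eq0.
Qed.

Lemma augmentation : exists eps : {rmorphism S -> k},
  forall x, hc 0 x = (eps x)%:A.
Proof.
have /choice[e eE] : forall x, exists c : k, hc 0 x = c%:A by move=> x; apply/hcomp0P/hc_comp.
have inj c d : (c%:A : S) = d%:A -> c = d.
  by move=> /eqP; rewrite -subr_eq0 -scalerBl => /eqP/scaleA_inj/eqP; rewrite subr_eq0 => /eqP.
have eB : {morph e : x y / x - y} by move=> x y; apply: inj; rewrite -eE linearB /= !eE scalerBl.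
have eM : monoid_morphism e.
  split; first by apply: inj; rewrite -eE scale1r hc_id //; exact: hcomp1.
  move=> x y; apply: inj; rewrite -eE.
  have -> : x * y = hc 0 x * y + (x - hc 0 x) * y by rewrite -mulrDl addrC subrK.
  have [N hN] := hc_sum x.
  have -> : x - hc 0 x = \sum_(i < N) hc i.+1 x.
    by rewrite {1}(hN N.+1) ?leqnSn // big_ord_recl /= addrC addKr.
  rewrite linearD /= mulr_suml linear_sum big1 ?addr0 => [|i _]; last first.
    by apply: (@hc_mul0 i.+1) => //; exact: hc_comp.
  have := @hc_mul 0 0 (hc 0 x) y (hc_comp 0 x); rewrite addn0 => ->.
  by rewrite !eE -scalerAl mul1r scalerA.
pose e' := HB.pack_for {rmorphism S -> k} e
  (GRing.isZmodMorphism.Build _ _ e eB) (GRing.isMonoidMorphism.Build _ _ e eM).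
by exists e'.
Qed.

End Graded.

(** * Linear algebra over the base field *)

Section LinearGraphs.
Variables (k : fieldType) (V : lmodType k).

Definition linear_graph (X : set (V * k)) :=
  [/\ X (0, 0), forall a p q, X p -> X q -> X (a *: p.1 + q.1, a * p.2 + q.2) &
      forall t, X (0, t) -> t = 0].

(** Extension of functionals by Zorn's lemma on graphs of partial functionals; the space may be
    infinite-dimensional. *)
Lemma linear_graph_extend (X : set (V * k)) : linear_graph X ->
  exists F : V -> k, (forall a x y, F (a *: x + y) = a * F x + F y) /\
    forall p, X p -> F p.1 = p.2.
Proof.
move=> gX; pose P (Y : set (V * k)) := Y = set0 \/ linear_graph Y /\ X `<=` Y.
have [A [PA maxA]] : exists A, P A /\ forall B, A `<` B -> ~ P B.
  apply: Zorn_bigcup => F FP totF.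
  have [[Y [FY nY]]|h] := pselect (exists Y, F Y /\ linear_graph Y /\ X `<=` Y); last first.
    left; apply/seteqP; split=> // p [Y FY Yp]; case: h; exists Y; split=> //.
    by case: (FP Y FY) => [Y0|//]; have : set0 p by rewrite -Y0.
  have up Z1 Z2 : F Z1 -> F Z2 -> exists Z, [/\ F Z, Z1 `<=` Z & Z2 `<=` Z].
    by move=> F1 F2; have [h|h] := totF _ _ F1 F2; [exists Z2|exists Z1]; split=> //.
  have gd Z p : F Z -> Z p -> linear_graph Z.
    by move=> FZ Zp; case: (FP Z FZ) => [Z0|[]//]; have : set0 p by rewrite -Z0.
  case: nY => -[Y0 YD Y1] XY; right; split; last by move=> p Xp; exists Y => //; apply: XY.
  split; first by exists Y.
    move=> a p q [Z1 F1 Zp] [Z2 F2 Zq]; have [Z [FZ s1 s2]] := up _ _ F1 F2.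
    exists Z => //; have [_ ZD _] := gd Z p FZ (s1 _ Zp).
    by apply: ZD; [apply: s1|apply: s2].
  by move=> t [Z FZ Zt]; have [_ _] := gd _ _ FZ Zt; apply.
have {PA} [gA XA] : linear_graph A /\ X `<=` A.
  case: PA => // A0; exfalso; apply: (maxA X); last by right; split.
  by rewrite A0; split=> // h; have [X0 _ _] := gX; apply: (h _ X0).
have [A0 AD A1] := gA.
have tot x : exists t, A (x, t).
  apply: contrapT => /forallNP nx.
  (* The maximal graph is enlarged by the value 0 at [x]. *)
  pose B : set (V * k) := [set q | exists p a, A p /\ q = (p.1 + a *: x, p.2)].
  have AB : A `<=` B.
    by move=> p Ap; exists p, 0; split=> //; rewrite scale0r addr0 -surjective_pairing.
  apply: (maxA B).
    split=> // h; apply: (nx 0); apply: h; exists (0, 0), 1; split=> //.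
    by rewrite scale1r add0r.
  right; split; last by move=> p /XA/AB.
  split; first by apply: AB.
    move=> a _ _ [p [c [Ap ->]]] [q [d [Aq ->]]] /=.
    exists (a *: p.1 + q.1, a * p.2 + q.2), (a * c + d); split; first exact: AD.
    by rewrite /= scalerDr scalerDl scalerA addrACA.
  move=> t [p [a [Ap [e1 e2]]]]; have [a0|a0] := eqVneq a 0.
    apply: A1; rewrite e2; move: e1; rewrite a0 scale0r addr0 => ->.
    by rewrite -surjective_pairing.
  exfalso; apply: (nx (- a^-1 * p.2)).
  have := AD (- a^-1) p (0, 0) Ap A0; rewrite /= !addr0.
  suff -> : - a^-1 *: p.1 = x by [].
  have -> : p.1 = - (a *: x) by apply/eqP; rewrite -addr_eq0 -e1.
  by rewrite scaleNr scalerN opprK scalerA mulVf // scale1r.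
have /choice[F FE] := tot.
have FU x t : A (x, t) -> F x = t.
  move=> Ax; apply/eqP; rewrite eq_sym -subr_eq0; apply/eqP/A1.
  have := AD (-1) _ _ (FE x) Ax; rewrite /= scaleN1r addNr.
  by rewrite mulN1r addrC.
exists F; split=> [a x y|p Xp]; last by apply: FU; rewrite -surjective_pairing; apply: XA.
by apply: FU; apply: (AD a (x, F x) (y, F y)).
Qed.

End LinearGraphs.

(** * Finite-dimensional spaces through sequences of vectors *)

Section FiniteDimension.
Variables (k : fieldType) (V : lmodType k).
Implicit Types (s t : seq V) (c d : nat -> k).

(** Coefficients are functions on nat, of which the first [size s] values count, so that sequences
    can be concatenated without transporting index types. *)
Definition lc s c := \sum_(i < size s) c i *: s`_i.

Definition inspan s x := exists c, x = lc s c.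

Definition indep s := forall c, lc s c = 0 -> forall i, (i < size s)%N -> c i = 0.

Lemma lcD s c d a : lc s (fun i => a * c i + d i) = a *: lc s c + lc s d.
Proof.
rewrite /lc scaler_sumr -big_split; apply: eq_bigr => i _ /=.
by rewrite scalerDl scalerA.
Qed.

Lemma lc_cat s t c : lc (s ++ t) c = lc s c + lc t (fun i => c (size s + i)%N).
Proof.
rewrite /lc size_cat big_split_ord /=; congr (_ + _); apply: eq_bigr => i _ /=.
  by rewrite nth_cat ltn_ord.
by rewrite nth_cat ltnNge leq_addr /= addKn.
Qed.

Lemma lc1 x c : lc [:: x] c = c 0%N *: x.
Proof. by rewrite /lc big_ord1. Qed.

Lemma lc_delta s i : (i < size s)%N -> lc s (fun j => (j == i)%:R) = s`_i.
Proof.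
move=> si; rewrite /lc (bigD1 (Ordinal si)) //= eqxx scale1r big1 ?addr0 // => j ji.
suff /negPf -> : val j != i by rewrite scale0r.
by apply: contraNneq ji => e; apply/eqP/val_inj.
Qed.

Lemma inspan_mem s x : x \in s -> inspan s x.
Proof.
move=> xs; exists (fun j => (j == index x s)%:R); rewrite lc_delta ?index_mem //.
by rewrite nth_index.
Qed.

Lemma inspan0 s : inspan s 0.
Proof. by exists (fun=> 0); rewrite /lc big1 // => i _; rewrite scale0r. Qed.

Lemma inspanP s a x y : inspan s x -> inspan s y -> inspan s (a *: x + y).
Proof. by move=> [c ->] [d ->]; eexists; rewrite -lcD. Qed.

Lemma inspan_sum s n (F : 'I_n -> V) (a : 'I_n -> k) :
  (forall i, inspan s (F i)) -> inspan s (\sum_i a i *: F i).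
Proof.
move=> h; apply: (big_ind (inspan s)) => [|x y hx hy|i _]; first exact: inspan0.
  by rewrite -[x]scale1r; apply: inspanP.
by rewrite -[_ *: _]addr0; apply: inspanP => //; exact: inspan0.
Qed.

Lemma inspan_trans s t x : (forall y, y \in s -> inspan t y) -> inspan s x -> inspan t x.
Proof.
move=> h [c ->]; apply: inspan_sum => i; apply: h; exact: mem_nth.
Qed.

Lemma indep_rcons s x : indep s -> ~ inspan s x -> indep (rcons s x).
Proof.
move=> is_ nx c; rewrite -cats1 lc_cat lc1 addn0 => e.
have cx : c (size s) = 0.
  apply: contrapT => /eqP c0; apply: nx.
  have -> : x = - (c (size s))^-1 *: lc s c + 0.
    have -> : lc s c = - (c (size s) *: x) by apply/eqP; rewrite -addr_eq0 e.
    by rewrite scalerN scaleNr opprK scalerA mulVf // scale1r addr0.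
  by apply: inspanP; [exists c|exact: inspan0].
move: e; rewrite cx scale0r addr0 => /is_ h i.
by rewrite size_cat addn1 ltnS leq_eqVlt => /orP[/eqP->|/h].
Qed.

Lemma indep_extend s t : indep s -> exists u,
  [/\ {subset u <= t}, indep (s ++ u) & forall x, x \in t -> inspan (s ++ u) x].
Proof.
elim: t s => [|y t IHt] s is_; first by exists [::]; rewrite cats0.
have [hy|hy] := pselect (inspan s y).
  have [u [ut iu hu]] := IHt s is_; exists u; split=> // x.
    by move/ut; rewrite inE orbC => ->.
  rewrite inE => /orP[/eqP->|/hu//]; apply: inspan_trans hy => z zs.
  by apply: inspan_mem; rewrite mem_cat zs.
have [u [ut iu hu]] := IHt _ (indep_rcons is_ hy); exists (y :: u).
rewrite -cat_rcons; split=> // x.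
  by rewrite !inE => /orP[->//|/ut->]; rewrite orbT.
rewrite inE => /orP[/eqP->|/hu//]; apply: inspan_mem.
by rewrite mem_cat mem_rcons inE eqxx.
Qed.

Lemma indep1 x : x <> 0 -> indep [:: x].
Proof.
move=> x0 c; rewrite lc1 => /eqP; rewrite scaler_eq0 => /orP[/eqP c0 [|//] _ //|/eqP //].
Qed.

Lemma indep_inj s c d : indep s -> lc s c = lc s d ->
  forall i, (i < size s)%N -> c i = d i.
Proof.
move=> is_ e i si; apply/eqP; rewrite -subr_eq0 addrC -mulN1r; apply/eqP.
by apply: (is_ (fun i => -1 * d i + c i)) si; rewrite lcD e scaleN1r addNr.
Qed.

Lemma indep_has_dim (W : set V) s : indep s -> (forall x, x \in s -> W x) ->
  (forall x, W x -> inspan s x) -> has_dim W (size s).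
Proof.
move=> is_ sW Ws; exists (fun i => s`_i); split=> [i|x /Ws[c ->]].
  by apply/sW/mem_nth.
exists (\row_i c i); split=> [|d e].
  by apply: eq_bigr => i _; rewrite mxE.
apply/rowP => i; rewrite mxE.
pose d' j := if insub j is Some j' then d 0 j' else 0 : k.
have dE (j : 'I_(size s)) : d' j = d 0 j by rewrite /d' valK.
rewrite -dE; apply: (indep_inj is_) => //.
by rewrite e; apply: eq_bigr => j _; rewrite dE.
Qed.

Lemma indep_endo_surj s (h : V -> V) : indep s ->
  (forall a x y, h (a *: x + y) = a *: h x + h y) ->
  (forall x, inspan s x -> inspan s (h x)) ->
  (forall x, inspan s x -> h x = 0 -> x = 0) ->
  forall y, inspan s y -> exists2 x, inspan s x & h x = y.
Proof.
move=> is_ hl hs hi y [c ->].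
have h0 : h 0 = 0 by have := hl 1 0 0; rewrite !scale1r addr0 => /eqP; rewrite -subr_eq0 opprD addrA subrr add0r oppr_eq0 => /eqP.
have hsum n (a : 'I_n -> k) (F : 'I_n -> V) : h (\sum_i a i *: F i) = \sum_i a i *: h (F i).
  elim: n a F => [|n IHn] a F; first by rewrite !big_ord0.
  by rewrite !big_ord_recl hl IHn.
have /choice[e eE] : forall i : 'I_(size s), exists d : nat -> k, h s`_i = lc s d.
  by move=> i; apply/hs/inspan_mem/mem_nth.
pose X : 'M[k]_(size s) := \matrix_(i, j) e i j.
have hX (v : 'rV_(size s)) : h (\sum_i v 0 i *: s`_i) = \sum_j (v *m X) 0 j *: s`_j.
  rewrite hsum; under eq_bigr do rewrite eE scaler_sumr.
  rewrite exchange_big /=; apply: eq_bigr => j _; rewrite mxE scaler_suml.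
  by apply: eq_bigr => i _; rewrite mxE scalerA.
have ind0 (v : 'rV[k]_(size s)) : \sum_i v 0 i *: s`_i = 0 -> v = 0.
  move=> e0; pose v' j := if insub j is Some j' then v 0 j' else 0 : k.
  have vE (j : 'I_(size s)) : v' j = v 0 j by rewrite /v' valK.
  apply/rowP => j; rewrite [RHS]mxE -vE; apply: is_ => //.
  by rewrite -[RHS]e0; apply: eq_bigr => i _; rewrite vE.
have spn (v : 'rV[k]_(size s)) : inspan s (\sum_i v 0 i *: s`_i).
  by apply: inspan_sum => i; apply/inspan_mem/mem_nth.
have : row_free X.
  rewrite -kermx_eq0; apply/eqP/row_matrixP => i; rewrite row0.
  have : row i (kermx X) *m X = 0 by rewrite -row_mul mulmx_ker row0.
  move: (row i _) => v hv; apply: ind0; apply: hi => //.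
  by rewrite hX hv big1 // => j _; rewrite mxE scale0r.
rewrite row_free_unit => uX; pose v := (\row_i c i) *m invmx X.
exists (\sum_i v 0 i *: s`_i) => //.
by rewrite hX mulmxKV //; apply: eq_bigr => i _; rewrite mxE.
Qed.

End FiniteDimension.

(* A finite-dimensional algebra with a nondegenerate functional tau is isomorphic
   to its k-dual, so extending a homomorphism into it amounts to extending a
   functional. *)
Lemma nondegenerate_gorenstein (k : fieldType) (R : comAlgType k) (tau : {linear R -> k^o})
    (s : seq R) :
  (forall x, inspan s x) -> (forall x, (forall a, tau (a * x) = 0) -> x = 0) ->
  gorenstein R.
Proof.
move=> sp nd; exists 0%N => B C g f gi.
have [u [_ iu hu]] := @indep_extend k R [::] s (fun c _ i => fun h => False_ind _ (notF h)).
rewrite cat0s in iu hu.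
have spu x : inspan u x by apply: inspan_trans (sp x).
(* The Gram matrix of the form (x, y) |-> tau (x y); its invertibility represents every functional
   on [R] by an element. *)
pose G : 'M[k]_(size u) := \matrix_(i, j) tau (u`_j * u`_i).
have tsum (v : 'rV[k]_(size u)) a : tau (a * \sum_i v 0 i *: u`_i) = \sum_i v 0 i * tau (a * u`_i).
  rewrite mulr_sumr linear_sum; apply: eq_bigr => i _.
  by rewrite -scalerAr linearZ.
have uG : G \in unitmx.
  rewrite -row_free_unit -kermx_eq0; apply/eqP/row_matrixP => i; rewrite row0.
  have : row i (kermx G) *m G = 0 by rewrite -row_mul mulmx_ker row0.
  move: (row i _) => v hv; pose x := \sum_i v 0 i *: u`_i.
  have x0 : x = 0.
    apply: nd => a; have [c ->] := spu a; rewrite /lc mulr_suml linear_sum big1 // => j _.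
    rewrite -scalerAl linearZ /= tsum.
    have /rowP/(_ j) := hv; rewrite !mxE => e.
    suff -> : \sum_i v 0 i * tau (u`_j * u`_i) = 0 by rewrite scaler0.
    by rewrite -[RHS]e; apply: eq_bigr => l _; rewrite mxE.
  pose v' j := if insub j is Some j' then v 0 j' else 0 : k.
  have vE (j : 'I_(size u)) : v' j = v 0 j by rewrite /v' valK.
  apply/rowP => j; rewrite [RHS]mxE -vE; apply: iu => //.
  by rewrite -[RHS]x0; apply: eq_bigr => l _; rewrite vE.
pose Ck := restr (in_alg R) C : lmodType k.
(* The functional tau f on the image of [g], as a graph; it is single-valued because [g] is
   injective. *)
pose X : set (Ck * k) := [set p | exists b, p = (g b, tau (f b))].
have [|F [Fl FX]] := @linear_graph_extend k Ck X.
  split.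
  - by exists 0; rewrite !linear0.
  - move=> a _ _ [b ->] [b' ->]; exists (a%:A *: b + b'); congr (_, _).
      by rewrite /= linearP.
    have -> : f (a%:A *: b + b') = a *: (f b : R) + f b'.
      by rewrite linearP -[a%:A *: _]/(a%:A * (f b : R)) mulr_algl.
    by rewrite /= linearP.
  - move=> t [b [/esym e ->]].
    have -> : b = 0 by apply: gi; rewrite e linear0.
    by rewrite !linear0.
have F0 : F 0 = 0 by apply: (FX (0, 0)); exists 0; rewrite !linear0.
have Fsum n (c : 'I_n -> k) (y : 'I_n -> Ck) : F (\sum_i c i *: y i) = \sum_i c i * F (y i).
  elim: n c y => [|n IHn] c y; first by rewrite !big_ord0.
  by rewrite !big_ord_recl Fl IHn.
have tau_eq (x y : R) : (forall a, tau (a * x) = tau (a * y)) -> x = y.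
  move=> h; apply/eqP; rewrite -subr_eq0; apply/eqP/nd => a.
  by rewrite mulrBr linearB /= h subrr.
(* The value h c represents the functional a |-> F (a c); linearity over [R] then follows from
   nondegeneracy. *)
have /choice[h hE] : forall c : C, exists x : R, forall a, tau (a * x) = F (a *: c).
  move=> c; pose v := (\row_j F (u`_j *: c)) *m invmx G.
  exists (\sum_i v 0 i *: u`_i) => a; have [d ->] := spu a.
  have ej (j : 'I_(size u)) : tau (u`_j * \sum_i v 0 i *: u`_i) = F (u`_j *: c).
    have <- : (v *m G) 0 j = F (u`_j *: c) by rewrite mulmxKV // mxE.
    by rewrite tsum [RHS]mxE; apply: eq_bigr => i _; rewrite [G i j]mxE.
  rewrite /lc mulr_suml linear_sum scaler_suml.
  have -> : \sum_(i < size u) d i *: u`_i *: c = \sum_(i < size u) d i *: (u`_i *: c : Ck).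
    apply: eq_bigr => i _; rewrite -[d i *: (_ : Ck)]/((d i)%:A *: (u`_i *: c)).
    by rewrite scalerA mulr_algl.
  rewrite Fsum; apply: eq_bigr => j _.
  by rewrite -scalerAl linearZ /= ej.
have lh : linear (h : C -> R^o).
  move=> r x y; apply: tau_eq => a; rewrite hE.
  have -> : tau (a * (r *: (h x : R^o) + h y)) = F (a *: (r *: x)) + F (a *: y).
    by rewrite scalerA -!hE -linearD mulrDr -mulrA.
  by have := Fl 1 (a *: (r *: x)) (a *: y); rewrite scale1r mul1r scalerDr.
exists (HB.pack_for {linear C -> R^o} (h : C -> R^o) (GRing.isLinear.Build _ _ _ _ _ lh)).
move=> b; apply: tau_eq => a; rewrite /= hE -linearZ /=.
have /= -> := FX (g (a *: b), tau (f (a *: b))); last by exists (a *: b).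
by rewrite linearZ.
Qed.

(** * Graded quotients *)

Section GradedRing.
Variables (k : fieldType) (S : homog_ring k).
Implicit Types x y : S.

(** Generation in degree one, in the form in which inductions on the degree use it. *)
Lemma hcomp_gens : exists (n : nat) (a : 'I_n -> S), (forall j, hr_comp 1 (a j)) /\
  forall i x, hr_comp i.+1 x ->
    exists2 b : 'I_n -> S, forall j, hr_comp i (b j) & x = \sum_j a j * b j.
Proof.
exists _, (fun j => hr_pres S (mpoly.mpolyX k (mpoly.mnm1 j))); split.
  move=> j; exists (mpoly.mpolyX k (mpoly.mnm1 j)) => //.
  by rewrite mpoly.dhomogX /= mpoly.mdeg1.
move=> i x [p /homog_mpolyS[q [hq ->]] <-]; exists (fun j => hr_pres S (q j)).
  by move=> j; exists (q j).
by rewrite rmorph_sum; apply: eq_bigr => j _; rewrite rmorphM.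
Qed.

Lemma hcomp_span i : exists s : seq S,
  (forall x, x \in s -> hr_comp i x) /\ forall x, hr_comp i x -> inspan s x.
Proof.
elim: i => [|i [s [sS hs]]].
  exists [:: 1]; split=> [x|x /hcomp0P[c ->]]; first by rewrite inE => /eqP->; exact: hcomp1.
  by exists (fun=> c); rewrite lc1.
have [n [a [a1 aS]]] := hcomp_gens.
exists [seq a j * y | j <- enum 'I_n, y <- s]; split.
  by move=> x /allpairsP[[j y] [_ /sS hy ->]]; rewrite -add1n; apply: hcompM.
move=> x /aS[b hb ->].
have -> : \sum_j a j * b j = \sum_j 1 *: (a j * b j) by apply: eq_bigr => j _; rewrite scale1r.
apply: inspan_sum => j; have [c ->] := hs _ (hb j).
have -> : a j * lc s c = \sum_(l < size s) c l *: (a j * s`_l).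
  by rewrite mulr_sumr; apply: eq_bigr => l _; rewrite scalerAr.
apply: inspan_sum => l; apply: inspan_mem; apply/allpairsP; exists (j, s`_l).
by rewrite mem_enum mem_nth.
Qed.

Lemma inspan_hcomp i (s : seq S) x :
  (forall y, y \in s -> hr_comp i y) -> inspan s x -> hr_comp i x.
Proof. by move=> h [c ->]; apply: hcomp_sum => j _; apply/hcompZ/h/mem_nth. Qed.

Lemma hcomp_basis i (s : seq S) : indep s -> exists u : seq S,
  [/\ forall x, x \in u -> hr_comp i x, indep (s ++ u) &
      forall x, hr_comp i x -> inspan (s ++ u) x].
Proof.
move=> is_; have [t [tS ht]] := hcomp_span i; have [u [ut iu hu]] := indep_extend t is_.
exists u; split=> // [x /ut/tS //|x /ht]; exact: inspan_trans.
Qed.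

Lemma hr_max_ideal : is_ideal (@hr_max k S).
Proof. exact: ideal_gen_ideal. Qed.

Lemma hr_maxE x : hr_max x <-> hc 0 x = 0.
Proof.
split=> [|x0].
  move: x; apply: ideal_gen_min.
    split=> [|x y hx hy|a x hx] /=; first by rewrite linear0.
      by rewrite linearD /= hx hy addr0.
    have [eps epsE] := @augmentation k S.
    move/eqP: hx; rewrite !epsE rmorphM => /eqP/scaleA_inj ->.
    by rewrite mulr0 scale0r.
  by move=> x [i i0 hx] /=; apply: (hc_ne hx); rewrite eq_sym -lt0n.
have [N hN] := hc_sum x; rewrite (hN N.+1) ?leqnSn // big_ord_recl /= x0 add0r.
apply: ideal_sum => [|i _]; first exact: hr_max_ideal.
by apply: ideal_gen_mem; exists i.+1 => //; exact: hc_comp.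
Qed.

Lemma hr_max_hcomp i x : hr_comp i.+1 x -> hr_max x.
Proof. by move=> hx; apply: ideal_gen_mem; exists i.+1. Qed.

Lemma ideal_mul_ideal (A : comNzRingType) (I J : set A) : is_ideal J -> is_ideal (ideal_mul I J).
Proof.
move=> [_ _ JM]; split=> [|x y [s [hs ->]] [t [ht ->]]|a x [s [hs ->]]].
- by exists [::]; rewrite big_nil.
- exists (s ++ t); rewrite big_cat; split=> // p; rewrite mem_cat => /orP[/hs|/ht] //.
- exists [seq (p.1, a * p.2) | p <- s]; split=> [p /mapP[q /hs[h1 h2] ->]|] /=.
    by split=> //; apply: JM.
  by rewrite big_map mulr_sumr; apply: eq_bigr => i _ /=; rewrite mulrCA.
Qed.

Lemma ideal_exp_ideal (A : comNzRingType) (I : set A) n : is_ideal (ideal_exp I n).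
Proof. by elim: n => [|n IHn] //=; apply: ideal_mul_ideal. Qed.

Lemma hr_max_exp_hc n x : ideal_exp (@hr_max k S) n x -> forall i, (i < n)%N -> hc i x = 0.
Proof.
elim: n x => [//|n IHn] _ [s [hs ->]] i; rewrite ltnS => ni.
rewrite linear_sum /= big_seq big1 // => -[a y] /hs[/= /hr_maxE a0 hy].
have [N hN] := hc_sum a; rewrite (hN N.+1) ?leqnSn // big_ord_recl /= a0 add0r.
rewrite mulr_suml linear_sum big1 //= => j _.
have [ij|ij] := ltnP i j.+1; first by apply: hc_mul0 ij; exact: hc_comp.
rewrite -(subnKC ij) (@hc_mul _ _ j.+1); last exact: hc_comp.
rewrite (IHn y) ?mulr0 //; apply: leq_trans ni.
by rewrite subnS prednK ?leq_subr // subn_gt0.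
Qed.

Lemma hr_max_exp_hcomp n i x : hr_comp (n + i) x -> ideal_exp (@hr_max k S) n x.
Proof.
elim: n x => [//|n IHn] x; have [m [a [a1 aS]]] := hcomp_gens.
move=> /aS[b hb ->]; apply: ideal_sum; first exact: (ideal_exp_ideal _ n.+1).
move=> j _; exists [:: (a j, b j)]; rewrite big_seq1; split=> // p.
by rewrite inE => /eqP-> /=; split; [exact: hr_max_hcomp (a1 j)|exact: IHn].
Qed.

Lemma hr_max_exp_eq0 n :
  ideal_exp (@hr_max k S) n = [set 0] <-> forall i, (n <= i)%N -> forall x, hr_comp i x -> x = 0.
Proof.
split=> [h i ni x|h].
  rewrite -(subnKC ni) => /hr_max_exp_hcomp; by rewrite h.
apply/seteqP; split=> [x hx|x ->]; last by case: (ideal_exp_ideal (@hr_max k S) n).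
apply: hc_eq0 => i; have [ni|ni] := ltnP i n; first exact: hr_max_exp_hc hx _ ni.
exact: h ni _ (hc_comp _ _).
Qed.

Lemma hc_mulE e f x d : hr_comp e f -> hc d (f * x) = if (e <= d)%N then f * hc (d - e) x else 0.
Proof.
move=> hf; case: leqP => [ed|de]; last exact: hc_mul0 de.
by rewrite -{1}(subnKC ed); apply: hc_mul.
Qed.

Lemma homog_ideal_hc (s : seq S) x d :
  (forall f, f \in s -> exists e, hr_comp e f) ->
  ideal_span s x -> ideal_span s (hc d x).
Proof.
move=> hs [t [ht ->]]; rewrite linear_sum /= big_seq; apply: ideal_sum.
  exact: ideal_span_ideal.
move=> [a f] /ht[_ /= fs]; have [e he] := hs f fs.
rewrite mulrC (hc_mulE _ _ he); case: ifP => _; last by case: (ideal_span_ideal s).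
by rewrite mulrC; case: (ideal_span_ideal s) => _ _ h; apply/h/ideal_span_mem.
Qed.

Lemma homog_ideal_quotient (s : seq S) : ~ ideal_span s 1 ->
  (forall f, f \in s -> exists e, hr_comp e f) ->
  exists (T : homog_ring k) (p : {lrmorphism S -> T}), residue_iso s p.
Proof.
move=> s1 hs; have [B [p [ps pk]]] := quotient_algebra (ideal_span_ideal s) s1.
have h1 (y : B) : exists q, (p \o hr_pres S) q = y.
  by have [x <-] := ps y; have [q <-] := hr_surj x; exists q.
have h2 q d : (p \o hr_pres S) q = 0 -> (p \o hr_pres S) (mpoly.pihomog mpoly.mdeg d q) = 0.
  by move=> /= /pk h; apply/pk; rewrite -hcE; apply: homog_ideal_hc.
exists (@HomogRing k B _ (p \o hr_pres S) h1 h2), p; split=> //.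
  by move=> i _ [q hq <-]; exists q.
by apply/seteqP; split=> x /pk.
Qed.

Lemma homog_cofactor e i f a y : hr_comp e f -> hr_comp (e + i) y -> y = f * a ->
  exists2 b, hr_comp i b & y = f * b.
Proof.
move=> hf /hcompP hy e1; exists (hc i a); first exact: hc_comp.
by rewrite -(hc_mul _ _ hf) -e1 hy.
Qed.

Lemma homog_multiple_low e i f a y : hr_comp e f -> hr_comp i y -> (i < e)%N -> y = f * a -> y = 0.
Proof. by move=> hf /hcompP hy ie e1; rewrite -hy e1; apply: hc_mul0 ie. Qed.

End GradedRing.

Section GradedMorphism.
Variables (k : fieldType) (S R : homog_ring k) (phi : {lrmorphism S -> R}).

Lemma graded_hc : graded_morphism phi -> forall i x, phi (hc i x) = hc i (phi x).
Proof.
move=> g i x; have [N hN] := hc_sum x; pose m := maxn N i.+1.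
rewrite {2}(hN m (leq_maxl _ _)) !linear_sum /=.
have im : (i < m)%N by rewrite leq_maxr.
rewrite (bigD1 (Ordinal im)) //= big1 => [|l li].
  by rewrite addr0 [RHS]hc_id //; apply: g; exact: hc_comp.
apply: (@hc_ne _ _ _ l); first by apply: g; exact: hc_comp.
by apply: contraNneq li => e; apply/eqP/val_inj.
Qed.

Lemma graded_lift (s : seq S) i y : residue_iso s phi -> hr_comp i y -> exists2 x, hr_comp i x & phi x = y.
Proof.
move=> [g ps _] /hcompP hy; have [x xy] := ps y; exists (hc i x); first exact: hc_comp.
by rewrite graded_hc // xy.
Qed.

End GradedMorphism.

Lemma residue_iso_factor (k : fieldType) (S R T : homog_ring k) (s : seq S) (f : S)
    (phi : {lrmorphism S -> R}) (p : {lrmorphism S -> T}) :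
  residue_iso s p -> residue_iso (rcons s f) phi ->
  exists psi : {lrmorphism T -> R}, residue_iso [:: p f] psi /\ forall x, psi (p x) = phi x.
Proof.
move=> pR phiR; have [pg ps pk] := pR; have [fg fs fk] := phiR.
have wd x y : p x = p y -> phi x = phi y.
  move=> e; apply/eqP; rewrite -subr_eq0 -linearB; apply/eqP.
  have : ideal_span s (x - y) by rewrite -pk /kernel /= linearB /= e subrr.
  rewrite -[phi _ = 0]/((kernel phi) (x - y)) fk.
  by apply: ideal_span_min; [exact: ideal_span_ideal|move=> z zs; apply: ideal_span_mem; rewrite mem_rcons inE zs orbT].
have /choice[h hE] : forall y, exists z, forall x, p x = y -> phi x = z.
  move=> y; have [x xy] := ps y; exists (phi x) => x'; rewrite -xy; exact: wd.
have hp x : h (p x) = phi x by rewrite (hE (p x) x).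
have hl : linear h.
  move=> c y z; have [x <-] := ps y; have [x' <-] := ps z.
  by rewrite -linearP !hp linearP.
have hm : monoid_morphism h.
  split; first by rewrite -(rmorph1 p) hp rmorph1.
  by move=> y z; have [x <-] := ps y; have [x' <-] := ps z; rewrite -rmorphM !hp rmorphM.
pose psi := HB.pack_for {lrmorphism T -> R} h
  (GRing.isLinear.Build _ _ _ _ h hl) (GRing.isMonoidMorphism.Build _ _ h hm).
exists psi; split=> //; split.
- by move=> i y hy; have [x hx <-] := graded_lift pR hy; rewrite /= hp; apply: fg.
- by move=> y; have [x <-] := fs y; exists (p x); exact: hp.
- apply/seteqP; split=> y.
    have [x <-] := ps y; rewrite /kernel /= hp => x0.
    have : ideal_span (rcons s f) x by rewrite -fk.
    rewrite ideal_span_rcons => -[a]; rewrite -pk /kernel /= => e.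
    by apply/ideal_span1; exists (p a); move/eqP: e; rewrite linearB rmorphM /= subr_eq0 => /eqP.
  move=> /ideal_span1[a ->]; have [b <-] := ps a.
  rewrite /kernel /= -rmorphM hp; rewrite -[_ = 0]/((kernel phi) (f * b)) fk mulrC.
  by case: (ideal_span_ideal (rcons s f)) => _ _; apply; apply: ideal_span_mem; rewrite mem_rcons inE eqxx.
Qed.

(** * Hypersurfaces defined by a product of two linear forms *)

(** The functional reads the coefficient of [w] in degree N; the last hypothesis makes it
    nondegenerate on each homogeneous component. *)
Lemma graded_gorenstein (k : fieldType) (R : homog_ring k) N (w : R) :
  hr_comp N w -> w <> 0 -> (forall x : R, hr_comp N x -> exists c : k, x = c *: w) ->
  (forall i (x : R), (N < i)%N -> hr_comp i x -> x = 0) ->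
  (forall i (x : R), (i <= N)%N -> hr_comp i x -> x <> 0 ->
     exists2 z, hr_comp (N - i) z & z * x <> 0) ->
  gorenstein R.
Proof.
move=> Nw w0 hN RN nd.
have /choice[tau tauE] : forall x : R, exists c : k, hc N x = c *: w by move=> x; exact/hN/hc_comp.
have inj c d : c *: w = d *: w -> c = d.
  move=> /eqP; rewrite -subr_eq0 -scalerBl scaler_eq0 subr_eq0 => /orP[/eqP//|/eqP//].
have tl : linear (tau : R -> k^o).
  by move=> c x y; apply: inj; rewrite -tauE linearP /= !tauE scalerDl scalerA.
pose t := HB.pack_for {linear R -> k^o} (tau : R -> k^o) (GRing.isLinear.Build _ _ _ _ (tau : R -> k^o) tl).
have /choice[s sE] := @hcomp_span k R.
apply: (@nondegenerate_gorenstein k R t (flatten [seq s i | i <- iota 0 N.+1])).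
  move=> x; have [m hm] := hc_sum x.
  have -> : x = \sum_(i < m) 1 *: hc i x.
    by rewrite {1}(hm m (leqnn m)); apply: eq_bigr => i _; rewrite scale1r.
  apply: inspan_sum => i; have [iN|Ni] := leqP i N; last first.
    by rewrite (RN i _ Ni (hc_comp _ _)); exact: inspan0.
  apply: inspan_trans ((sE i).2 _ (hc_comp i x)) => y ys; apply: inspan_mem.
  by apply/flatten_mapP; exists (val i); rewrite // mem_iota.
move=> x hx; apply: hc_eq0 => i; have [iN|Ni] := leqP i N; last exact: RN Ni (hc_comp _ _).
apply: contrapT => /(nd _ _ iN (hc_comp i x))[z hz]; apply.
have := hc_mul i x hz; rewrite subnK // => <-.
by rewrite tauE -[tau _]/(t _) hx scale0r.
Qed.

Section Hypersurface.
Variables (k : fieldType) (T R : homog_ring k) (phi : {lrmorphism T -> R}).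
Implicit Types (l f x z : T) (t : seq T).

(* R = T/(l l') with T behaving as a one-dimensional ring of minimal
   multiplicity whose reduction is l. *)
Definition quadric_factor l l' f :=
  [/\ [/\ hr_comp 1 l, hr_comp 1 l' & f = l * l'], forall x, f * x = 0 -> x = 0,
      residue_iso [:: f] phi &
      forall y : T, hr_comp 2 y -> exists2 z, hr_comp 1 z & y = l * z].

Lemma residue_iso1 f : residue_iso [:: f] phi ->
  [/\ graded_morphism phi, forall y : R, exists x, phi x = y &
      forall x, phi x = 0 <-> exists a, x = f * a].
Proof.
move=> [g ps pk]; by split=> // x; rewrite -ideal_span1 -pk; exact: iff_refl.
Qed.

Variables (l l' f : T) (D : quadric_factor l l' f).

Lemma quadric_l1 : hr_comp 1 l. Proof. by case: D => -[]. Qed.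
Lemma quadric_l'1 : hr_comp 1 l'. Proof. by case: D => -[]. Qed.
Lemma quadric_f : f = l * l'. Proof. by case: D => -[]. Qed.
Lemma quadric_f2 : hr_comp 2 f.
Proof. by rewrite quadric_f; apply: (@hcompM _ _ 1 1); [exact: quadric_l1|exact: quadric_l'1]. Qed.

Lemma quadric_regf x : f * x = 0 -> x = 0. Proof. by case: D => _ + _ _; apply. Qed.

Lemma quadric_regl x : l * x = 0 -> x = 0.
Proof. by move=> e; apply: quadric_regf; rewrite quadric_f mulrAC e mul0r. Qed.

Lemma quadric_regl' x : l' * x = 0 -> x = 0.
Proof. by move=> e; apply: quadric_regf; rewrite quadric_f -mulrA e mulr0. Qed.

Lemma quadric_canl (x y : T) : l * x = l * y -> x = y.
Proof.
move=> /eqP; rewrite -subr_eq0 -mulrBr => /eqP/quadric_regl/eqP.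
by rewrite subr_eq0 => /eqP.
Qed.

Lemma quadric_canl' (x y : T) : l' * x = l' * y -> x = y.
Proof.
move=> /eqP; rewrite -subr_eq0 -mulrBr => /eqP/quadric_regl'/eqP.
by rewrite subr_eq0 => /eqP.
Qed.

Lemma quadric_l0 : l <> 0.
Proof. by move=> l0; have := @quadric_regl 1; rewrite l0 mul0r => /(_ erefl)/eqP; rewrite oner_eq0. Qed.

Lemma quadric_comp i (y : T) : hr_comp i.+2 y -> exists2 z, hr_comp i.+1 z & y = l * z.
Proof.
elim: i y => [|i IHi] y; first by case: D => _ _ _; apply.
have [n [a [a1 aS]]] := hcomp_gens T.
move=> /aS[b hb ->]; have /choice[c hc] : forall j, exists z, hr_comp i.+1 z /\ b j = l * z.
  by move=> j; have [z hz e] := IHi _ (hb j); exists z.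
exists (\sum_j a j * c j).
  by apply: hcomp_sum => j _; rewrite -add1n; apply: hcompM => //; exact: (hc j).1.
by rewrite mulr_sumr; apply: eq_bigr => j _; rewrite (hc j).2 mulrCA.
Qed.

(** Since T_2 = l T_1, dividing by [l] turns multiplication by l' from T_1 to T_2 into an
    endomorphism [h] of the finite-dimensional space T_1, injective because l' is regular, hence
    surjective. *)
Lemma quadric_comp2' (y : T) : hr_comp 2 y -> exists2 z, hr_comp 1 z & y = l' * z.
Proof.
(* The projection to degree 1 makes [h] a linear map on all of [T]. *)
have /choice[h hE] : forall x, exists w, hr_comp 1 w /\ l' * hc 1 x = l * w.
  move=> x; have [|w] := @quadric_comp 0 (l' * hc 1 x); last by exists w.
  by apply: (@hcompM _ _ 1 1); [exact: quadric_l'1|exact: hc_comp].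
have hl a x z : h (a *: x + z) = a *: h x + h z.
  apply: quadric_canl; rewrite -(hE _).2 linearP mulrDr -scalerAr (hE x).2 (hE z).2.
  by rewrite mulrDr -scalerAr.
have [u [uS iu hu]] := @hcomp_basis k T 1 [::] (fun c _ i => fun h => False_ind _ (notF h)).
rewrite cat0s in iu hu => hy; have [v hv ->] := @quadric_comp 0 y hy.
have [x hx <-] : exists2 x, inspan u x & h x = v.
  apply: (indep_endo_surj iu) => //; last exact: hu.
    by move=> x _; apply/hu; exact: (hE x).1.
  move=> x /(inspan_hcomp uS) hx e; have := (hE x).2; rewrite e mulr0 hc_id //.
  exact: quadric_regl'.
have hx1 := inspan_hcomp uS hx; exists x => //.
by rewrite -(hE x).2 hc_id.
Qed.

Lemma quadric_comp3 i (y : T) : hr_comp i.+3 y -> exists2 z, hr_comp i.+1 z & y = f * z.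
Proof.
elim: i y => [|i IHi] y.
  move=> /quadric_comp[z hz ->]; have [v hv ->] := quadric_comp2' hz.
  by exists v => //; rewrite mulrA -quadric_f.
have [n [a [a1 aS]]] := hcomp_gens T.
move=> /aS[b hb ->]; have /choice[c hc] : forall j, exists z, hr_comp i.+1 z /\ b j = f * z.
  by move=> j; have [z hz e] := IHi _ (hb j); exists z.
exists (\sum_j a j * c j).
  by apply: hcomp_sum => j _; rewrite -add1n; apply: hcompM => //; exact: (hc j).1.
by rewrite mulr_sumr; apply: eq_bigr => j _; rewrite (hc j).2 mulrCA.
Qed.

Lemma quadric_iso : residue_iso [:: f] phi. Proof. by case: D. Qed.

Lemma quadric_vanish i (y : R) : (3 <= i)%N -> hr_comp i y -> y = 0.
Proof.
case: i => [|[|[|i]]] // _ hy; have [x hx <-] := graded_lift quadric_iso hy.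
have [z _ ->] := quadric_comp3 hx; have [_ _ pk] := residue_iso1 quadric_iso.
by apply/pk; exists z.
Qed.

Lemma quadric_inj1 x : hr_comp 1 x -> phi x = 0 -> x = 0.
Proof.
move=> hx; have [_ _ pk] := residue_iso1 quadric_iso; move=> /pk[a e].
exact: homog_multiple_low quadric_f2 hx _ e.
Qed.

Lemma lc_linear (V W : lmodType k) (h : {linear V -> W}) (s : seq V) c :
  h (lc s c) = lc (map h s) c.
Proof.
rewrite /lc linear_sum size_map; apply: eq_bigr => i _.
by rewrite linearZ /= (nth_map 0).
Qed.

Variables (t : seq T) (ht1 : forall x, x \in t -> hr_comp 1 x) (it : indep (l :: t)).
Hypothesis st : forall x, hr_comp 1 x -> inspan (l :: t) x.

Lemma lc_cons (V : lmodType k) (x : V) s c : lc (x :: s) c = c 0%N *: x + lc s (fun i => c i.+1).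
Proof. by rewrite /lc big_ord_recl. Qed.

(** In R_2 = T_2 / k f the space T_2 = l' T_1 loses exactly l' l = f, so the products of l' with [t]
    form a basis. *)
Lemma quadric_span2 (y : R) : hr_comp 2 y -> exists c, y = phi (l' * lc t c).
Proof.
move=> hy; have [x hx <-] := graded_lift quadric_iso hy.
have [z hz ->] := quadric_comp2' hx; have [c ->] := st hz.
exists (fun i => c i.+1); rewrite lc_cons mulrDr linearD /= -scalerAr mulrC -quadric_f.
have [_ _ pk] := residue_iso1 quadric_iso.
have -> : phi (c 0%N *: f) = 0 by apply/pk; exists (c 0%N)%:A; rewrite mulr_algr.
by rewrite add0r.
Qed.

Lemma quadric_indep2 c : phi (l' * lc t c) = 0 -> forall i, (i < size t)%N -> c i = 0.
Proof.
have [_ _ pk] := residue_iso1 quadric_iso; move=> /pk[a].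
rewrite quadric_f (mulrC l) -mulrA => /quadric_canl' e.
have h1 : hr_comp (1 + 0) (lc t c) by apply: hcomp_sum => j _; apply/hcompZ/ht1/mem_nth.
have [b /hcomp0P[d ->] {}e] := homog_cofactor quadric_l1 h1 e.
pose c' i := if i is j.+1 then c j else - d.
have : lc (l :: t) c' = 0 by rewrite lc_cons /= e mulr_algr scaleNr addNr.
by move=> /it h i si; apply: (h i.+1).
Qed.

Lemma quadric_hilbert :
  hilbert_series R (fun i => ((1 + 'X) * (1 + size t *: 'X) : {poly nat})`_i).
Proof.
have coefE i : ((1 + 'X) * (1 + size t *: 'X) : {poly nat})`_i =
    nth 0%N [:: 1%N; (size t).+1; size t] i.
  rewrite mulrDl mul1r coefD coefXM !coefD !coefZ !coefX !coef1.
  by case: i => [|[|[|i]]] //=; rewrite /GRing.add /GRing.mul /= ?muln0 ?muln1 ?addn0 ?add0n ?addn1 ?nth_nil.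
move=> i; rewrite coefE; case: i => [|[|[|i]]].
- apply: (@indep_has_dim _ _ _ [:: 1]).
  + by apply/indep1/eqP; exact: oner_neq0.
  + by move=> x; rewrite inE => /eqP->; exact: hcomp1.
  + by move=> x /hcomp0P[c ->]; exists (fun=> c); rewrite lc1.
- have -> : nth 0%N [:: 1%N; (size t).+1; size t] 1 = size (map phi (l :: t)) by rewrite size_map.
  have [g _ _] := residue_iso1 quadric_iso.
  apply: indep_has_dim.
  + move=> c; rewrite -lc_linear => e i; rewrite size_map; apply: it.
    apply: quadric_inj1 e; apply: hcomp_sum => j _; apply: hcompZ.
    have : (l :: t)`_j \in l :: t by exact: mem_nth.
    by rewrite inE => /orP[/eqP->|/ht1//]; exact: quadric_l1.
  + move=> _ /mapP[x xs ->]; apply: g; move: xs.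
    by rewrite inE => /orP[/eqP->|/ht1//]; exact: quadric_l1.
  + move=> y hy; have [x hx <-] := graded_lift quadric_iso hy.
    by have [c ->] := st hx; exists c; rewrite lc_linear.
- have -> : nth 0%N [:: 1%N; (size t).+1; size t] 2 = size [seq phi (l' * x) | x <- t] by rewrite size_map.
  have E c : phi (l' * lc t c) = lc [seq phi (l' * x) | x <- t] c.
    rewrite /lc mulr_sumr linear_sum size_map; apply: eq_bigr => j _.
    by rewrite -scalerAr linearZ /= (nth_map 0).
  have [g _ _] := residue_iso1 quadric_iso.
  apply: indep_has_dim.
  + by move=> c; rewrite -E => e i; rewrite size_map; apply: quadric_indep2.
  + move=> _ /mapP[x xs ->]; apply: g; apply: (@hcompM _ _ 1 1); last exact: ht1.
    exact: quadric_l'1.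
  + by move=> y /quadric_span2[c ->]; exists c.
- rewrite -[nth _ _ _]/(nth 0%N [::] i) nth_nil.
  apply: (@indep_has_dim _ _ _ [::]) => // y hy; rewrite (quadric_vanish _ hy) //.
  exact: inspan0.
Qed.

(** With [t] empty, R has Hilbert function (1, 1) and socle l. With one element the top degree is 2:
    if u kills R_1, then l u = a f gives u = a l', and t0 u = b f gives a t0 = b l, so a = 0. *)
Lemma quadric_gorenstein : (size t <= 1)%N -> gorenstein R.
Proof.
have [g _ pk] := residue_iso1 quadric_iso.
have l0 : phi l <> 0 by move=> /(quadric_inj1 quadric_l1)/quadric_l0.
have one0 : (1 : R) <> 0 by apply/eqP; exact: oner_neq0.
case: t ht1 it st quadric_span2 quadric_indep2 => [|t0 [|//]] h1 i1 s1 sp2 in2 _.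
  apply: (@graded_gorenstein k R 1 (phi l)) => //.
  - by apply: g; exact: quadric_l1.
  - move=> y hy; have [x hx <-] := graded_lift quadric_iso hy.
    by have [c ->] := s1 x hx; exists (c 0%N); rewrite lc1 linearZ.
  - move=> [|[|[|i]]] // y _ hy; last exact: quadric_vanish hy.
    by have [c ->] := sp2 _ hy; rewrite /lc big_ord0 mulr0 linear0.
  - move=> [|[|//]] x _ hx x0.
      have [c xE] : exists c : k, x = c%:A by apply/hcomp0P.
      exists (phi l); first by apply: g; exact: quadric_l1.
      rewrite xE mulr_algr => /eqP; rewrite scaler_eq0 => /orP[/eqP c0|/eqP//].
      by apply: x0; rewrite xE c0 scale0r.
    by exists 1; [exact: hcomp1|rewrite mul1r].
have t1 : hr_comp 1 t0 by apply: h1; rewrite inE.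
have w0 : phi (l' * t0) <> 0.
  move=> e; have := in2 (fun=> 1); rewrite lc1 scale1r => /(_ e 0%N isT)/eqP.
  by rewrite oner_eq0.
have wc : hr_comp 2 (phi (l' * t0)).
  by apply/g/(@hcompM _ _ 1 1) => //; exact: quadric_l'1.
apply: (@graded_gorenstein k R 2 (phi (l' * t0))) => //.
- by move=> y /sp2[c ->]; exists (c 0%N); rewrite lc1 -scalerAr linearZ.
- by move=> i x i2 hx; exact: quadric_vanish hx.
move=> [|[|[|//]]] x _ hx x0; first 2 last.
- by exists 1; [exact: hcomp1|rewrite mul1r].
- have [c xE] : exists c : k, x = c%:A by apply/hcomp0P.
  exists (phi (l' * t0)) => //.
  rewrite xE mulr_algr => /eqP; rewrite scaler_eq0 => /orP[/eqP c0|/eqP//].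
  by apply: x0; rewrite xE c0 scale0r.
have [u hu ux] := graded_lift quadric_iso hx.
have mulf z : hr_comp 1 z -> phi z * x = 0 -> exists a : k, z * u = a *: f.
  move=> hz; rewrite -ux -rmorphM => /pk[a e].
  have h2 : hr_comp (2 + 0) (z * u) by apply: (@hcompM _ _ 1 1).
  have [b /hcomp0P[d ->] ->] := homog_cofactor quadric_f2 h2 e.
  by exists d; rewrite mulr_algr.
apply: contrapT => /forallPNP hz.
have [a ea] : exists a : k, l * u = a *: f.
  apply: (mulf _ quadric_l1); apply: contrapT => h; apply: (hz (phi l)) => //.
  by apply: g; exact: quadric_l1.
have [b eb] : exists a : k, t0 * u = a *: f.
  by apply: (mulf _ t1); apply: contrapT => h; apply: (hz (phi t0)) => //; apply: g.
have uE : u = a *: l' by apply: quadric_canl; rewrite ea quadric_f scalerAr.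
have e : a *: t0 = b *: l.
  apply: quadric_canl'; rewrite -scalerAr scalerAl -uE mulrC eb quadric_f.
  by rewrite -!scalerAr (mulrC l).
have : lc [:: l; t0] (fun i => if i is 0 then - b else a) = 0.
  by rewrite lc_cons lc1 /= e scaleNr addNr.
move=> /i1/(_ 1%N isT) a0; apply: x0; by rewrite -ux uE a0 scale0r linear0.
Qed.

End Hypersurface.

(** * Consequences of minimal multiplicity *)

Lemma hc2_mul (k : fieldType) (S : homog_ring k) (x y : S) :
  hc 0 x = 0 -> hc 0 y = 0 -> hc 2 (x * y) = hc 1 x * hc 1 y.
Proof.
move=> x0 y0; have [N hN] := hc_sum x.
rewrite {1}(hN N.+2) 1?ltnW ?leqnSn // !big_ord_recl /= x0 add0r mulrDl linearD /=.
rewrite (@hc_mul _ _ 1 1) ?mulr_suml ?linear_sum ?big1 ?addr0 //=; last exact: hc_comp.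
move=> i _; rewrite (hc_mulE _ _ (hc_comp _ _)) /= /bump /=; case: leqP => // i2.
have -> : (2 - (1 + (1 + i)))%N = 0%N by apply/eqP; rewrite subn_eq0 !add1n.
by rewrite y0 mulr0.
Qed.

Lemma hc1_mul (k : fieldType) (S : homog_ring k) (x y : S) :
  hc 1 (x * y) = hc 0 x * hc 1 y + hc 1 x * hc 0 y.
Proof.
have [N hN] := hc_sum x.
rewrite {1}(hN N.+2) 1?ltnW ?leqnSn // !big_ord_recl /= !mulrDl !linearD /=.
rewrite (@hc_mul _ _ 0 1 (hc 0 x) y (hc_comp _ _)) (@hc_mul _ _ 1 0 (hc 1 x) y (hc_comp _ _)).
congr (_ + _); rewrite -[RHS]addr0; congr (_ + _).
rewrite mulr_suml linear_sum big1 // => i _.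
by rewrite /= (hc_mulE _ _ (hc_comp _ _)).
Qed.

Lemma krull_dim_inj (A : comNzRingType) d e : krull_dim A d -> krull_dim A e -> d = e.
Proof.
by move=> [[p hp] hd] [[q hq] he]; apply/eqP; rewrite eqn_leq (he _ p) // (hd _ q).
Qed.

(** The parameter of minimal multiplicity may be inhomogeneous; comparing components of degree 2
    shows that its linear part generates S_2 over S_1. Applied to [f], this gives the second
    factor. *)
Lemma minmult_factor (k : fieldType) (R S : homog_ring k) (f : S) (phi : {lrmorphism S -> R}) :
  minmult_deformation f phi -> exists l l', quadric_factor phi l l' f.
Proof.
move=> [[_ kS] [s [ks sm _] e] f2 freg phiR].
have : size s = 1%N := krull_dim_inj ks kS.
case: s ks sm e => [|x [|//]] _ sm e _ //.
have x0 : hc 0 x = 0 by apply/hr_maxE/sm; rewrite /= inE.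
have E y : hr_comp 2 y -> exists2 z, hr_comp 1 z & y = hc 1 x * z.
  move=> y2; have := @hr_max_exp_hcomp _ _ 2 0 y y2; rewrite -e => -[t [ht yE]].
  have [v v0 vE] : exists2 v, hc 0 v = 0 & y = x * v.
    rewrite yE big_seq; elim/big_ind: _ => [|_ _ [v v0 ->] [w w0 ->]|p /ht[/ideal_span1[a ->] /hr_maxE p0]].
    - by exists 0; rewrite ?linear0 ?mulr0.
    - by exists (v + w); rewrite ?mulrDr // linearD /= v0 w0 addr0.
    - exists (a * p.2); rewrite ?mulrA //; apply/hr_maxE.
      by case: (hr_max_ideal S) => _ _; apply; apply/hr_maxE.
  exists (hc 1 v); first exact: hc_comp.
  by rewrite -hc2_mul // -vE hc_id.
have [l' hl' fE] := E f f2; exists (hc 1 x), l'; split=> //; split=> //; exact: hc_comp.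
Qed.

Section Quadric.
Variables (k : fieldType) (T R : homog_ring k) (phi : {lrmorphism T -> R}) (l l' f : T).
Hypothesis D : quadric_factor phi l l' f.

Lemma quadric_basis : exists t : seq T, [/\ forall x, x \in t -> hr_comp 1 x,
  indep (l :: t) & forall x, hr_comp 1 x -> inspan (l :: t) x].
Proof. by apply: (@hcomp_basis _ _ 1 [:: l]); apply/indep1/(quadric_l0 D). Qed.

Lemma quadric_basis2 : ~ gorenstein R -> exists t : seq T, [/\ forall x, x \in t -> hr_comp 1 x,
  indep (l :: t), forall x, hr_comp 1 x -> inspan (l :: t) x & (2 <= size t)%N].
Proof.
move=> ng; have [t [t1 it st]] := quadric_basis; exists t; split=> //.
by rewrite ltnNge; apply/negP => h; apply: ng; apply: quadric_gorenstein D _ t1 it st h.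
Qed.

Lemma quadric_factor_hilbert : ~ gorenstein R -> exists2 r : nat, (2 <= r)%N &
  hilbert_series R (fun i => ((1 + 'X) * (1 + r *: 'X) : {poly nat})`_i).
Proof.
move=> /quadric_basis2[t [t1 it st t2]]; exists (size t) => //.
exact: (quadric_hilbert D).
Qed.

Lemma quadric_factor_max3 : ideal_exp (@hr_max k R) 3 = [set 0].
Proof. by apply/hr_max_exp_eq0 => i i3 x; apply: (quadric_vanish D). Qed.

Lemma quadric_factor_Gdim_zero :
  exists M : lmodType R, [/\ fin_gen M, ~ fin_free M & Gdim_zero M].
Proof.
have [_ ps pk] := residue_iso1 (quadric_iso D).
pose I : set R^o := [set y | exists a : R, y = a * phi l].
have [|M [q [qs qk]]] := @quotient_module R R^o I.
  split; first by exists 0; rewrite mul0r.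
  by move=> a _ _ [b ->] [c ->]; exists (a * b + c); rewrite mulrDl -mulrA.
have [|a aE] := @linear_pack R 'rV[R]_1 M (fun v => q (v 0 0)).
  by move=> c u v; rewrite !mxE -linearP.
have as_ y : exists v, a v = y.
  by have [x <-] := qs y; exists (x%:M); rewrite aE mxE eqxx mulr1n.
exists M; split; first by exists 1%N, a.
- move=> [b [p [p' pK p'K]]].
  have kill (y : M) : phi l *: y = 0.
    have [x <-] := qs y; rewrite -linearZ; apply/qk.
    by exists x; rewrite -[_ *: _]/(phi l * x) mulrC.
  case: b p p' pK p'K => [|b] p p' pK p'K.
    have : q 1 = 0.
      by rewrite -[q 1]p'K (_ : p' (q 1) = 0) ?linear0 //; apply/rowP; case.
    move=> /qk[y]; have [x <-] := ps y; rewrite -rmorphM => e.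
    have /pk[z] : phi (1 - x * l) = 0 by rewrite linearB /= -e rmorph1 subrr.
    move=> /(congr1 (hc 0)); rewrite linearB /= (hc_id (hcomp1 T)).
    rewrite mulrC (hc_mulE _ _ (quadric_l1 D)) (hc_mulE _ _ (quadric_f2 D)) /=.
    by rewrite subr0 => /eqP; rewrite oner_eq0.
  have : phi l *: delta_mx 0 0 = 0 :> 'rV[R]_b.+1.
    by apply: (can_inj pK); rewrite linearZ /= kill linear0.
  move=> /rowP/(_ 0); rewrite !mxE !eqxx mulr1 => e.
  exact: (quadric_l0 D) (quadric_inj1 D (quadric_l1 D) e).
apply: (@factorization_Gdim_zero _ _ phi f 1 ps pk _ (quadric_regf D) 1 1 (l%:M) (l'%:M)).
- by exists 1; rewrite rmorph1 mulr1.
- by rewrite mul1r (quadric_f D) scalar_mxM.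
- by rewrite mul1r (quadric_f D) mulrC scalar_mxM.
- exact: as_.
- move=> v; rewrite aE map_scalar_mx; split=> [/qk[y e]|[w ->]].
    exists (y%:M); rewrite -scalar_mxM; apply/rowP => i.
    by rewrite !ord1 mxE eqxx mulr1n e.
  by apply/qk; exists (w 0 0); rewrite mul_mx_scalar mxE mulrC.
Qed.

(** As [R] is not Gorenstein, two linear forms are independent modulo [l]. Their coordinate
    functions on the linear part kill [l T] and obey the Leibniz rule, so they serve as [lam] and
    [mu]. *)
Lemma quadric_Gdim : cohen_macaulay T -> ~ gorenstein R ->
  forall M : lmodType R, fin_gen M ->
  Gdim M = (pd (restr phi M) - 1)%E /\ ((exists x : M, x <> 0) -> Gdim M = CIdim M).
Proof.
move=> [nT _] ng M fM; have [t [t1 it st t2]] := quadric_basis2 ng.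
have [_ ps pk] := residue_iso1 (quadric_iso D).
have [eps epsE] := @augmentation k T.
have inj c d : (c%:A : T) = d%:A -> c = d.
  by move=> /eqP; rewrite -subr_eq0 -scalerBl => /eqP/scaleA_inj/eqP; rewrite subr_eq0 => /eqP.
have epsK c : eps c%:A = c.
  by apply: inj; rewrite -epsE hc_id //; apply/hcomp0P; exists c.
have eps0 x : eps x = 0 <-> hc 0 x = 0.
  by rewrite epsE; split=> [->|/scaleA_inj//]; rewrite scale0r.
have eps_h i x : hr_comp i.+1 x -> eps x = 0 by move=> hx; apply/eps0; rewrite (hc_ne hx).
have l1 := quadric_l1 D.
have hl i x : hc i.+1 (l * x) = l * hc i x by rewrite (hc_mulE _ _ l1) subn1.
have hl0 x : hc 0 (l * x) = 0 by rewrite (hc_mulE _ _ l1).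
have max2 x y : eps x = 0 -> eps y = 0 -> exists z, x * y = l * z.
  move=> /eps0 x0 /eps0 y0.
  have /choice[c cE] : forall i, exists z, hc i (x * y) = l * z.
    move=> [|[|i]]; last by have [z _ e] := quadric_comp D (hc_comp i.+2 (x * y)); exists z.
    - exists 0; rewrite mulr0; apply/hr_maxE.
      by case: (hr_max_ideal T) => _ _; apply; apply/hr_maxE.
    - by exists 0; rewrite hc1_mul x0 y0 mul0r !mulr0 addr0.
  have [N hN] := hc_sum (x * y); exists (\sum_(i < N) c i).
  by rewrite (hN N (leqnn N)) mulr_sumr; apply: eq_bigr => i _.
have sepl x : (forall N, exists y, x = l ^+ N * y) -> x = 0.
  move=> h; apply: hc_eq0 => i; have [y ->] := h i.+1.
  by apply: (@hc_mul0 _ _ i.+1) => //; have := hcompX i.+1 l1; rewrite mul1n.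
have [z0 _ lf] : exists2 z, hr_comp 1 z & l ^+ 3 = f * z.
  by apply: (quadric_comp3 D); have := hcompX 3 l1.
(* Chosen coefficients are determined only at indices up to [size t], hence the bounds in the facts
   below. *)
have /choice[c cE] : forall x : T, exists c, hc 1 x = lc (l :: t) c by move=> x; exact/st/hc_comp.
have cU x d : hc 1 x = lc (l :: t) d -> forall i, (i <= size t)%N -> c x i = d i.
  by move=> e i si; apply: (indep_inj it) => //; rewrite -cE.
have cD a x y i : (i <= size t)%N -> c (a *: x + y) i = a * c x i + c y i.
  by move=> si; apply: (cU _ (fun i => a * c x i + c y i)) => //; rewrite lcD -!cE linearP.
have cl x i : (i < size t)%N -> c (l * x) i.+1 = 0.
  move=> si; apply: (cU _ (fun j => if j is 0 then eps x else 0)) => //.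
  rewrite lc_cons /= hl epsE mulr_algr.
  by rewrite /lc big1 ?addr0 // => j _; rewrite scale0r.
have cM x y i : (i < size t)%N -> c (x * y) i.+1 = c x i.+1 * eps y + eps x * c y i.+1.
  move=> si; rewrite (cU _ (fun j => eps y * c x j + eps x * c y j)) //; first by rewrite mulrC.
  rewrite hc1_mul !epsE mulr_algl mulr_algr !cE addrC.
  by rewrite lcD; congr (_ + _); rewrite /lc scaler_sumr; apply: eq_bigr => j _; rewrite scalerA.
have add i : (i < size t)%N -> exists lam : {additive T -> k}, forall x, lam x = c x i.+1.
  move=> si; have h : zmod_morphism (fun x => c x i.+1).
    by move=> x y; rewrite -[x - y]addrC -scaleN1r cD // mulN1r addrC.
  by exists (HB.pack_for {additive T -> k} (fun x => c x i.+1) (GRing.isZmodMorphism.Build _ _ _ h)).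
have ct i j : (i < size t)%N -> (j < size t)%N -> c t`_i j.+1 = (j == i)%:R.
  move=> si sj; apply: (cU _ (fun m => (m == i.+1)%:R)) => //.
  by rewrite lc_delta //= hc_id //; apply/t1/mem_nth.
have [lam lamE] := add 0%N (ltnW t2); have [mu muE] := add 1%N t2.
have te i : (i < size t)%N -> eps t`_i = 0 by move=> si; apply: (eps_h 0%N); apply/t1/mem_nth.
have t2' := ltnW t2.
apply: (@Gdim_pd_CIdim k T eps l f z0 epsK _ _ (quadric_regl D) (quadric_regf D) max2 sepl lf
  R phi ps pk nT lam mu t`_0 t`_1) => //; rewrite ?te // ?lamE ?muE ?ct //.
- exact: eps_h l1.
- exact: eps_h (quadric_f2 D).
- by move=> x y; rewrite !lamE cM.
- by move=> x; rewrite lamE cl.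
- by move=> x y; rewrite !muE cM.
- by move=> x; rewrite muE cl.
Qed.

End Quadric.

(** * Factoring a quadric into linear forms *)

Lemma nilpotentD (A : comNzRingType) (a b : A) m n :
  a ^+ m = 0 -> b ^+ n = 0 -> (a + b) ^+ (m + n) = 0.
Proof.
move=> a0 b0; rewrite exprDn big1 // => i _; have [ni|ni] := leqP n i.
  by rewrite -(subnKC ni) (exprD b) b0 mul0r mulr0 mul0rn.
have -> : (m + n - i = m + (n - i))%N by rewrite addnBA // ltnW.
by rewrite exprD a0 !mul0r mul0rn.
Qed.

Section PerfectPairing.
Variables (Q : comNzRingType) (B M M' : set Q).
Hypotheses (B1 : B 1) (BB : forall x y, B x -> B y -> B (x - y))
  (BM : forall x y, B x -> B y -> B (x * y))
  (M0 : M 0) (MD : forall x y, M x -> M y -> M (x + y))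
  (MZ : forall b x, B b -> M x -> M (b * x))
  (M'0 : M' 0) (M'D : forall x y, M' x -> M' y -> M' (x + y))
  (M'Z : forall b x, B b -> M' x -> M' (b * x))
  (MM' : forall x y, M x -> M' y -> B (x * y))
  (fitting : forall c, B c -> exists m h, B h /\ c ^+ m = c ^+ m.+1 * h).

Let BX x n : B x -> B (x ^+ n).
Proof. by move=> Bx; elim: n => [|n IHn]; rewrite ?expr0 // exprS; apply: BM. Qed.

(* Fitting's lemma splits off the part of the ring on which a further pairing
   value is invertible, so idempotent pairing values can be accumulated. *)
Lemma pairing_idempotent (s : seq (Q * Q)) : (forall p, p \in s -> M p.1 /\ M' p.2) ->
  exists l l', [/\ M l, M' l', (l * l') * (l * l') = l * l' &
    exists n, ((1 - l * l') * \sum_(p <- s) p.1 * p.2) ^+ n = 0].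
Proof.
elim: s => [|[x y] s IHs] hs.
  exists 0, 0; split=> //; first by rewrite !mulr0.
  by exists 1%N; rewrite big_nil mulr0 expr1.
have [|l [l' [Ml Ml' EE [a na]]]] := IHs; first by move=> p ps; apply: hs; rewrite inE ps orbT.
have [/= Mx My] : M x /\ M' y by apply: (hs (x, y)); rewrite inE eqxx.
have BE : B (l * l') by apply: MM'.
set E := l * l' in EE na BE; pose c : Q := (1 - E) * (x * y).
have Bc : B c by apply: BM; [apply: BB|apply: MM'].
have [m [h [Bh ch]]] := fitting Bc.
have cj j : c ^+ m.+1 = c ^+ (m.+1 + j) * h ^+ j.
  elim: j => [|j IHj]; first by rewrite addn0 mulr1.
  have ch' : c ^+ m.+1 = c ^+ m.+1 * c * h by rewrite -exprSr !(exprS c) {1}ch exprS; ring.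
  have -> : c ^+ (m.+1 + j.+1) * h ^+ j.+1 = c ^+ m.+1 * c * h * (c ^+ j * h ^+ j).
    by rewrite exprD !(exprS _ j); ring.
  by rewrite -ch' mulrA -exprD.
(* [e] is Fitting's idempotent of [c]: on its part [c] has inverse [q], and on the complement [c] is
   nilpotent. *)
pose q : Q := c ^+ m * h ^+ m.+1; pose e : Q := c * q.
have eE : e = c ^+ m.+1 * h ^+ m.+1 by rewrite /e /q mulrA -exprS.
have ec : e * c ^+ m.+1 = c ^+ m.+1 by rewrite {2}(cj m.+1) eE exprD; ring.
have ee : e * e = e by rewrite {2 3}eE mulrA ec.
have Bq : B q by apply: BM; apply: BX.
have Be : B e by apply: BM.
have Ee : E * e = 0.
  have -> : E * e = (E - E * E) * (x * y * q) by rewrite /e /c; ring.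
  by rewrite EE subrr mul0r.
have exy : e * (x * y) = e * c.
  have -> : e * (x * y) = e * c + E * e * (x * y) by rewrite {1}/c; ring.
  by rewrite Ee mul0r addr0.
(* The orthogonal idempotents [E] and [e] glue the old pair (l, l') and the new pair (x, q y), whose
   product is [e] on the part of [e]. *)
have ll : (E * l + e * x) * (E * l' + q * e * y) = E + e.
  have -> : (E * l + e * x) * (E * l' + q * e * y) =
     E * E * (l * l') + E * e * (l * q * y + x * l') + q * e * (e * (x * y)) by ring.
  rewrite -/E EE EE Ee mul0r addr0 exy; congr (_ + _).
  have -> : q * e * (e * c) = e * e * (c * q) by ring.
  by rewrite ee -/e ee.
exists (E * l + e * x), (E * l' + q * e * y); rewrite ll; split.
- by apply: MD; apply: MZ.
- by apply: M'D; apply: M'Z => //; apply: BM.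
- have -> : (E + e) * (E + e) = E * E + E * e + E * e + e * e by ring.
  by rewrite EE Ee ee !addr0.
exists (a + m.+1)%N; rewrite big_cons /=.
have -> : (1 - (E + e)) * (x * y + \sum_(p <- s) p.1 * p.2) =
    (1 - e) * ((1 - E) * \sum_(p <- s) p.1 * p.2) + (1 - e) * c.
  rewrite /c; set w := \sum_(_ <- _) _.
  have -> : 1 - (E + e) = (1 - e) * (1 - E) - E * e by ring.
  by rewrite Ee subr0; ring.
apply: nilpotentD; first by rewrite exprMn na mulr0.
by rewrite exprMn exprSr -mulrA mulrBl ec mul1r subrr mulr0.
Qed.

(** When the pairing values sum to 1, the idempotent 1 - l l' is nilpotent, hence zero. *)
Lemma pairing_unit (s : seq (Q * Q)) : (forall p, p \in s -> M p.1 /\ M' p.2) ->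
  \sum_(p <- s) p.1 * p.2 = 1 -> exists l l', [/\ M l, M' l' & l * l' = 1].
Proof.
move=> /pairing_idempotent[l [l' [Ml Ml' EE [n nn]]]] s1; exists l, l'; split=> //.
move: nn; rewrite s1 mulr1; have idem : (1 - l * l') * (1 - l * l') = 1 - l * l'.
  by rewrite mulrBr mulr1 mulrBl mul1r EE subrr subr0.
case: n => [|n]; first by move/eqP; rewrite expr0 oner_eq0.
suff -> : (1 - l * l') ^+ n.+1 = 1 - l * l' by move/eqP; rewrite subr_eq0 => /eqP.
by elim: n => [|n IHn]; rewrite ?expr1 // exprS IHn.
Qed.

End PerfectPairing.

(** A linear dependence solved for its lowest index: applied to the powers of an element it has the
    shape c^m = c^(m+1) h of Fitting's condition. *)
Lemma inspan_relation (k : fieldType) (V : lmodType k) (s : seq V) (F : nat -> V) :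
  (forall i, inspan s (F i)) ->
  exists m N (v : nat -> k), F m = \sum_(i < N) v i *: F (m.+1 + i)%N.
Proof.
move=> /choice[c cE]; pose n := size s.
pose X : 'M[k]_(n.+1, n) := \matrix_(i, j) c i j.
have : kermx X != 0.
  by rewrite kermx_eq0 -row_leq_rank -ltnNge ltnS rank_leq_col.
move=> /matrix0Pn[i0 [j0 hij]]; pose v : 'rV_n.+1 := row i0 (kermx X).
have vX : v *m X = 0 by rewrite -row_mul mulmx_ker row0.
pose w j := if insub j is Some j' then v 0 j' else 0 : k.
have wE (j : 'I_n.+1) : w j = v 0 j by rewrite /w valK.
have w0 : \sum_(i < n.+1) w i *: F i = 0.
  under eq_bigr do rewrite cE /lc scaler_sumr.
  rewrite exchange_big big1 //= => j _.
  have /rowP/(_ j) := vX; rewrite !mxE => e; rewrite -[RHS](scale0r s`_j) -[in RHS]e scaler_suml.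
  by apply: eq_bigr => i _; rewrite scalerA wE !mxE.
have ex : exists j, w j != 0 by exists (val j0); rewrite wE mxE.
case: (ex_minnP ex) => m wm mmin.
have mn : (m <= n)%N by rewrite leqNgt; apply: contra wm => nm; rewrite /w insubN // -ltnNge.
exists m, (n - m)%N, (fun i => - (w m)^-1 * w (m.+1 + i)%N).
have e : F m + \sum_(i < n - m) ((w m)^-1 * w (m.+1 + i)%N) *: F (m.+1 + i)%N = 0.
  rewrite -[F m]scale1r -(mulVf wm).
  have -> : \sum_(i < n - m) ((w m)^-1 * w (m.+1 + i)%N) *: F (m.+1 + i)%N =
     (w m)^-1 *: \sum_(i < n - m) w (m.+1 + i)%N *: F (m.+1 + i)%N.
    by rewrite scaler_sumr; apply: eq_bigr => i _; rewrite scalerA.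
  rewrite -scalerA -scalerDr; move: w0; have -> : n.+1 = (m.+1 + (n - m))%N by rewrite addSn subnKC.
  rewrite big_split_ord /= big_ord_recr big1 /= ?add0r => [->|i _]; first by rewrite scaler0.
  have -> : w i = 0; last by rewrite scale0r.
  by apply: contrapT => /eqP /mmin; rewrite leqNgt ltn_ord.
move/eqP: e; rewrite addr_eq0 => /eqP->; rewrite -sumrN; apply: eq_bigr => i _.
by rewrite mulNr scaleNr.
Qed.

Section QuadraticForm.
Variables (k : fieldType) (T : homog_ring k) (f : T).
Hypotheses (f2 : hr_comp 2 f) (freg : forall x, f * x = 0 -> x = 0)
  (f3 : forall x : T, hr_comp 3 x -> exists2 z, hr_comp 1 z & x = f * z).

Lemma regular_cubic_quartic (x : T) : hr_comp 4 x -> exists2 z, hr_comp 2 z & x = f * z.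
Proof.
have [n [a [a1 aS]]] := hcomp_gens T; move=> /aS[b hb ->].
have /choice[c hc] : forall j, exists z, hr_comp 1 z /\ b j = f * z.
  by move=> j; have [z hz e] := f3 (hb j); exists z.
exists (\sum_j a j * c j).
  by apply: hcomp_sum => j _; apply: (@hcompM _ _ 1 1) => //; exact: (hc j).1.
by rewrite mulr_sumr; apply: eq_bigr => j _; rewrite (hc j).2 mulrCA.
Qed.

(* In T[1/f] the degree-0 elements b/f (b in T_2) form a finite-dimensional
   algebra over which T_1 and T_1/f are paired with 1 in the image. *)
Lemma quadric_product : exists l l', [/\ hr_comp 1 l, hr_comp 1 l' & f = l * l'].
Proof.
have [|||Q [i [iinj iu _ _]]] := @localization T (fun u => `[< exists n, u = f ^+ n >]).
- by apply/asboolP; exists 0%N.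
- by move=> u v /asboolP[m ->] /asboolP[n ->]; apply/asboolP; exists (m + n)%N; rewrite exprD.
- move=> u x /asboolP[n ->]; elim: n => [|n IHn]; first by rewrite expr0 mul1r.
  by rewrite exprS -mulrA => /freg.
have [g fg] : exists g, i f * g = 1 by apply: iu; apply/asboolP; exists 1%N.
have can x y : i f * x = i f * y -> x = y.
  by move=> /(congr1 ( *%R g)); rewrite !mulrA (mulrC g) fg !mul1r.
pose B : set Q := [set x | exists2 b, hr_comp 2 b & i f * x = i b].
pose M : set Q := [set x | exists2 a, hr_comp 1 a & x = i a].
pose M' : set Q := [set x | exists2 a, hr_comp 1 a & i f * x = i a].
have fM a b (n : nat) x y : hr_comp n b -> i f * x = i a -> a * b = f * y -> x * i b = i y.
  by move=> _ xa ab; apply: can; rewrite mulrA xa -!rmorphM ab.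
have B1 : B 1 by exists f; rewrite ?mulr1.
have BB x y : B x -> B y -> B (x - y).
  move=> [a ha xa] [b hb yb]; exists (a - b); first exact: hcompB.
  by rewrite mulrBr xa yb rmorphB.
have BM x y : B x -> B y -> B (x * y).
  move=> [a ha xa] [b hb yb]; have [c hc e] := regular_cubic_quartic (hcompM ha hb).
  by exists c => //; rewrite mulrCA yb; exact: (fM a b 2).
have M0 : M 0 by exists 0; [exact: hcomp0|rewrite rmorph0].
have MD x y : M x -> M y -> M (x + y).
  by move=> [a ha ->] [b hb ->]; exists (a + b); [exact: hcompD|rewrite rmorphD].
have MZ b x : B b -> M x -> M (b * x).
  move=> [a ha ba] [c hc ->]; have [d hd e] := f3 (hcompM ha hc).
  by exists d => //; exact: (fM a c 1).
have M'0 : M' 0 by exists 0; [exact: hcomp0|rewrite rmorph0 mulr0].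
have M'D x y : M' x -> M' y -> M' (x + y).
  move=> [a ha xa] [b hb yb]; exists (a + b); first exact: hcompD.
  by rewrite mulrDr xa yb rmorphD.
have M'Z b x : B b -> M' x -> M' (b * x).
  move=> [a ha ba] [c hc xc]; have [d hd e] := f3 (hcompM ha hc).
  by exists d => //; rewrite mulrCA xc; exact: (fM a c 1).
have MM' x y : M x -> M' y -> B (x * y).
  move=> [a ha ->] [b hb yb]; exists (a * b); first exact: (hcompM ha hb).
  by rewrite mulrCA yb rmorphM.
have BX x n : B x -> B (x ^+ n).
  by move=> Bx; elim: n => [|n IHn]; rewrite ?expr0 // exprS; apply: BM.
have Bk (c : k) x : B x -> B (i c%:A * x).
  move=> [a ha xa]; exists (c *: a); first exact: hcompZ.
  by rewrite mulrCA xa -rmorphM mulr_algl.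
have Bsum n (F : 'I_n -> Q) : (forall j, B (F j)) -> B (\sum_j F j).
  move=> h; have B0 : B 0 by rewrite -(subrr 1); apply: BB.
  apply: (big_ind B) => // x y Bx By.
  by rewrite -[y]opprK; apply: (BB) => //; rewrite -sub0r; apply: (BB).
have fitting c : B c -> exists m h, B h /\ c ^+ m = c ^+ m.+1 * h.
  move=> Bc; have /choice[F hF] : forall n, exists b, hr_comp 2 b /\ i f * c ^+ n = i b.
    by move=> n; have [b hb e] := BX c n Bc; exists b.
  have [s [sS hs]] := hcomp_span T 2.
  have [m [N [v e]]] := @inspan_relation k T s F (fun n => hs _ (hF n).1).
  exists m, (\sum_(j < N) i (v j)%:A * c ^+ j); split.
    by apply: Bsum => j; apply/Bk/BX.
  apply: can; rewrite (hF m).2 e rmorph_sum mulrA mulr_sumr; apply: eq_bigr => j _.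
  rewrite -(mulr_algl (v j) (F _)) rmorphM -(hF _).2 exprD; ring.
have [n [a [a1 aS]]] := hcomp_gens T; have [b hb fE] := aS 1%N f f2.
(* Writing f as a sum of products a_j b_j of linear forms gives 1 as the sum of the pairings of a_j
   with b_j / f. *)
have [||x [y [[l hl ->] [l' hl' yl] xy]]] := @pairing_unit Q B M M' B1 BB BM M0 MD MZ M'0 M'D M'Z MM' fitting
  [seq (i (a j), i (b j) * g) | j <- enum 'I_n].
- move=> _ /mapP[j _ ->]; split; first by exists (a j).
  by exists (b j) => //; rewrite mulrCA fg mulr1.
- rewrite big_map big_enum /= -fg fE rmorph_sum mulr_suml; apply: eq_bigr => j _.
  by rewrite rmorphM mulrA.
exists l, l'; split=> //; apply: iinj.
by rewrite rmorphM -yl mulrCA xy mulr1.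
Qed.

End QuadraticForm.

(** * Hypersurface presentations of a ring with vanishing cubics *)

Section Reduction.
Variables (k : fieldType) (T R : homog_ring k) (phi : {lrmorphism T -> R}).

Lemma hcomp_vanish (n : nat) : (forall x : T, hr_comp n x -> x = 0) ->
  forall i (x : T), (n <= i)%N -> hr_comp i x -> x = 0.
Proof.
move=> h; elim=> [|i IHi] x; first by rewrite leqn0 => /eqP n0; rewrite -n0; apply: h.
rewrite leq_eqVlt => /orP[/eqP e|ni]; first by rewrite -e; apply: h.
have [m [a [a1 aS]]] := hcomp_gens T; move=> /aS[b hb ->].
by rewrite big1 // => j _; rewrite (IHi (b j)) ?mulr0.
Qed.

Lemma cubic_hypersurface_gorenstein (f : T) : hr_comp 3 f -> (forall x, f * x = 0 -> x = 0) ->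
  residue_iso [:: f] phi -> (forall i (y : R), (3 <= i)%N -> hr_comp i y -> y = 0) ->
  gorenstein R.
Proof.
move=> f3 freg phiR R3; have [g ps pk] := residue_iso1 phiR.
have T3 x : hr_comp 3 x -> exists c : k, x = c *: f.
  move=> hx; have /pk[a e] : phi x = 0 by apply: (R3 3%N) => //; apply: g.
  have [b /hcomp0P[c ->] ->] := @homog_cofactor _ _ 3 0 _ _ _ f3 hx e.
  by exists c; rewrite mulr_algr.
have f0 : f <> 0.
  by move=> f0; have := @freg 1; rewrite f0 mul0r => /(_ erefl)/eqP; rewrite oner_eq0.
(* Since x y is a nonzero multiple of [f], the quadric [y] is regular; multiplication by it embeds
   T_1 into T_3 = k f. *)
have [x [y [hx hy xy0]]] : exists x y : T, [/\ hr_comp 1 x, hr_comp 2 y & x * y <> 0].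
  apply: contrapT => h; apply: f0; have [m [a [a1 aS]]] := hcomp_gens T.
  have [b hb ->] := aS 2%N f f3; rewrite big1 // => j _.
  by apply: contrapT => h'; apply: h; exists (a j), (b j).
have [c xyE] := T3 _ (hcompM hx hy).
have c0 : c != 0 by apply/eqP => c0; apply: xy0; rewrite xyE c0 scale0r.
have yreg z : y * z = 0 -> z = 0.
  move=> yz; apply: freg; have -> : f = c^-1 *: (x * y) by rewrite xyE scalerA mulVf // scale1r.
  by rewrite -scalerAl -mulrA yz mulr0 scaler0.
have T1 u : hr_comp 1 u -> exists d : k, u = d *: x.
  move=> hu; have [d e] := T3 _ (hcompM hu hy); exists (d / c).
  apply/eqP; rewrite -subr_eq0; apply/eqP/yreg; rewrite mulrC mulrBl -scalerAl xyE e.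
  by rewrite scalerA -mulrA mulVf // mulr1 subrr.
have Tn i u : hr_comp i u -> exists d : k, u = d *: x ^+ i.
  elim: i u => [|i IHi] u; first by move=> /hcomp0P[d ->]; exists d.
  have [m [a [a1 aS]]] := hcomp_gens T; move=> /aS[b hb ->].
  have /choice[d dE] : forall j, exists d : k, a j * b j = d *: x ^+ i.+1.
    move=> j; have [d1 ->] := T1 _ (a1 j); have [d2 ->] := IHi _ (hb j).
    by exists (d1 * d2); rewrite -scalerAl -scalerAr scalerA exprS.
  by exists (\sum_j d j); rewrite scaler_suml; apply: eq_bigr => j _; rewrite dE.
have Rn i (z : R) : hr_comp i z -> exists d : k, z = d *: phi x ^+ i.
  move=> hz; have [u hu <-] := graded_lift phiR hz; have [d ->] := Tn _ _ hu.
  by exists d; rewrite linearZ /= rmorphXn.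
have hX i : hr_comp i (phi x ^+ i) by have := hcompX i (g _ _ hx); rewrite mul1n.
have w0 : phi x ^+ 2 <> 0.
  rewrite -rmorphXn => /pk[a e]; have hx2 : hr_comp 2 (x ^+ 2) by have := hcompX 2 hx.
  have x2 : x ^+ 2 = 0 by apply: homog_multiple_low f3 hx2 _ e.
  have [d yE] := Tn _ _ hy; apply: f0; have : y * 1 = 0 by rewrite yE x2 scaler0 mul0r.
  by move=> /yreg/eqP; rewrite oner_eq0.
apply: (@graded_gorenstein k R 2 (phi x ^+ 2)) => //; first by move=> z /Rn.
move=> i z i2 /Rn[d zE] z0; exists (phi x ^+ (2 - i)); first exact: hX.
rewrite zE -scalerAr -exprD subnK // => /eqP; rewrite scaler_eq0 => /orP[/eqP d0|/eqP//].
by apply: z0; rewrite zE d0 scale0r.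
Qed.

Lemma hypersurface_quadric (f : T) e : hr_comp e f -> (2 <= e)%N -> (forall x, f * x = 0 -> x = 0) ->
  residue_iso [:: f] phi -> (forall i (y : R), (3 <= i)%N -> hr_comp i y -> y = 0) ->
  ~ gorenstein R -> hr_comp 2 f /\ exists l l', quadric_factor phi l l' f.
Proof.
move=> fe e2 freg phiR R3 ng; have [g ps pk] := residue_iso1 phiR.
have T3 x : hr_comp 3 x -> exists a, x = f * a.
  by move=> hx; apply/pk/(R3 3%N) => //; apply: g.
move: e2; rewrite leq_eqVlt => /orP[/eqP e2|].
  rewrite -e2 in fe; split=> //.
  have f3 x : hr_comp 3 x -> exists2 z, hr_comp 1 z & x = f * z.
    by move=> hx; have [a e'] := T3 x hx; exact: (@homog_cofactor _ _ 2 1 _ _ _ fe hx e').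
  have [l [l' [hl hl' fE]]] := quadric_product fe freg f3.
  (* The cubic l' y equals f z; multiplying by [l] gives f y = f l z, and [f] cancels. *)
  exists l, l'; split=> // y hy; have [z hz ez] := f3 _ (hcompM hl' hy).
  exists z => //; apply/eqP; rewrite -subr_eq0; apply/eqP/freg.
  have -> : f * (y - l * z) = l * (l' * y) - f * (l * z) by rewrite fE; ring.
  by rewrite ez; ring.
rewrite leq_eqVlt => /orP[/eqP e3|e4].
  by case: ng; rewrite -e3 in fe; exact: cubic_hypersurface_gorenstein fe freg phiR R3.
have T30 (x : T) : hr_comp 3 x -> x = 0.
  by move=> hx; have [a ea] := T3 x hx; exact: homog_multiple_low fe hx e4 ea.
have f0 : f = 0 by apply: (hcomp_vanish T30 _ fe); apply: ltnW.
by have := @freg 1; rewrite f0 mul0r => /(_ erefl)/eqP; rewrite oner_eq0.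
Qed.

End Reduction.

(* A regular element g of degree at least 2 cannot be a further layer of the
   deformation: lifting l l' = f through g either makes g a multiple of l, or
   makes g the only quadric modulo l. *)
Lemma quadric_factor_undeformed (k : fieldType) (U T R : homog_ring k)
    (phi : {lrmorphism T -> R}) (p : {lrmorphism U -> T}) l l' f (g : U) e :
  quadric_factor phi l l' f -> ~ gorenstein R ->
  hr_comp e g -> (2 <= e)%N -> (forall x, g * x = 0 -> x = 0) -> residue_iso [:: g] p -> False.
Proof.
move=> D ng ge e2 greg pR; have [t [t1 it st t2]] := quadric_basis2 D ng.
have [pg ps pk] := residue_iso1 pR.
have [L L1 Ll] := graded_lift pR (quadric_l1 D).
have [L' L'1 Ll'] := graded_lift pR (quadric_l'1 D).
have g0 : g <> 0.
  by move=> g0; have := @greg 1; rewrite g0 mul0r => /(_ erefl)/eqP; rewrite oner_eq0.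
(* If g = L w, then f p(w) is the image of L' g, hence 0, so w is a multiple of [g] of smaller
   degree and vanishes. *)
have noL w i : hr_comp i w -> (i < e)%N -> g <> L * w.
  move=> hw ie gw; have /pk[a wa] : p w = 0.
    apply: (quadric_regf D); rewrite (quadric_f D) -Ll -Ll' -!rmorphM.
    by apply/pk; exists L'; rewrite gw; ring.
  by apply: g0; rewrite gw (homog_multiple_low ge hw ie wa) mulr0.
have inj1 (x : U) : hr_comp 1 x -> p x = 0 -> x = 0.
  by move=> hx /pk[a xa]; apply: homog_multiple_low ge hx e2 xa.
move: e2; rewrite leq_eqVlt => /orP[/eqP ee|e3]; last first.
  (* For e >= 3 the kernel of [p] starts above degree 2, so T_2 = l T_1 lifts to [U], and [g]
     becomes a multiple of [L]. *)
  have U2 (y : U) : hr_comp 2 y -> exists2 z, hr_comp 1 z & y = L * z.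
    move=> hy; have [z hz yz] := quadric_comp D (pg _ _ hy).
    have [Z hZ Zz] := graded_lift pR hz; exists Z => //.
    apply/eqP; rewrite -subr_eq0; apply/eqP.
    have /pk[a ea] : p (y - L * Z) = 0 by rewrite rmorphB rmorphM /= Ll Zz yz subrr.
    apply: homog_multiple_low ge _ e3 ea; apply: hcompB => //.
    exact: (@hcompM _ _ 1 1).
  have Un i (y : U) : hr_comp i.+2 y -> exists2 z, hr_comp i.+1 z & y = L * z.
    elim: i y => [|i IHi] y; first exact: U2.
    have [n [a [a1 aS]]] := hcomp_gens U.
    move=> /aS[b hb ->]; have /choice[c hc] : forall j, exists z, hr_comp i.+1 z /\ b j = L * z.
      by move=> j; have [z hz ej] := IHi _ (hb j); exists z.
    exists (\sum_j a j * c j).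
      by apply: hcomp_sum => j _; rewrite -add1n; apply: hcompM => //; exact: (hc j).1.
    by rewrite mulr_sumr; apply: eq_bigr => j _; rewrite (hc j).2 mulrCA.
  case: e ge noL inj1 e3 => [|[|e]] // ge noL _ _.
  by have [w hw gw] := Un _ _ ge; exact: noL hw (ltnSn _) gw.
rewrite -{e}ee in ge noL.
have U2 (y : U) : hr_comp 2 y -> exists z (c : k), hr_comp 1 z /\ y = L * z + c *: g.
  move=> hy; have [z hz yz] := quadric_comp D (pg _ _ hy).
  have [Z hZ Zz] := graded_lift pR hz; exists Z.
  have /pk[a ea] : p (y - L * Z) = 0 by rewrite rmorphB rmorphM /= Ll Zz yz subrr.
  have h2 : hr_comp (2 + 0) (y - L * Z) by apply: hcompB => //; exact: (@hcompM _ _ 1 1).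
  have [b /hcomp0P[c ->] e'] := homog_cofactor ge h2 ea.
  by exists c; split=> //; rewrite -mulr_algr -e' addrC subrK.
(* Reduction gives l p(y) = 0, so y = g c, and cancelling [g] gives x = L c with c of degree 0. *)
have gL x y : hr_comp 1 x -> g * x = L * y -> exists c : k, x = c *: L.
  move=> hx gx; have /pk[c yc] : p y = 0.
    by apply: (quadric_regl D); rewrite -Ll -rmorphM -gx; apply/pk; exists x.
  have xL : x = L * c.
    by apply/eqP; rewrite -subr_eq0; apply/eqP/greg; rewrite mulrBr gx yc; ring.
  have [b /hcomp0P[d ->] ->] := @homog_cofactor _ _ 1 0 _ _ _ L1 hx xL.
  by exists d; rewrite mulr_algr.
(* If every product of linear forms lay in L U_1, so would [g]. *)
have [x [y [v [c [hx hy c0 xy]]]]] : exists (x y v : U) (c : k),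
    [/\ hr_comp 1 x, hr_comp 1 y, c != 0 & x * y = L * v + c *: g].
  apply: contrapT => h; have [n [a [a1 aS]]] := hcomp_gens U.
  have [b hb gE] := aS 1%N g ge.
  have /choice[w wE] : forall j, exists z, hr_comp 1 z /\ a j * b j = L * z.
    move=> j; have [z [d [hz ez]]] := U2 _ (hcompM (a1 j) (hb j)).
    exists z; split=> //; have [d0|d0] := eqVneq d 0; first by rewrite ez d0 scale0r addr0.
    by case: h; exists (a j), (b j), z, d.
  apply: (noL (\sum_j w j) 1%N) => //; first by apply: hcomp_sum => j _; exact: (wE j).1.
  by rewrite gE mulr_sumr; apply: eq_bigr => j _; exact: (wE j).2.
(* Comparing (x y) z with x (y z) gives g (c z - d x) as a multiple of [L], so c z - d x lies in k
   L; hence U_1 is spanned by [L] and [x]. *)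
have sp (z : U) : hr_comp 1 z -> exists a b : k, z = a *: L + b *: x.
  move=> hz; have [v' [d [_ yz]]] := U2 _ (hcompM hy hz).
  have [||a ea] := gL (c *: z - d *: x) (x * v' - z * v).
  - by apply: hcompB; exact: hcompZ.
  - have : x * y * z = x * (y * z) by rewrite mulrA.
    rewrite xy yz -(mulr_algl c g) -(mulr_algl c z) -(mulr_algl d g) -(mulr_algl d x).
    move: (c%:A : U) (d%:A : U) => C C' exyz; apply/eqP; rewrite -subr_eq0; apply/eqP.
    have -> : g * (C * z - C' * x) - L * (x * v' - z * v) =
       (L * v + C * g) * z - x * (L * v' + C' * g) by ring.
    by rewrite exyz subrr.
  exists (c^-1 * a), (c^-1 * d).
  by rewrite -!scalerA -ea -scalerDr subrK scalerA mulVf // scale1r.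
have spT (z : T) : hr_comp 1 z -> exists a b : k, z = a *: l + b *: p x.
  move=> hz; have [Z hZ <-] := graded_lift pR hz; have [a [b ->]] := sp _ hZ.
  by exists a, b; rewrite linearD !linearZ /= Ll.
case: t t1 it t2 {st} => [|t0 [|t1 t]] // ht it _.
have [a0 [b0 e0]] := spT t0 (ht _ (mem_head _ _)).
have [a1 [b1 e1]] : exists a b : k, t1 = a *: l + b *: p x.
  by apply/spT/ht; rewrite !inE eqxx orbT.
(* Three forms in the span of l and p(x): this combination cancels both coordinates. Independence
   gives b0 = 0, after which t0 = a0 l is itself a dependence. *)
have /it h : lc [:: l, t0, t1 & t] (fun i => nth 0 [:: a1 * b0 - a0 * b1; b1; - b0] i) = 0.
  rewrite !lc_cons /= /lc big1 ?addr0 => [|i _]; last by rewrite ?nth_nil scale0r.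
  rewrite e0 e1 !scalerDr !scalerA (addrACA (_ *: l)) -!scalerDl addrA -scalerDl.
  have -> : a1 * b0 - a0 * b1 + (b1 * a0 + - b0 * a1) = 0 by ring.
  have -> : b1 * b0 + - b0 * b1 = 0 by ring.
  by rewrite !scale0r addr0.
have b00 : b0 = 0 by apply/eqP; rewrite -oppr_eq0; apply/eqP/(h 2%N).
have /it h' : lc [:: l, t0, t1 & t] (fun i => nth 0 [:: - a0; 1] i) = 0.
  rewrite !lc_cons /= /lc big1 ?addr0 => [|i _]; last by rewrite ?nth_nil scale0r.
  rewrite ?nth_nil scale0r addr0 e0 b00 scale0r addr0 scale1r scaleNr.
  by rewrite addNr.
by have /eqP := h' 1%N isT; rewrite oner_eq0.
Qed.

(** * The equivalence *)

Lemma quadric_minimal_multiplicity (k : fieldType) (R S : homog_ring k) (f l l' : S)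
    (phi : {lrmorphism S -> R}) :
  krull_dim S 1 -> quadric_factor phi l l' f -> minimal_multiplicity S.
Proof.
move=> kS D; have l1 := quadric_l1 D.
have lm : hr_max l := hr_max_hcomp l1.
have [_ _ mM] := hr_max_ideal S.
have m2 x : ideal_exp (@hr_max k S) 2 x -> exists2 z, hr_max z & x = l * z.
  move=> hx; have [N hN] := hc_sum x.
  have /choice[c cE] : forall i, exists z, hr_comp i.+1 z /\ hc i.+2 x = l * z.
    by move=> i; have [z hz e] := quadric_comp D (hc_comp i.+2 x); exists z.
  exists (\sum_(i < N) c i).
    apply: ideal_sum; first exact: hr_max_ideal.
    by move=> i _; exact: hr_max_hcomp (cE i).1.
  rewrite {1}(hN N.+2); last by rewrite ltnW.
  rewrite !big_ord_recl (hr_max_exp_hc hx) // (hr_max_exp_hc hx) // !add0r mulr_sumr.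
  by apply: eq_bigr => i _; exact: (cE i).2.
exists [:: l].
  split=> //; first by move=> x /=; rewrite inE => /eqP->.
  by exists 2%N => x /m2[z _ ->]; apply/ideal_span1; exists z.
apply/seteqP; split=> x.
  move=> [s [hs ->]]; exists s; split=> // p /hs[/ideal_span1[a ->] hp].
  split; first by rewrite mulrC; apply: mM.
  exists [:: (p.2, 1)]; rewrite big_seq1 mulr1; split=> // q.
  by rewrite inE => /eqP->.
move=> /m2[z hz ->]; exists [:: (l, z)]; rewrite big_seq1; split=> // p.
by rewrite inE => /eqP-> /=; split=> //; apply: ideal_span_mem; rewrite inE.
Qed.

(** For a sequence of length 1 the ring [S] itself serves. For a longer one, with last elements [g]
    and [f], the quotient T by all but [f] and the quotient U by all but [g] and [f] are ruled out
    by [quadric_factor_undeformed]. *)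
Lemma deformation_minmult (k : fieldType) (R : homog_ring k) :
  ~ gorenstein R -> nontrivial_deformation R ->
  (forall i (x : R), (3 <= i)%N -> hr_comp i x -> x = 0) ->
  exists (S : homog_ring k) (f : S) (phi : {lrmorphism S -> R}), minmult_deformation f phi.
Proof.
move=> ng [S [d [s [phi [cmS [kS d0] [sreg sd] sdeg phiR]]]]] R3.
have nt i x : (i < size s)%N -> ideal_span (take i s) (nth 0 s i * x) -> ideal_span (take i s) x.
  by move=> si; apply: sreg.2.
have s1 := sreg.1.
case/lastP: s sd sreg sdeg phiR nt s1 => [sd|s f]; first by rewrite -sd in d0.
rewrite size_rcons => sd sreg sdeg phiR nt s1.
have [e e2 fe] : exists2 e, (2 <= e)%N & hr_comp e f by apply: sdeg; rewrite mem_rcons inE eqxx.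
have last_reg x : ideal_span s (f * x) -> ideal_span s x.
  have := nt (size s) x (ltnSn _); rewrite -cats1 take_size_cat // nth_cat ltnn subnn; exact.
case/lastP: s sd sreg sdeg phiR nt last_reg s1 => [|s g] sd sreg sdeg phiR nt last_reg s1.
  have freg x : f * x = 0 -> x = 0 by have := last_reg x; rewrite ideal_span_nil; exact.
  have [f2 [l [l' D]]] := hypersurface_quadric fe e2 freg phiR R3 ng.
  have kS1 : krull_dim S 1 by rewrite sd.
  exists S, f, phi; split=> //; exact: quadric_minimal_multiplicity kS1 D.
exfalso; have sub (u : seq S) y : ideal_span u 1 -> ideal_span (rcons u y) 1.
  by rewrite ideal_span_rcons => h; exists 0; rewrite mulr0 subr0.
have sh (h : S) : h \in rcons (rcons s g) f -> exists e, hr_comp e h.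
  by move=> /sdeg[e' _ he]; exists e'.
have [T [q qR]] : exists (T : homog_ring k) (q : {lrmorphism S -> T}), residue_iso (rcons s g) q.
  apply: homog_ideal_quotient; first by move=> /sub/s1.
  by move=> h hs; apply: sh; rewrite mem_rcons inE hs orbT.
have [U [u uR]] : exists (U : homog_ring k) (u : {lrmorphism S -> U}), residue_iso s u.
  apply: homog_ideal_quotient; first by move=> /(sub _ g)/sub/s1.
  by move=> h hs; apply: sh; rewrite !(mem_rcons, inE) hs !orbT.
have [p [pR pq]] := residue_iso_factor uR qR.
have [psi [psiR psiq]] := residue_iso_factor qR phiR.
have [e' e'2 ge] : exists2 e, (2 <= e)%N & hr_comp e g.
  by apply: sdeg; rewrite !(mem_rcons, inE) eqxx orbT.
have [ug us uk] := uR; have [qg qs qk] := qR.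
have freg x : q f * x = 0 -> x = 0.
  have [y <-] := qs x; rewrite -rmorphM -[_ = 0]/(kernel q _) -[q y = 0]/(kernel q y) qk.
  exact: last_reg.
have greg x : u g * x = 0 -> x = 0.
  have [y <-] := us x; rewrite -rmorphM -[_ = 0]/(kernel u _) -[u y = 0]/(kernel u y) uk.
  have := nt (size s) y; rewrite !size_rcons => /(_ (leqnSn _)).
  rewrite -!cats1 -catA take_size_cat // nth_cat ltnn subnn; exact.
have [_ [l [l' D]]] := hypersurface_quadric (qg _ _ fe) e2 freg psiR R3 ng.
exact: quadric_factor_undeformed D ng (ug _ _ ge) e'2 greg pR.
Qed.

Theorem theorem4p2 (k : fieldType) (R : homog_ring k) :
  is_artinian R -> ~ gorenstein R -> nontrivial_deformation R ->
  let c1 := (exists M : lmodType R, [/\ fin_gen M, ~ fin_free M & Gdim_zero M])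
            /\ ideal_exp (@hr_max k R) 3 = [set 0] in
  let c2 := exists2 r : nat, (2 <= r)%N &
              hilbert_series R
                (fun i => ((1 + 'X) * (1 + r *: 'X) : {poly nat})`_i) in
  let c3 := exists (S : homog_ring k) (f : S) (phi : {lrmorphism S -> R}),
              minmult_deformation f phi in
  [/\ c1 <-> c2, c2 <-> c3 &
      forall (S : homog_ring k) (f : S) (phi : {lrmorphism S -> R}),
        minmult_deformation f phi ->
        forall M : lmodType R, fin_gen M ->
          Gdim M = (pd (restr phi M) - 1)%E /\
          ((exists x : M, x <> 0) -> Gdim M = CIdim M)].
Proof.
move=> _ ng def c1 c2 c3.
have c13 : c1 -> c3.
  by move=> [_ /hr_max_exp_eq0 R3]; apply: deformation_minmult => // i x i3; apply: R3.
have c32 : c3 -> c2.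
  by move=> [S [f [phi /minmult_factor[l [l' D]]]]]; exact: quadric_factor_hilbert D ng.
have c31 : c3 -> c1.
  move=> [S [f [phi /minmult_factor[l [l' D]]]]].
  by split; [exact: quadric_factor_Gdim_zero D|exact: quadric_factor_max3 D].
have c23 : c2 -> c3.
  (* The polynomial has degree at most 2, so the components from degree 3 on have an empty basis. *)
  move=> [r _ H]; apply: deformation_minmult => // -[|[|[|i]]] // x _ hx.
  have := H i.+3; rewrite mulrDl mul1r coefD coefXM !coefD !coefZ !coefX !coef1 /=.
  rewrite /GRing.add /GRing.mul /= ?muln0 ?addn0 => -[b [_ /(_ x hx)[c [-> _]]]].
  by rewrite big_ord0.
split; [split=> [/c13/c32//|/c23/c31//] | by split | ].
move=> S f phi mm M fM; have [l [l' D]] := minmult_factor mm.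
by have [[cmS _] _ _ _ _] := mm; exact: quadric_Gdim D cmS ng M fM.
Qed.
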